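(* Consider the DOSP-S algorithm under the model and assumptions listed in the context, with $\beta_\ell=\beta_0\ell^{-c_1}$, $\gamma_\ell=\gamma_0\ell^{-c_2}$, and $D_k$, $K_2$ as defined there. If the value of $\beta_0\gamma_0<\infty$ is large enough, then there exists $\Xi<\infty$ such that $$D_k\le\Xi\,q_r^{-1}(q_ak)^{-\min\{2c_2,\,c_1-c_2\}}\qquad\forall k\ge K_2.$$ For $c_1=0.75$ and $c_2=0.25$ the upper bound on $D_k$ has the optimum decreasing order (over the admissible pairs $(c_1,c_2)$), i.e. $D_k=O\big(q_r^{-1}(q_ak)^{-0.5}\big)$.
   Context: Model. There are $N$ nodes, $\mathcal N=\{1,\dots,N\}$, and time-slots $k=1,2,\dots$. The indicator $\delta_{i,k}\in\{0,1\}$ tells whether node $i$ is active at slot $k$; the $\delta_{i,k}$ are i.i.d. with $\mathbb P(\delta_{i,k}=1)=q_a\in(0,1]$, and $\lambda=Nq_a<\infty$. The number of active nodes is binomial with mean $\lambda$ (if $N\to\infty$, $q_a$ is small so that $\lambda<\infty$ and the number is Poisson with parameter $\lambda$). Put $\boldsymbol\delta_k=(\delta_{1,k},\dots,\delta_{N,k})^T$ and $\mathcal N^{(k)}=\{i:\delta_{i,k}=1\}$. Actions take values in $\mathcal A_i=[a_{i,\min},a_{i,\max}]$; $\mathcal A=\mathcal A_1\times\cdots\times\mathcal A_N$. The environment states $\mathbf S_k\in\mathcal S$ are i.i.d. random matrices. The symbol $\circ$ is the element-wise product and $\|\cdot\|$ the Euclidean norm. Utilities. Each node has a real local utility function $u_i(\boldsymbol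 a,\boldsymbol\delta,\mathbf S)$ of the action vector $\boldsymbol a$, the activity vector $\boldsymbol\delta\in\{0,1\}^N$ and the environment state $\mathbf S\in\mathcal S$, with $u_i=0$ if $\delta_i=0$. Put $f=\sum_{i:\delta_i=1}u_i$, $G(\boldsymbol a,\boldsymbol\delta)=\mathbb E_{\mathbf S}f(\boldsymbol a,\boldsymbol\delta,\mathbf S)$, $F(\boldsymbol a)=\mathbb E_{\boldsymbol\delta,\mathbf S}f(\boldsymbol a,\boldsymbol\delta,\mathbf S)$. Observations. At slot $k$, if $\widehat{\boldsymbol a}$ is the performed action vector, active node $i$ observes $\widetilde u_{i,k}=u_i(\widehat{\boldsymbol a},\boldsymbol\delta_k,\mathbf S_k)+\eta_{i,k}$, where the noises $\eta_{i,k}$ are independent with mean $0$ and variance $\sigma_\eta^2<\infty$. Active node $i$ receives $\widetilde u_{j,k}$ for $j$ in a random set $\mathcal I^{(i,k)}\subseteq\mathcal N^{(k)}\setminus\{i\}$; each $j\in\mathcal N^{(k)}\setminus\{i\}$ belongs to it with constant probability $q_r\in(0,1]$ (the joint probability that $j$ is a neighbor of $i$ and that the transmission succeeds), independently over $j$. Node $i$ computes $\widetilde f_{i,k}=\widetilde u_{i,k}+q_r^{-1}\sum_{j\in\mathcal I^{(i,k)}}\widetilde u_{j,k}$. Regularity. (a) $G(\boldsymbol a,\boldsymbol\delta)$ and $F(\boldsymbol a)$ are first and second order differentiable functions of $\boldsymbol a\in\mathcal A$; the optimal point $\boldsymbol a^*\in\mathcal A$ (maximizer of $F$ over $\mathcal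 A$) exists, with $\partial F(\boldsymbol a^* )/\partial a_i=0$, $\partial^2F(\boldsymbol a^* )/\partial a_i^2<0$ and $a_i^*\in(a_{i,\min},a_{i,\max})$ for all $i$; and $F$ is strictly concave: $(\boldsymbol a-\boldsymbol a')^T(\nabla F(\boldsymbol a)-\nabla F(\boldsymbol a'))<0$ for all $\boldsymbol a\ne\boldsymbol a'$ in $\mathcal A$. (b) There is $\alpha_G\in(0,\infty)$ with $|\partial^2G(\boldsymbol a,\boldsymbol\delta)/\partial a_i\partial a_j|\le\alpha_G$ for all active $i,j$ ($\delta_i=\delta_j=1$). (c) For any $\boldsymbol\delta,\mathbf S$, $|u_i(\boldsymbol a,\boldsymbol\delta,\mathbf S)-u_i(\boldsymbol a',\boldsymbol\delta,\mathbf S)|\le L_{\mathbf S}\|(\boldsymbol a-\boldsymbol a')\circ\boldsymbol\delta\|$ with $L_{\mathbf S}<\infty$ and $L=\sqrt{\mathbb E(L_{\mathbf S}^2)}<\infty$. (d) Strong concavity: there is $\alpha_F>0$ with $(\boldsymbol a-\boldsymbol a^* )^T\nabla F(\boldsymbol a)\le-\alpha_F\|\boldsymbol a-\boldsymbol a^*\|^2$ for all $\boldsymbol a\in\mathcal A$. Parameters. $\beta_\ell=\beta_0\ell^{-c_1}$, $\gamma_\ell=\gamma_0\ell^{-c_2}$ for $\ell\ge1$, with $\beta_0,\gamma_0>0$, $c_1\in(0.5,1)$, $c_2\in(0,1-c_1]$ (the admissible pairs; so $\sum\beta_\ell\gamma_\ell=\infty$, $\sum\beta_\ell^2<\infty$).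 The perturbations $\Phi_{i,k}$ are i.i.d., mean zero, with $\mathbb E(\Phi_{i,k}^2)=\sigma_\Phi^2$, $\sigma_\Phi>0$, and $|\Phi_{i,k}|\le\alpha_\Phi$, $\alpha_\Phi>0$. There is $K_0<\infty$ with $\alpha_\Phi\gamma_\ell\le\min_{i}\min\{|a_{i,\max}-a_i^*|,|a_{i,\min}-a_i^*|\}$ for all $\ell\ge K_0$. Random step-sizes. $\widetilde\ell_{i,k}\sim\mathrm{Binomial}(k-1,q_a)$, generated independently by each node; $\ell_{i,k}=\widetilde\ell_{i,k}+\delta_{i,k}$, $\widetilde\beta_{i,k}=\delta_{i,k}\beta_{\ell_{i,k}}$, $\widetilde\gamma_{i,k}=\delta_{i,k}\gamma_{\ell_{i,k}}$ (both $0$ if $\delta_{i,k}=0$). The variables $\widetilde\ell$, $\Phi$, $\eta$, $\mathbf S$, $\delta$ and the receptions are mutually independent, and independent across time-slots. DOSP-S algorithm. $a_{i,1}$ is chosen randomly in $[a_{i,\min}+\alpha_\Phi\widetilde\gamma_{i,1},a_{i,\max}-\alpha_\Phi\widetilde\gamma_{i,1}]$. At slot $k$ the performed action is $\boldsymbol a_k+\widetilde{\boldsymbol\gamma}_k\circ\boldsymbol\Phi_k$, $\widetilde f_{i,k}$ is computed from the resulting observations, and for every $i$ $$\widetilde a_{i,k+1}=a_{i,k}+\widetilde\beta_{i,k}\Phi_{i,k}\widetilde f_{i,k},\qquad a_{i,k+1}=\min\{\max\{\widetilde a_{i,k+1},\,a_{i,\min}+\alpha_\Phi\widetilde\gamma_{i,k+1}\},\,a_{i,\max}-\alpha_\Phi\widetilde\gamma_{i,k+1}\}.$$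 The projection is applied to ensure that the performed actions belong to $\mathcal A$. Further notation. $D_k=N^{-1}\mathbb E(\|\boldsymbol a_k-\boldsymbol a^*\|^2)$ (expectation over all random terms). $\overline{\beta\gamma}_k=\mathbb E(\widetilde\beta_{i,k}\widetilde\gamma_{i,k})$, $\overline{\beta^2}_k=\mathbb E(\widetilde\beta_{i,k}^2)$ (the same for every $i$). $\varDelta_k=\alpha_\Phi^2\gamma_0^2N^{-1}\sum_i\delta_{i,k}\iota_{i,k}$ with $\iota_{i,k}=1$ if $\widetilde\ell_{i,k}<K_0-1$ and $0$ otherwise; $K_1\ge K_0$ and $\widetilde C>0$ are bounded constants with $\mathbb E(\varDelta_k)\le\widetilde C\,\overline{\beta^2}_{k-1}$ for all $k\ge K_1$ (such constants exist). With $\theta_k=q_a^{-1}\overline{\beta\gamma}_k$ and $A=2\sigma_\Phi^2\alpha_F$, $K_2$ is the minimum value of $k\ge K_1$ such that $\theta_k<A^{-1}$.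
   Formalization: The utilities are additionally assumed to have finite second moments, E u_i(a,δ,S)² < ∞ for a in A, and u_i and L_S to be measurable in S; without finite second moments the claimed rate fails for heavy-tailed additive states. *)

(* Defs.v *)
From HB Require Import structures.
From mathcomp Require Import all_boot all_order all_algebra.
From mathcomp Require Import all_classical all_reals all_analysis.

Set Implicit Arguments.
Unset Strict Implicit.
Unset Printing Implicit Defensive.
Import Order.TTheory GRing.Theory Num.Theory.
Import numFieldNormedType.Exports.
Local Open Scope classical_set_scope.
Local Open Scope ring_scope.

Definition dotv (R : realType) (N : nat) (x y : 'rV[R]_N) : R :=
  \sum_i x 0 i * y 0 i.

(* The library norm on 'rV is the sup norm. *)
Definition enorm (R : realType) (N : nat) (x : 'rV[R]_N) : R :=
  Num.sqrt (dotv x x).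

(* Differentiability is relative to the set A (one-sided on the boundary of a
   box), so the values of f outside A play no role. On a box with nonempty
   interior the gradient is unique; at an interior point it is the usual one. *)
Definition is_grad (R : realType) (N : nat) (A : set 'rV[R]_N)
    (f : 'rV[R]_N -> R) (a g : 'rV[R]_N) : Prop :=
  forall e : R, 0 < e ->
    \forall x \near within A (nbhs a),
      `|f x - f a - dotv g (x - a)| <= e * `|x - a|.

Definition grad (R : realType) (N : nat) (A : set 'rV[R]_N)
    (f : 'rV[R]_N -> R) (a : 'rV[R]_N) : 'rV[R]_N :=
  xget 0 [set g | is_grad A f a g].

Definition partial (R : realType) (N : nat) (A : set 'rV[R]_N) (i : 'I_N)
    (f : 'rV[R]_N -> R) (a : 'rV[R]_N) : R := grad A f a 0 i.

Definition differentiable_on (R : realType) (N : nat) (A : set 'rV[R]_N)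
    (f : 'rV[R]_N -> R) : Prop :=
  forall a, A a -> exists g, is_grad A f a g.

Definition twice_differentiable_on (R : realType) (N : nat)
    (A : set 'rV[R]_N) (f : 'rV[R]_N -> R) : Prop :=
  differentiable_on A f /\ forall i, differentiable_on A (partial A i f).

Definition sigma_rv d d' (Omega : measurableType d) (T : measurableType d')
    (X : Omega -> T) : set_system Omega :=
  preimage_set_system setT X measurable.

Definition mutually_independent (R : realType) d (Omega : measurableType d)
    (P : probability Omega R) (I : Type) (D : set I)
    (F : I -> set_system Omega) : Prop :=
  forall (m : nat) (t : 'I_m -> I) (B : 'I_m -> set Omega),
    injective t -> (forall j, D (t j)) -> (forall j, F (t j) (B j)) ->
    P (\big[setI/setT]_(j < m) B j) = (\prod_(j < m) P (B j))%E.

Definition independent2 (R : realType) d (Omega : measurableType d)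
    (P : probability Omega R) (F1 F2 : set_system Omega) : Prop :=
  forall B1 B2, F1 B1 -> F2 B2 -> P (B1 `&` B2) = (P B1 * P B2)%E.

Definition activity (n : nat) : Type := {ffun 'I_n.+1 -> bool}.

(* There are n.+1 nodes. Families of random variables are indexed by a node and
   a time-slot k; slots are k = 1, 2, ..., and nothing is assumed at k = 0.
   [recv i j k] is the event that, provided j is active at slot k, node i
   receives the utility of node j. *)
Record dosp_model (R : realType) d (Omega : measurableType d)
    (P : probability Omega R) d' (T : measurableType d') (n : nat) := DospModel {
  qa : R;
  qr : R;
  sigma_eta : R;
  sigma_Phi : R;
  alpha_Phi : R;
  alpha_G : R;
  alpha_F : R;
  amin : 'rV[R]_n.+1;
  amax : 'rV[R]_n.+1;
  astar : 'rV[R]_n.+1;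
  utility : 'I_n.+1 -> 'rV[R]_n.+1 -> activity n -> T -> R;
  lipS : T -> R;
  delta : 'I_n.+1 -> nat -> {RV P >-> bool};
  state : nat -> {RV P >-> T};
  eta : 'I_n.+1 -> nat -> {RV P >-> R};
  recv : 'I_n.+1 -> 'I_n.+1 -> nat -> {RV P >-> bool};
  ellt : 'I_n.+1 -> nat -> {RV P >-> nat};
  Phi : 'I_n.+1 -> nat -> {RV P >-> R} }.

Definition actions (R : realType) d (Omega : measurableType d)
    (P : probability Omega R) d' (T : measurableType d') (n : nat)
    (M : dosp_model P T n) : set 'rV[R]_n.+1 :=
  [set a | forall i, amin M 0 i <= a 0 i <= amax M 0 i].

Definition active (R : realType) d (Omega : measurableType d)
    (P : probability Omega R) d' (T : measurableType d') (n : nat)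
    (M : dosp_model P T n) (k : nat) (w : Omega) : activity n :=
  [ffun i => delta M i k w].

Definition total_utility (R : realType) d (Omega : measurableType d)
    (P : probability Omega R) d' (T : measurableType d') (n : nat)
    (M : dosp_model P T n) (a : 'rV[R]_n.+1) (dl : activity n) (s : T) : R :=
  \sum_(i | dl i) utility M i a dl s.

(* Activities and states are identically distributed over the slots, so the
   expectations defining G and F are taken at slot 1. *)
Definition Gfun (R : realType) d (Omega : measurableType d)
    (P : probability Omega R) d' (T : measurableType d') (n : nat)
    (M : dosp_model P T n) (dl : activity n) (a : 'rV[R]_n.+1) : R :=
  fine ('E_P[fun w => total_utility M a dl (state M 1 w)])%E.

Definition Ffun (R : realType) d (Omega : measurableType d)
    (P : probability Omega R) d' (T : measurableType d') (n : nat)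
    (M : dosp_model P T n) (a : 'rV[R]_n.+1) : R :=
  fine ('E_P[fun w => total_utility M a (active M 1 w) (state M 1 w)])%E.

Inductive source (n : nat) : Type :=
  | SrcDelta of 'I_n.+1 & nat
  | SrcState of nat
  | SrcEta of 'I_n.+1 & nat
  | SrcRecv of nat
  | SrcEll of 'I_n.+1 & nat
  | SrcPhi of 'I_n.+1 & nat.

Definition slot (n : nat) (x : source n) : nat :=
  match x with
  | SrcDelta _ k | SrcState k | SrcEta _ k | SrcRecv k
  | SrcEll _ k | SrcPhi _ k => k
  end.

(* All the receptions of one slot form a single source, so that receptions at
   different receivers may be dependent (e.g. reciprocal links). *)
Definition source_sigma (R : realType) d (Omega : measurableType d)
    (P : probability Omega R) d' (T : measurableType d') (n : nat)
    (M : dosp_model P T n) (x : source n) : set_system Omega :=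
  match x with
  | SrcDelta i k => sigma_rv (delta M i k)
  | SrcState k => sigma_rv (state M k)
  | SrcEta i k => sigma_rv (eta M i k)
  | SrcRecv k => <<s \bigcup_(p in [set: 'I_n.+1 * 'I_n.+1])
                       sigma_rv (recv M p.1 p.2 k) >>
  | SrcEll i k => sigma_rv (ellt M i k)
  | SrcPhi i k => sigma_rv (Phi M i k)
  end.

Record dosp_assumptions (R : realType) d (Omega : measurableType d)
    (P : probability Omega R) d' (T : measurableType d') (n : nat)
    (M : dosp_model P T n) : Prop := {
  qa_gt0 : 0 < qa M;
  qa_le1 : qa M <= 1;
  qr_gt0 : 0 < qr M;
  qr_le1 : qr M <= 1;
  sigma_Phi_gt0 : 0 < sigma_Phi M;
  alpha_Phi_gt0 : 0 < alpha_Phi M;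
  alpha_G_gt0 : 0 < alpha_G M;
  alpha_F_gt0 : 0 < alpha_F M;

  delta_law : forall i k, (0 < k)%N ->
    distribution P (delta M i k) =1 bernoulli_prob (qa M);
  state_law : forall k B, (0 < k)%N -> measurable B ->
    distribution P (state M k) B = distribution P (state M 1) B;
  eta_L2 : forall i k, (0 < k)%N -> (eta M i k : Omega -> R) \in Lfun P 2%:E;
  eta_mean : forall i k, (0 < k)%N -> ('E_P[eta M i k] = 0)%E;
  eta_var : forall i k, (0 < k)%N ->
    ('V_P[eta M i k] = ((sigma_eta M) ^+ 2)%:E)%E;
  recv_law : forall i j k, (0 < k)%N -> j != i ->
    distribution P (recv M i j k) =1 bernoulli_prob (qr M);
  recv_indep : forall i k, (0 < k)%N ->
    mutually_independent P [set j | j != i]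
      (fun j => sigma_rv (recv M i j k));
  ellt_law : forall i k, (0 < k)%N ->
    distribution P (ellt M i k) =1 binomial_prob k.-1 (qa M);
  Phi_law : forall i k B, (0 < k)%N -> measurable B ->
    distribution P (Phi M i k) B = distribution P (Phi M ord0 1) B;
  Phi_mean : forall i k, (0 < k)%N -> ('E_P[Phi M i k] = 0)%E;
  Phi_var : forall i k, (0 < k)%N ->
    ('E_P[fun w => ((Phi M i k w) ^+ 2)%R] = ((sigma_Phi M) ^+ 2)%:E)%E;
  Phi_bound : forall i k w, (0 < k)%N -> `|Phi M i k w| <= alpha_Phi M;
  sources_indep : mutually_independent P [set x | (0 < slot x)%N]
    (source_sigma M);

  utility_inactive : forall i a (dl : activity n) s, actions M a ->
    ~~ dl i -> utility M i a dl s = 0;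
  utility_measurable : forall i a dl, actions M a ->
    measurable_fun setT (utility M i a dl);
  (* Second moments of the utilities: without them f has no finite variance
     and the mean-square rate fails (heavy-tailed additive states). *)
  utility_L2 : forall i a dl, actions M a ->
    ('E_P[fun w => ((utility M i a dl (state M 1 w)) ^+ 2)%R] < +oo)%E;

  G_twice : forall dl, twice_differentiable_on (actions M) (Gfun M dl);
  F_twice : twice_differentiable_on (actions M) (Ffun M);
  astar_in : actions M (astar M);
  astar_max : forall a, actions M a -> Ffun M a <= Ffun M (astar M);
  astar_interior : forall i, amin M 0 i < astar M 0 i < amax M 0 i;
  astar_grad : forall i, partial (actions M) i (Ffun M) (astar M) = 0;
  astar_hess : forall i,
    partial (actions M) i (partial (actions M) i (Ffun M)) (astar M) < 0;
  F_concave : forall a a', actions M a -> actions M a' -> a <> a' ->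
    dotv (a - a') (grad (actions M) (Ffun M) a - grad (actions M) (Ffun M) a')
      < 0;
  G_hess : forall (dl : activity n) a i j, actions M a -> dl i -> dl j ->
    `|partial (actions M) i (partial (actions M) j (Gfun M dl)) a|
      <= alpha_G M;
  utility_lipschitz : forall i a a' (dl : activity n) s,
    actions M a -> actions M a' ->
    `|utility M i a dl s - utility M i a' dl s|
      <= lipS M s * enorm (\row_j ((a - a') 0 j * (dl j)%:R));
  lipschitz_measurable : measurable_fun setT (lipS M);
  lipschitz_L2 : ('E_P[fun w => ((lipS M (state M 1 w)) ^+ 2)%R] < +oo)%E;
  F_strongly_concave : forall a, actions M a ->
    dotv (a - astar M) (grad (actions M) (Ffun M) a)
      <= - alpha_F M * enorm (a - astar M) ^+ 2 }.

Record stepsize (R : realType) := StepSize {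
  beta0 : R; gamma0 : R; c1 : R; c2 : R }.

Definition admissible (R : realType) (c1 c2 : R) : Prop :=
  [/\ 1 / 2 < c1, c1 < 1, 0 < c2 & c2 <= 1 - c1].

Definition beta (R : realType) (st : stepsize R) (l : nat) : R :=
  beta0 st * l%:R `^ (- c1 st).

Definition gamma (R : realType) (st : stepsize R) (l : nat) : R :=
  gamma0 st * l%:R `^ (- c2 st).

Definition ell (R : realType) d (Omega : measurableType d)
    (P : probability Omega R) d' (T : measurableType d') (n : nat)
    (M : dosp_model P T n) (i : 'I_n.+1) (k : nat) (w : Omega) : nat :=
  (ellt M i k w + delta M i k w)%N.

Definition betat (R : realType) d (Omega : measurableType d)
    (P : probability Omega R) d' (T : measurableType d') (n : nat)
    (M : dosp_model P T n) (st : stepsize R)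
    (i : 'I_n.+1) (k : nat) (w : Omega) : R :=
  (delta M i k w)%:R * beta st (ell M i k w).

Definition gammat (R : realType) d (Omega : measurableType d)
    (P : probability Omega R) d' (T : measurableType d') (n : nat)
    (M : dosp_model P T n) (st : stepsize R)
    (i : 'I_n.+1) (k : nat) (w : Omega) : R :=
  (delta M i k w)%:R * gamma st (ell M i k w).

Definition performed (R : realType) d (Omega : measurableType d)
    (P : probability Omega R) d' (T : measurableType d') (n : nat)
    (M : dosp_model P T n) (st : stepsize R)
    (a : 'rV[R]_n.+1) (k : nat) (w : Omega) : 'rV[R]_n.+1 :=
  \row_i (a 0 i + gammat M st i k w * Phi M i k w).

Definition observed_utility (R : realType) d (Omega : measurableType d)
    (P : probability Omega R) d' (T : measurableType d') (n : nat)
    (M : dosp_model P T n) (st : stepsize R)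
    (a : 'rV[R]_n.+1) (i : 'I_n.+1) (k : nat) (w : Omega) : R :=
  utility M i (performed M st a k w) (active M k w) (state M k w)
    + eta M i k w.

Definition received (R : realType) d (Omega : measurableType d)
    (P : probability Omega R) d' (T : measurableType d') (n : nat)
    (M : dosp_model P T n) (i : 'I_n.+1) (k : nat) (w : Omega) :
    {set 'I_n.+1} :=
  [set j | [&& delta M j k w, j != i & recv M i j k w]]%SET.

Definition f_estimate (R : realType) d (Omega : measurableType d)
    (P : probability Omega R) d' (T : measurableType d') (n : nat)
    (M : dosp_model P T n) (st : stepsize R)
    (a : 'rV[R]_n.+1) (i : 'I_n.+1) (k : nat) (w : Omega) : R :=
  observed_utility M st a i k w +
  (qr M)^-1 * \sum_(j in received M i k w) observed_utility M st a j k w.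

Definition project (R : realType) (lo hi x : R) : R :=
  Num.min (Num.max x lo) hi.

(* [a k w] is the action vector a_k; [a 0] is unused. *)
Record dosp_run (R : realType) d (Omega : measurableType d)
    (P : probability Omega R) d' (T : measurableType d') (n : nat)
    (M : dosp_model P T n) (st : stepsize R)
    (a : nat -> Omega -> 'rV[R]_n.+1) : Prop := {
  init_measurable : forall i, measurable_fun setT (fun w => a 1%N w 0 i);
  init_range : forall i w,
    amin M 0 i + alpha_Phi M * gammat M st i 1 w <= a 1%N w 0 i
      <= amax M 0 i - alpha_Phi M * gammat M st i 1 w;
  (* a_1 may depend on the step-sizes of slot 1, which determine its range, but
     on no other randomness of the algorithm. *)
  init_indep : independent2 P
    <<s \bigcup_(i in [set: 'I_n.+1])
          (sigma_rv (fun w => a 1%N w 0 i) `|`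
           sigma_rv (delta M i 1) `|` sigma_rv (ellt M i 1)) >>
    <<s \bigcup_(x in [set x : source n | (0 < slot x)%N /\
            forall i, x <> SrcDelta i 1 /\ x <> SrcEll i 1])
          source_sigma M x >>;
  update : forall k i w, (0 < k)%N ->
    a k.+1 w 0 i =
      project (amin M 0 i + alpha_Phi M * gammat M st i k.+1 w)
              (amax M 0 i - alpha_Phi M * gammat M st i k.+1 w)
              (a k w 0 i +
               betat M st i k w * Phi M i k w * f_estimate M st (a k w) i k w) }.

Definition msd (R : realType) d (Omega : measurableType d)
    (P : probability Omega R) d' (T : measurableType d') (n : nat)
    (M : dosp_model P T n) (a : nat -> Omega -> 'rV[R]_n.+1) (k : nat) :
    \bar R :=
  ((n.+1%:R^-1)%:E * 'E_P[fun w => (enorm (a k w - astar M) ^+ 2)%R])%E.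

(* The next two expectations do not depend on the node; node 0 is used. *)
Definition mean_betagamma (R : realType) d (Omega : measurableType d)
    (P : probability Omega R) d' (T : measurableType d') (n : nat)
    (M : dosp_model P T n) (st : stepsize R) (k : nat) : R :=
  fine ('E_P[fun w => (betat M st ord0 k w * gammat M st ord0 k w)%R])%E.

Definition mean_beta2 (R : realType) d (Omega : measurableType d)
    (P : probability Omega R) d' (T : measurableType d') (n : nat)
    (M : dosp_model P T n) (st : stepsize R) (k : nat) : R :=
  fine ('E_P[fun w => ((betat M st ord0 k w) ^+ 2)%R])%E.

(* The indicator is that of ellt < K0 - 1. *)
Definition Delta (R : realType) d (Omega : measurableType d)
    (P : probability Omega R) d' (T : measurableType d') (n : nat)
    (M : dosp_model P T n) (st : stepsize R) (K0 k : nat) (w : Omega) : R :=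
  (alpha_Phi M) ^+ 2 * (gamma0 st) ^+ 2 * n.+1%:R^-1 *
  \sum_i (delta M i k w)%:R * ((ellt M i k w).+1 < K0)%N%:R.

Definition theta (R : realType) d (Omega : measurableType d)
    (P : probability Omega R) d' (T : measurableType d') (n : nat)
    (M : dosp_model P T n) (st : stepsize R) (k : nat) : R :=
  (qa M)^-1 * mean_betagamma M st k.

Definition A_const (R : realType) d (Omega : measurableType d)
    (P : probability Omega R) d' (T : measurableType d') (n : nat)
    (M : dosp_model P T n) : R :=
  2 * (sigma_Phi M) ^+ 2 * alpha_F M.

Record dosp_constants (R : realType) d (Omega : measurableType d)
    (P : probability Omega R) d' (T : measurableType d') (n : nat)
    (M : dosp_model P T n) (st : stepsize R)
    (K0 K1 : nat) (C : R) (K2 : nat) : Prop := {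
  K0_gt0 : (0 < K0)%N;
  K0_prop : forall l i, (K0 <= l)%N ->
    alpha_Phi M * gamma st l <=
      Num.min `|amax M 0 i - astar M 0 i| `|amin M 0 i - astar M 0 i|;
  K1_ge : (K0 <= K1)%N;
  C_gt0 : 0 < C;
  (* [mean_beta2] at k.-1 only makes sense from the second slot on. *)
  K1_prop : forall k, (K1 <= k)%N -> (1 < k)%N ->
    ('E_P[Delta M st K0 k] <= (C * mean_beta2 M st k.-1)%:E)%E;
  K2_ge : (K1 <= K2)%N;
  K2_prop : theta M st K2 < (A_const M)^-1;
  K2_min : forall k, (K1 <= k)%N -> theta M st k < (A_const M)^-1 ->
    (K2 <= k)%N }.

(* Main.v *)
Require Import Defs.
From HB Require Import structures.
From mathcomp Require Import all_boot all_order all_algebra.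
From mathcomp Require Import all_classical all_reals all_analysis.
From mathcomp Require Import measurable_realfun ring lra.
Set Implicit Arguments.
Unset Strict Implicit.
Unset Printing Implicit Defensive.
Import Order.TTheory GRing.Theory Num.Theory.
Import numFieldNormedType.Exports.
Local Open Scope classical_set_scope.
Local Open Scope ring_scope.

(** The constant [Xi] may depend on everything but [k]. Since [q_a <= 1], it is
    enough to show that the mean-square deviation is [O(k ^ (- m))], where [m] is
    the minimum of [2 * c2] and [c1 - c2].

    The algorithm is a stochastic gradient ascent. The estimate is multiplied by
    the perturbation [Phi i k], which is centred and independent of the rest.
    Expanding [G] along coordinate [i] therefore leaves, in the mean, the second
    moment of [Phi i k] times the step-size [gammat] times the partial derivative
    of [G]; the noises average out, and the factor [1 / q_r] compensates the
    losses at reception ([Ex_probe_estimate], [Ex_probe_total],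
    [expansion_error]).

    The obstacle is that [a k] is not independent of slot [k]: the projection
    that produces it uses the step-sizes of that very slot. The analysis follows
    instead [iterate k], the previous update projected onto the whole box, which
    depends on the earlier slots only, and from which [a k] is obtained by one
    more projection. The two points are close, and closer still near the optimum,
    which is an interior point ([project_shift], [project_dist_sqr]). At
    [iterate k] the randomness of the slot separates from that of the past:
    averaging over the activities turns the partial derivatives of [G] into those
    of [F], with a factor [mean_product] for the step-sizes ([Ex_gain]).

    Both step-sizes of a node are powers of the inverse of its step index, set to
    zero when it is inactive. The index is at most [k], so [mean_product] is at
    least [beta0 * gamma0 * k ^ (- (c1 + c2))]; conversely, moments of inverse
    powers of a binomial variable show that the power [s <= 2] of the sum of
    these rates has mean [O(k ^ (- s))] ([Ex_total_rate]). Hence the square of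
    the update costs [k ^ (- (2 * c1))], while the errors of the expansion are of
    order [k ^ (- (c1 + 2 * c2))] times the deviation plus
    [k ^ (- (c1 + 3 * c2))]. Young's inequality splits the former into a small
    part of the contraction and a term of the latter order ([residual_le]).

    Let [u k] be the sum over the nodes of the second moments of the deviations
    of [iterate k]. Once [beta0 * gamma0] is large enough, strong concavity of
    [F] gives, with [s = c1 + c2],
      [u (k + 1) <= (1 - 2 * k ^ (- s)) * u k + C * k ^ (- s - m)]
    ([dev2_step]): the exponent [m] is the largest for which [s + m] is at most
    both [2 * c1] and [c1 + 3 * c2]. As [s <= 1] and [m <= 1], this recursion
    yields [u k = O(k ^ (- m))] ([rate_of_recursion]); the constant in front of
    [k ^ (- s)] has to exceed [m] when [s = 1], and this is where the size of
    [beta0 * gamma0] matters. Finally [m] is at most [1 / 2] for admissible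
    exponents, with equality at [(3 / 4, 1 / 4)]. *)

(** * Recursions and projections *)

Section elementary.
Context {R : realType}.
Implicit Types (x y s m r : R).

Lemma powRN_ge1 (k : nat) x : (0 < k)%N -> x <= 1 ->
  k%:R^-1 <= k%:R `^ (- x) :> R.
Proof.
move=> k0 x1; rewrite -powR_inv1// ler_powR ?ler1n// lerN2//.
Qed.

(** [(1 + 1 / k) ^ (- m)] is at least [1 / (1 + 1 / k)], because [m <= 1], and
    hence at least [1 - 1 / k]. *)
Lemma powRN_succ (k : nat) m : (0 < k)%N -> 0 <= m -> m <= 1 ->
  k%:R `^ (- m) * (1 - k%:R^-1) <= k.+1%:R `^ (- m) :> R.
Proof.
move=> k0 m0 m1.
have kR : (0 : R) < k%:R by rewrite ltr0n.
have k1R : (0 : R) < k.+1%:R by rewrite ltr0n.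
have -> : k.+1%:R `^ (- m) = k%:R `^ (- m) * (k.+1%:R / k%:R) `^ (- m) :> R.
  rewrite -powRM ?ler0n ?divr_ge0//; congr (_ `^ _); field; lra.
apply: ler_wpM2l; first exact: powR_ge0.
have h1 : (1 : R) <= k.+1%:R / k%:R by rewrite ler_pdivlMr// mul1r ler_nat.
apply: (@le_trans _ _ ((k.+1%:R / k%:R) `^ (-1))).
  rewrite powR_inv1 ?divr_ge0// invf_div -natr1.
  rewrite ler_pdivlMr; last by rewrite ltr_wpDl.
  have : k%:R * k%:R^-1 = 1 :> R by rewrite divff// gt_eqF.
  have : 0 < k%:R^-1 :> R by rewrite invr_gt0.
  move: (k%:R^-1) => i; nra.
by rewrite ler_powR// lerN2.
Qed.

(** In the induction step the contraction gains [2 * k ^ (- s)], while the decay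
    of [k ^ (- m)] costs at most [1 / k <= k ^ (- s)]; the surplus [k ^ (- s)]
    absorbs the forcing term. For [s = 1] the contraction constant has to exceed
    [m], and [2] does. *)
Lemma rate_of_recursion (u : nat -> R) (s m C B : R) :
  1 / 2 <= s <= 1 -> 0 <= m <= 1 -> 0 <= C ->
  (forall k, (2 <= k)%N -> 0 <= u k <= B) ->
  (forall k, (2 <= k)%N ->
     u k.+1 <= (1 - 2 * k%:R `^ (- s)) * u k + C * k%:R `^ (- s - m)) ->
  exists Xi, forall k, (2 <= k)%N -> u k <= Xi * k%:R `^ (- m).
Proof.
move=> /andP[s2 s1] /andP[m0 m1] C0 hB rec.
have B0 : 0 <= B by case/andP: (hB 2%N isT); exact: le_trans.
(* From [k = 4] on, the contraction factor is nonnegative, since [1 / 2 <= s];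
   until then [4 * k ^ (- m) >= 1] and the bound [B] suffices. *)
exists (C + 4 * B).
have small k : (2 <= k)%N -> (k <= 4)%N -> u k <= (C + 4 * B) * k%:R `^ (- m).
  move=> k2 k4; case/andP: (hB k k2) => _ /le_trans; apply.
  have k0 : (0 < k)%N by rewrite (leq_trans _ k2).
  have h : 4^-1 <= k%:R `^ (- m) :> R.
    apply: le_trans (powRN_ge1 k0 m1).
    by rewrite lef_pV2 ?posrE ?ltr0n// ler_nat.
  have : 0 <= C * k%:R `^ (- m) by rewrite mulr_ge0// powR_ge0.
  nra.
elim=> // k IH k2.
have [k4|k4] := leqP k.+1 4; first exact: small.
have k2' : (2 <= k)%N by case: k k4 {IH k2} => [|[|[]]].
have k0 : (0 < k)%N by case: k k2' {IH k2 k4}.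
apply: (le_trans (rec k k2')).
have kR : (0 : R) < k%:R by rewrite ltr0n.
have half : k%:R `^ (- s) <= 1 / 2 :> R.
  have <- : 4%:R `^ (- (1 / 2)) = 1 / 2 :> R.
    have -> : 4%:R = 2%:R `^ 2%:R :> R by rewrite powR_mulrn ?ler0n// -natrX.
    rewrite -powRrM (_ : 2%:R * - (1 / 2) = -1 :> R); last by field.
    by rewrite powR_inv1// mul1r.
  apply: (@le_trans _ _ (4%:R `^ (- s))).
    rewrite !powRN lef_pV2 ?posrE ?powR_gt0// ge0_ler_powR ?nnegrE//.
    - lra.
    - by rewrite ler_nat -ltnS.
  by rewrite ler_powR ?lerN2// ler1n.
apply: (@le_trans _ _ ((1 - 2 * k%:R `^ (- s)) * ((C + 4 * B) * k%:R `^ (- m)) +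
    C * k%:R `^ (- s - m))).
  rewrite lerD2r ler_wpM2l ?IH// subr_ge0; lra.
apply: (@le_trans _ _ ((C + 4 * B) * (k%:R `^ (- m) * (1 - k%:R^-1)))); last first.
  rewrite ler_wpM2l ?powRN_succ//; nra.
rewrite powRD; last by apply/implyP => _; rewrite gt_eqF.
have h1 := powRN_ge1 k0 s1.
move: half h1.
have := powR_ge0 k%:R (- m); have := powR_ge0 k%:R (- s).
move: (k%:R `^ (- s)) (k%:R `^ (- m)) (k%:R^-1) => S N I S0 N0 half h1.
rewrite -subr_ge0.
have -> : (C + 4 * B) * (N * (1 - I)) -
    ((1 - 2 * S) * ((C + 4 * B) * N) + C * (S * N)) =
    N * ((C + 4 * B) * (S - I) + 4 * B * S) by ring.
by apply: mulr_ge0 => //; apply: addr_ge0; apply: mulr_ge0; lra.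
Qed.

Lemma projectP (lo hi x : R) : lo <= hi ->
  [\/ x <= lo /\ project lo hi x = lo, lo <= x <= hi /\ project lo hi x = x |
      hi <= x /\ project lo hi x = hi].
Proof.
move=> lohi; rewrite /project; have [h1|h1] := leP x lo.
  by apply: Or31; split => //; apply/min_idPl.
have [h2|h2] := leP x hi; first by apply: Or32; rewrite (ltW h1).
by apply: Or33; split => //; exact: ltW.
Qed.

(** The optimum is at distance at least [r] from the boundary, so it belongs to
    the interval shrunk by [t], onto which the projection does not increase
    distances, unless [t] exceeds [r]. *)
Lemma project_dist_sqr (lo hi x y t r : R) : 0 <= t -> 0 <= r ->
  lo + t <= hi - t -> lo + r <= y <= hi - r ->
  (project (lo + t) (hi - t) x - y) ^+ 2 <=
    (x - y) ^+ 2 + t ^+ 2 * (r < t)%R%:R.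
Proof.
move=> t0 r0 lohi /andP[ly yh].
have x0 := sqr_ge0 (x - y); have tt0 := sqr_ge0 t.
case: (projectP x lohi) => -[h ->].
- have [h3|h3] := leP (lo + t) y.
    have : (lo + t - y) ^+ 2 <= (x - y) ^+ 2 by nra.
    by case: ltP => _; rewrite ?mulr1 ?mulr0; lra.
  have -> : r < t by lra.
  have : (lo + t - y) ^+ 2 <= t ^+ 2 by nra.
  by rewrite mulr1; lra.
- by case: ltP => _; rewrite ?mulr1 ?mulr0; lra.
- have [h3|h3] := leP y (hi - t).
    have : (hi - t - y) ^+ 2 <= (x - y) ^+ 2 by nra.
    by case: ltP => _; rewrite ?mulr1 ?mulr0; lra.
  have -> : r < t by lra.
  have : (hi - t - y) ^+ 2 <= t ^+ 2 by nra.
  by rewrite mulr1; lra.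
Qed.

(** A point that the projection moves lies within [t] of the boundary, hence at
    distance at least [r - t] from the optimum: this is why the displacement,
    of first order in [t], carries an additional small factor. *)
Lemma project_shift (lo hi x y t r : R) : 0 <= t -> 0 < r ->
  lo + t <= hi - t -> lo + r <= y <= hi - r -> lo <= x <= hi ->
  `|project (lo + t) (hi - t) x - x| <= t * (`|x - y| + t) / r.
Proof.
move=> t0 r0 lohi /andP[ly yh] /andP[lx xh]; rewrite ler_pdivlMr//.
have a0 := normr_ge0 (x - y).
case: (projectP x lohi) => -[h ->].
- have hx : y - x <= `|x - y| by rewrite distrC ler_norm.
  by rewrite ger0_norm; [apply: ler_pM|]; lra.
- by rewrite subrr normr0 mul0r; nra.
- have hx : x - y <= `|x - y| by rewrite ler_norm.
  by rewrite ler0_norm; [apply: ler_pM|]; lra.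
Qed.

Lemma project_shift_le (lo hi x t : R) : 0 <= t ->
  lo + t <= hi - t -> lo <= x <= hi ->
  `|project (lo + t) (hi - t) x - x| <= t.
Proof.
move=> t0 lohi /andP[lx xh]; rewrite ler_norml.
by case: (projectP x lohi) => -[h ->]; apply/andP; split; lra.
Qed.

Lemma project_in (lo hi x : R) : lo <= hi -> lo <= project lo hi x <= hi.
Proof.
by move=> lohi; case: (projectP x lohi) => -[h ->]; apply/andP; split; lra.
Qed.

Lemma project_project (lo hi x t : R) : 0 <= t -> lo + t <= hi - t ->
  project (lo + t) (hi - t) (project lo hi x) = project (lo + t) (hi - t) x.
Proof.
move=> t0 lohi; have lohi' : lo <= hi by lra.
case: (projectP x lohi') => -[h ->] //; [case: (projectP lo lohi)|
  case: (projectP hi lohi)] => -[h1 ->]; case: (projectP x lohi) => -[h2 ->]; lra.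
Qed.

Lemma project_dist (lo hi x y : R) : lo <= y <= hi ->
  (project lo hi x - y) ^+ 2 <= (x - y) ^+ 2.
Proof.
move=> /andP[ly yh]; have lohi := le_trans ly yh.
by case: (projectP x lohi) => -[h ->]; nra.
Qed.

Lemma le_of_dist (x y e : R) : `|x - y| <= e -> x <= y + e.
Proof. by rewrite ler_norml => /andP[_]; lra. Qed.

Lemma sqr_sum_le (I : finType) (f : I -> R) :
  (\sum_i f i) ^+ 2 <= #|I|%:R * \sum_i f i ^+ 2.
Proof.
have -> : #|I|%:R * \sum_i f i ^+ 2 =
    \sum_i \sum_j (f i ^+ 2 + f j ^+ 2) / 2.
  have E i : \sum_j (f i ^+ 2 + f j ^+ 2) / 2 =
      (#|I|%:R * f i ^+ 2 + \sum_j f j ^+ 2) / 2.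
    by rewrite -mulr_suml big_split/= sumr_const -[_ *+ _]mulr_natl.
  rewrite (eq_bigr _ (fun i _ => E i)) -mulr_suml big_split/= -mulr_sumr.
  by rewrite sumr_const -[_ *+ #|_|]mulr_natl; field.
rewrite expr2 big_distrlr/=; apply: ler_sum => i _; apply: ler_sum => j _.
have := sqr_ge0 (f i - f j); nra.
Qed.

End elementary.

(** * Independence and expectations of products *)

Section independence.
Context d (Omega : measurableType d) (R : realType) (P : probability Omega R).
Local Open Scope ereal_scope.

(** Unlike the union of the systems indexed by [D], their finite intersections
    form a pi-system. *)
Definition cylinders (J : choiceType) (H : J -> set_system Omega) (D : set J) :
    set_system Omega :=
  [set A | exists s : seq J, exists B : J -> set Omega,
    [/\ uniq s, forall i, i \in s -> D i /\ H i (B i) &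
        A = \big[setI/setT]_(i <- s) B i] ].

Lemma cylinders_setI (J : choiceType) (H : J -> set_system Omega) (D : set J) :
  (forall i, D i -> setI_closed (H i)) -> setI_closed (cylinders H D).
Proof.
move=> HI A A' [s [B [us sB ->]]] [s' [B' [us' sB' ->]]].
exists (undup (s ++ s')).
exists (fun i => (if i \in s then B i else setT) `&`
                 (if i \in s' then B' i else setT)).
split.
- exact: undup_uniq.
- move=> i; rewrite mem_undup mem_cat.
  case: ifPn => is_; case: ifPn => is'_ //= _; rewrite ?setIT ?setTI.
  + have [Di HB] := sB _ is_; have [_ HB'] := sB' _ is'_.
    by split => //; exact: HI.
  + exact: sB.
  + exact: sB'.
- rewrite -!bigcap_seq; apply/seteqP; split => x /=.
    move=> [h h'] i /=; rewrite mem_undup mem_cat => _; split.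
      by case: ifPn => // /h.
    by case: ifPn => // /h'.
  move=> h; split => i /= i_.
    by have := h i; rewrite /= mem_undup mem_cat i_ => /(_ isT)[].
  by have := h i; rewrite /= mem_undup mem_cat i_ orbT => /(_ isT)[].
Qed.

Lemma independent2_sigma (G1 G2 : set_system Omega) :
  G1 `<=` measurable -> G2 `<=` measurable ->
  setI_closed G1 -> setI_closed G2 -> G1 setT -> G2 setT ->
  independent2 P G1 G2 -> independent2 P <<s G1 >> <<s G2 >>.
Proof.
move=> mG1 mG2 IG1 IG2 G1T G2T ind.
have sub (G : set_system Omega) : G `<=` measurable -> <<s G >> `<=` measurable.
  by move=> mG; apply: smallest_sub => //; exact: sigma_algebra_measurable.
have step (G : set_system Omega) (C : set Omega) : G `<=` measurable ->
    setI_closed G -> G setT -> measurable C ->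
    (forall A, G A -> P (A `&` C) = P A * P C) ->
    forall A, <<s G >> A -> P (A `&` C) = P A * P C.
  move=> mG IG GT mC h A GA.
  have PC0 : (0 <= fine (P C))%R by exact: fine_ge0.
  have -> : P A * P C = mscale (NngNum PC0) P A.
    by rewrite /mscale/= muleC fineK// fin_num_measure.
  have cover : \bigcup_(k : nat) [set: Omega] = setT.
    by rewrite bigcup_const//; exists 0%N.
  apply: (g_sigma_algebra_measure_unique G mG (fun _ => setT) (fun _ => GT)
    cover (mrestr P mC) (mscale (NngNum PC0) P) IG) => //.
  - move=> B GB; rewrite /= /mrestr h// /mscale/= muleC fineK//.
    by rewrite fin_num_measure.
  - move=> k; rewrite /= /mrestr.
    by rewrite (le_lt_trans (probability_le1 _ _))// ?ltry//; exact: measurableI.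
move=> A1 A2 sA1 sA2.
apply: (step G1) => //; first exact: (sub G2).
move=> A GA; rewrite setIC muleC; apply: (step G2) => //; first exact: mG1.
by move=> B GB; rewrite setIC ind// muleC.
Qed.

(** The product rule holds for the cylinders over [D1] and [D2], which are
    pi-systems that generate the two sigma-algebras. *)
Lemma independent2_group (J : choiceType) (H : J -> set_system Omega)
    (D1 D2 : set J) :
  (forall i, D1 i \/ D2 i -> setI_closed (H i) /\ H i `<=` measurable) ->
  D1 `&` D2 `<=` set0 ->
  (forall (s : seq J) (B : J -> set Omega), uniq s ->
     (forall i, i \in s -> (D1 i \/ D2 i) /\ H i (B i)) ->
     P (\big[setI/setT]_(i <- s) B i) = \prod_(i <- s) P (B i)) ->
  independent2 P <<s \bigcup_(i in D1) H i >> <<s \bigcup_(i in D2) H i >>.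
Proof.
move=> HD D12 ind.
have mcyl D : D `<=` D1 `|` D2 -> cylinders H D `<=` measurable.
  move=> DD _ [s [B [us sB ->]]]; rewrite big_seq.
  apply: bigsetI_measurable => i /sB[Di HB].
  by have [_] := HD i (DD _ Di); exact.
have gcyl D : \bigcup_(i in D) H i `<=` cylinders H D.
  move=> A [i Di HA]; exists [:: i]; exists (fun _ => A); split => //.
    by move=> j; rewrite inE => /eqP ->.
  by rewrite big_seq1.
have Tcyl D : cylinders H D setT.
  by exists [::]; exists (fun _ => setT); split => //; rewrite big_nil.
have Icyl D : D `<=` D1 `|` D2 -> setI_closed (cylinders H D).
  by move=> DD; apply: cylinders_setI => i /DD /HD[].
have sub1 : D1 `<=` D1 `|` D2 by move=> ?; left.
have sub2 : D2 `<=` D1 `|` D2 by move=> ?; right.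
have : independent2 P <<s cylinders H D1 >> <<s cylinders H D2 >>.
  apply: independent2_sigma; [exact: mcyl|exact: mcyl|exact: Icyl|exact: Icyl|
    exact: Tcyl|exact: Tcyl|].
  move=> _ _ [s1 [B1 [us1 sB1 ->]]] [s2 [B2 [us2 sB2 ->]]].
  have s12 i : i \in s1 -> i \in s2 -> False.
    by move=> /sB1[D1i _] /sB2[D2i _]; exact: (D12 i).
  pose B i := if i \in s1 then B1 i else B2 i.
  have E1 : \big[setI/setT]_(i <- s1) B1 i = \big[setI/setT]_(i <- s1) B i.
    by apply: eq_big_seq => i i1; rewrite /B i1.
  have E2 : \big[setI/setT]_(i <- s2) B2 i = \big[setI/setT]_(i <- s2) B i.
    by apply: eq_big_seq => i i2; rewrite /B; case: ifPn => // /s12 /(_ i2).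
  rewrite E1 E2 -big_cat/= !ind// ?big_cat//.
  - move=> i i2; have [Di HB] := sB2 _ i2; rewrite /B.
    by case: ifPn => [/s12/(_ i2)//|_]; split => //; right.
  - by move=> i i1; have [Di HB] := sB1 _ i1; rewrite /B i1; split => //; left.
  - rewrite cat_uniq us1 us2 andbT/=; apply/hasPn => i i2.
    by apply/negP => i1; exact: (s12 i).
  - move=> i; rewrite mem_cat /B; case: ifPn => [i1 _|_ /= i2].
      by have [? ?] := sB1 _ i1; split => //; left.
    by have [? ?] := sB2 _ i2; split => //; right.
move=> ind2 A1 A2 sA1 sA2; apply: ind2.
  exact: (sub_sigma_algebra2 (gcyl D1)).
exact: (sub_sigma_algebra2 (gcyl D2)).
Qed.

Lemma mutually_independent_seq (J : choiceType) (D : set J)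
    (H : J -> set_system Omega) : mutually_independent P D H ->
  forall (s : seq J) (B : J -> set Omega), uniq s ->
    (forall i, i \in s -> D i /\ H i (B i)) ->
    P (\big[setI/setT]_(i <- s) B i) = \prod_(i <- s) P (B i).
Proof.
move=> ind s B us sB; rewrite big_tnth [RHS]big_tnth.
apply: (ind _ (tnth (in_tuple s)) (fun i => B (tnth (in_tuple s) i))).
- by apply/(tuple_uniqP (in_tuple s)).
- by move=> j; have [] := sB _ (mem_tnth j (in_tuple s)).
- by move=> j; have [] := sB _ (mem_tnth j (in_tuple s)).
Qed.


Local Close Scope ereal_scope.

(** Phrased as measurability on [Omega] equipped with the sigma-algebra generated
    by [G], so that the closure properties of measurable functions apply. *)
Definition adapted d' (T : measurableType d') (G : set_system Omega)
    (X : Omega -> T) : Prop :=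
  measurable_fun [set: g_sigma_algebraType G] X.

Lemma adaptedS d' (T : measurableType d') (G1 G2 : set_system Omega)
  (X : Omega -> T) : G1 `<=` G2 -> adapted G1 X -> adapted G2 X.
Proof.
move=> G12 mX _ B mB; have := mX measurableT B mB; rewrite !setTI.
exact: (sub_sigma_algebra2 G12).
Qed.

Lemma adapted_measurable d' (T : measurableType d') (G : set_system Omega)
  (X : Omega -> T) : G `<=` measurable -> adapted G X ->
  measurable_fun [set: Omega] X.
Proof.
move=> mG mX _ B mB; have := mX measurableT B mB; rewrite !setTI.
by apply: smallest_sub => //; exact: sigma_algebra_measurable.
Qed.

Lemma adapted_of_sigma d' (T : measurableType d') (G : set_system Omega)
  (X : Omega -> T) : sigma_rv X `<=` <<s G >> -> adapted G X.
Proof.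
move=> XG _ B mB; apply: XG; exists B => //.
Qed.

Local Notation Ex f := (Rintegral P setT f).
Local Notation intble f := (P.-integrable setT (EFin \o (f : Omega -> R))).

(** The joint law of two independent variables is the product of their laws;
    Fubini's theorem does the rest. *)
Lemma Rintegral_indepM (G1 G2 : set_system Omega) (X Y : Omega -> R) :
  G1 `<=` measurable -> G2 `<=` measurable ->
  independent2 P <<s G1 >> <<s G2 >> ->
  adapted G1 X -> adapted G2 Y -> intble X -> intble Y ->
  intble (fun w => X w * Y w) /\ Ex (fun w => X w * Y w) = Ex X * Ex Y.
Proof.
move=> mG1 mG2 ind aX aY iX iY.
have mX := adapted_measurable mG1 aX; have mY := adapted_measurable mG2 aY.
pose X' : {RV P >-> R} :=
  MeasurableFun.Pack (MeasurableFun.Class (isMeasurableFun.Build _ _ _ _ _ mX)).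
pose Y' : {RV P >-> R} :=
  MeasurableFun.Pack (MeasurableFun.Class (isMeasurableFun.Build _ _ _ _ _ mY)).
have mZ : measurable_fun [set: Omega] (fun w => (X w, Y w)).
  exact: measurable_fun_pair.
pose Z' : {RV P >-> (R * R)%type} :=
  MeasurableFun.Pack (MeasurableFun.Class (isMeasurableFun.Build _ _ _ _ _ mZ)).
have prodE : forall S, measurable S ->
    (distribution P X' \x distribution P Y')%E S = distribution P Z' S.
  apply: product_measure_unique => A B mA mB.
  rewrite /= /distribution /pushforward/=.
  rewrite (_ : _ @^-1` _ = (X @^-1` A) `&` (Y @^-1` B)); last first.
    by apply/seteqP; split.
  apply: ind.
    by rewrite -[X in <<s _ >> X]setTI; exact: aX.
  by rewrite -[X in <<s _ >> X]setTI; exact: aY.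
pose f := (fun z : R * R => (z.1 * z.2)%:E).
have mM : measurable_fun setT f.
  by apply/measurable_EFinP; apply: measurable_funM.
have mid : measurable_fun [set: R] (@EFin R).
  exact/measurable_EFinP.
have iX' : (distribution P X').-integrable setT (fun x : R => x%:E).
  by apply: integrable_pushforward.
have iY' : (distribution P Y').-integrable setT (fun x : R => x%:E).
  by apply: integrable_pushforward.
have [_ finX] := integrableP _ _ _ iX'; have [_ finY] := integrableP _ _ _ iY'.
have mabs : measurable_fun [set: R] (abse \o @EFin R) by exact: measurableT_comp.
have iprod : (distribution P X' \x distribution P Y')%E.-integrable setT
 f.
  apply/integrable12ltyP => //=.
  have E x : (\int[distribution P Y']_y `|(x * y)%:E| =
      `|x|%:E * \int[distribution P Y']_y `|y%:E|)%E.
    rewrite -ge0_integralZl_EFin//.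
    by apply: eq_integral => y _; rewrite /= normrM EFinM.
  under eq_integral do rewrite E.
  rewrite ge0_integralZr//; last exact: integral_ge0.
  by apply: lte_mul_pinfty => //;
    [exact: integral_ge0|rewrite ge0_fin_numE//; exact: integral_ge0].
have eqint (g : R * R -> \bar R) :
    (\int[distribution P X' \x distribution P Y']_z g z =
     \int[distribution P Z']_z g z)%E.
  by apply: eq_measure_integral => A mA _; exact: prodE.
have iM : intble (fun w => X w * Y w).
  apply/integrableP; split; first exact/measurable_EFinP/measurable_funM.
  have [_] := integrableP _ _ _ iprod.
  rewrite eqint ge0_integral_distribution//.
  exact: measurableT_comp.
split => //; rewrite /Rintegral.
have -> : (\int[P]_w (X w * Y w)%:E =
    \int[distribution P Z']_z (z.1 * z.2)%:E)%E.
  by rewrite integral_distribution.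
rewrite -eqint -(integral12_prod_meas1 iprod)/f/=.
have E x : (\int[distribution P Y']_y (x * y)%:E =
    x%:E * \int[distribution P Y']_y y%:E)%E.
  by rewrite -integralZl//; apply: eq_integral => y _; rewrite EFinM.
rewrite (eq_integral (fun x : R => x%:E * \int[distribution P Y']_y y%:E)%E);
  last by move=> x _; exact: E.
have finY' : (\int[distribution P Y']_y y%:E)%E \is a fin_num.
  exact: integrable_fin_num.
rewrite -(fineK finY') integralZr// fineK//.
rewrite (integral_distribution (X := X'))// (integral_distribution (X := Y'))//.
by rewrite fineM//; exact: integrable_fin_num.
Qed.

End independence.

(** * Expectations of real variables *)

Section real_expectation.
Context d (Omega : measurableType d) (R : realType) (P : probability Omega R).
Implicit Types (X Y : Omega -> R).
Local Notation Ex f := (Rintegral P setT f).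
Local Notation L1 f := (P.-integrable setT (EFin \o (f : Omega -> R))).

Lemma L1_measurable X : L1 X -> measurable_fun setT X.
Proof. by move=> /integrableP[/measurable_EFinP]. Qed.

Lemma L1_le X Y : measurable_fun setT X -> (forall w, `|X w| <= Y w) ->
  L1 Y -> L1 X.
Proof.
move=> mX XY; apply: le_integrable => //; first exact/measurable_EFinP.
by move=> w _; rewrite /= lee_fin (le_trans (XY w))// ler_norm.
Qed.

Lemma L1_cst (c : R) : L1 (fun=> c).
Proof. exact: finite_measure_integrable_cst. Qed.

Lemma L1_bounded X (c : R) : measurable_fun setT X -> (forall w, `|X w| <= c) ->
  L1 X.
Proof. by move=> mX Xc; apply: (L1_le mX Xc); exact: L1_cst. Qed.

Lemma L1_norm X : L1 X -> L1 (fun w => `|X w|).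
Proof. exact: integrable_norm. Qed.

Lemma L1D X Y : L1 X -> L1 Y -> L1 (fun w => X w + Y w).
Proof.
move=> iX iY; have := integrableD measurableT iX iY.
by apply: eq_integrable.
Qed.

Lemma L1B X Y : L1 X -> L1 Y -> L1 (fun w => X w - Y w).
Proof.
move=> iX iY; have := integrableB measurableT iX iY.
by apply: eq_integrable.
Qed.

Lemma L1Zl (c : R) X : L1 X -> L1 (fun w => c * X w).
Proof.
move=> iX; have := integrableZl measurableT c iX.
by apply: eq_integrable.
Qed.

Lemma L1_boundedMl X Y (c : R) : measurable_fun setT X ->
  (forall w, `|X w| <= c) -> L1 Y -> L1 (fun w => X w * Y w).
Proof.
move=> mX Xc iY; apply: (@L1_le _ (fun w => c * `|Y w|)).
- by apply: measurable_funM => //; exact: L1_measurable.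
- by move=> w; rewrite normrM ler_wpM2r.
- exact/L1Zl/L1_norm.
Qed.

Lemma L1_sum (I : Type) (s : seq I) (p : pred I) (f : I -> Omega -> R) :
  (forall i, p i -> L1 (f i)) -> L1 (fun w => \sum_(i <- s | p i) f i w).
Proof.
move=> if_; have : P.-integrable setT
    (fun w => \sum_(i <- s | p i) (EFin \o f i) w)%E by exact: integrable_sum.
by apply: eq_integrable => // w _; rewrite /= sumEFin.
Qed.

Lemma Ex_cst (c : R) : Ex (fun=> c) = c.
Proof.
by have := expectation_cst P c; rewrite unlock /Rintegral => ->.
Qed.

Lemma ExD X Y : L1 X -> L1 Y -> Ex (fun w => X w + Y w) = Ex X + Ex Y.
Proof. exact: RintegralD. Qed.

Lemma ExB X Y : L1 X -> L1 Y -> Ex (fun w => X w - Y w) = Ex X - Ex Y.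
Proof. exact: RintegralB. Qed.

Lemma ExZl (c : R) X : L1 X -> Ex (fun w => c * X w) = c * Ex X.
Proof. exact: RintegralZl. Qed.

Lemma eq_Ex X Y : X =1 Y -> Ex X = Ex Y.
Proof. by move=> XY; apply: eq_Rintegral => w _. Qed.

Lemma le_Ex X Y : L1 X -> L1 Y -> (forall w, X w <= Y w) -> Ex X <= Ex Y.
Proof. by move=> iX iY XY; exact: le_Rintegral. Qed.

Lemma normr_Ex X : L1 X -> `|Ex X| <= Ex (fun w => `|X w|).
Proof. exact: le_normr_Rintegral. Qed.

Lemma Ex_ge0 X : (forall w, 0 <= X w) -> 0 <= Ex X.
Proof. by move=> X0; apply: Rintegral_ge0. Qed.

Lemma Ex_sum (I : Type) (s : seq I) (p : pred I) (f : I -> Omega -> R) :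
  (forall i, p i -> L1 (f i)) ->
  Ex (fun w => \sum_(i <- s | p i) f i w) = \sum_(i <- s | p i) Ex (f i).
Proof.
move=> if_; elim: s => [|i s ih].
  rewrite big_nil -[RHS]Ex_cst; apply: eq_Ex => w; exact: big_nil.
rewrite big_cons -ih; case: ifPn => pi; last first.
  by apply: eq_Ex => w; rewrite big_cons (negbTE pi).
rewrite -ExD; [|exact: if_|exact: L1_sum].
by apply: eq_Ex => w; rewrite big_cons pi.
Qed.

Lemma fine_expectation X : fine 'E_P[X]%E = Ex X.
Proof. by rewrite unlock. Qed.

Lemma expectation_Ex X : L1 X -> 'E_P[X]%E = (Ex X)%:E.
Proof.
by move=> iX; rewrite unlock fineK//; exact: integrable_fin_num.
Qed.

Lemma Ex_law d' (T : measurableType d') (X Y : {RV P >-> T}) (f : T -> R) :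
  (forall B, measurable B -> distribution P X B = distribution P Y B) ->
  measurable_fun setT f -> L1 (f \o Y) ->
  L1 (f \o X) /\ Ex (f \o X) = Ex (f \o Y).
Proof.
move=> XY mf iY; have mEf : measurable_fun setT (EFin \o f) by exact/measurable_EFinP.
have eqint (g : T -> \bar R) :
    (\int[distribution P X]_z g z = \int[distribution P Y]_z g z)%E.
  by apply: eq_measure_integral => A mA _; exact: XY.
have iX : L1 (f \o X).
  apply/integrableP; split.
    by apply/measurable_EFinP; exact: measurableT_comp.
  have mabs : measurable_fun setT (abse \o (EFin \o f)) by exact: measurableT_comp.
  have [_] := integrableP _ _ _ iY.
  have := ge0_integral_distribution Y mabs (fun=> abse_ge0 _).
  have := ge0_integral_distribution X mabs (fun=> abse_ge0 _).
  by move=> EX EY; rewrite -[ltLHS]/(\int[P]_w ((abse \o (EFin \o f)) \o Y) w)%E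
    -EY -eqint EX.
split => //; congr fine.
rewrite -[LHS](integral_distribution (X := X) (f := EFin \o f))//.
by rewrite eqint integral_distribution.
Qed.

End real_expectation.

(** * Grids on a box *)

Section box_partition.
Context (R : realType) (n : nat).
Implicit Types (lo hi a : 'rV[R]_n).

Definition box lo hi : set 'rV[R]_n :=
  [set a | forall i, lo 0 i <= a 0 i <= hi 0 i].

(** The weights are products of one-variable functions: at a random point they
    are then measurable as soon as its coordinates are. *)
Record box_partition lo hi (e : R) := BoxPartition {
  part_index : finType;
  part_pt : part_index -> 'rV[R]_n;
  part_weight : part_index -> 'I_n -> R -> R;
  part_pt_box : forall c, box lo hi (part_pt c);
  part_weight_meas : forall c i, measurable_fun setT (part_weight c i);
  part_weight01 : forall c i x, 0 <= part_weight c i x <= 1;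
  part_sum1 : forall a, box lo hi a ->
    \sum_c \prod_i part_weight c i (a 0 i) = 1;
  part_near : forall c a, box lo hi a -> \prod_i part_weight c i (a 0 i) != 0 ->
    forall i, `|a 0 i - part_pt c 0 i| <= e }.

Lemma grid_partition lo hi (e : R) : 0 < e -> (forall i, lo 0 i <= hi 0 i) ->
  box_partition lo hi e.
Proof.
move=> e0 lohi.
pose K := (\max_(i < n) Num.truncn ((hi 0 i - lo 0 i) / e)%R).+1.
pose cell i (c : nat) : set R := `[lo 0 i + c%:R * e, lo 0 i + c.+1%:R * e[%classic.
have cellE i c x : lo 0 i <= x ->
    (x \in cell i c) = (Num.truncn ((x - lo 0 i) / e) == c).
  move=> lx; rewrite truncn_eq ?divr_ge0 ?subr_ge0 ?(ltW e0)//.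
  rewrite ler_pdivlMr// ltr_pdivrMr// lerBrDl ltrBlDl.
  by apply/idP/idP => [/set_mem|h]; rewrite ?inE /cell /= in_itv.
have idx i x : lo 0 i <= x <= hi 0 i -> (Num.truncn ((x - lo 0 i) / e)%R < K)%N.
  move=> /andP[lx xh]; rewrite ltnS.
  apply: leq_trans (leq_bigmax i); apply: le_truncn.
  by rewrite ler_pM2r ?invr_gt0// lerD2r.
apply: (@BoxPartition _ _ _ {ffun 'I_n -> 'I_K}
  (fun c => \row_i Num.min (lo 0 i + (c i)%:R * e) (hi 0 i))
  (fun c i => \1_(cell i (c i)))).
- move=> c i; rewrite mxE le_min ge_min lexx orbT andbT lohi andbT.
  by rewrite lerDl mulr_ge0// ltW.
- by move=> c i; apply: measurable_indic; exact: measurable_itv.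
- by move=> c i x; rewrite indicE ler0n lern1 leq_b1.
- move=> a abox; transitivity (\prod_i \sum_(c < K) \1_(cell i c) (a 0 i) : R).
    by rewrite bigA_distr_bigA.
  apply: big1 => i _; have ai := abox i; have /andP[lx _] := ai.
  rewrite (bigD1 (Ordinal (idx _ _ ai)))//= big1 ?addr0.
    by rewrite indicE cellE ?eqxx.
  move=> c cneq; rewrite indicE cellE//.
  case: eqP => // cE; case/eqP: cneq; exact/val_inj.
- move=> c a abox /prodf_neq0 nz i.
  have := nz i isT; rewrite indicE; case: (boolP (_ \in _)) => [|_]; last by rewrite eqxx.
  rewrite inE /cell/= in_itv/= -natr1 => /andP[h1 h2] _.
  have /andP[lx xh] := abox i.
  rewrite mxE (min_idPl (le_trans h1 xh)) ger0_norm ?subr_ge0//.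
  lra.
Qed.

Lemma weighted_mean_dist (I : finType) (w : I -> R) (v : I -> R) (x e : R) :
  (forall c, 0 <= w c) -> \sum_c w c = 1 ->
  (forall c, w c != 0 -> `|x - v c| <= e) ->
  `|x - \sum_c w c * v c| <= e.
Proof.
move=> w0 w1 h; have -> : x - \sum_c w c * v c = \sum_c w c * (x - v c).
  under [RHS]eq_bigr do rewrite mulrBr.
  by rewrite sumrB -mulr_suml w1 mul1r.
rewrite (le_trans (ler_norm_sum _ _ _))// -[leRHS]mul1r -w1 mulr_suml.
apply: ler_sum => c _; rewrite normrM ger0_norm//.
have [->|nz] := eqVneq (w c) 0; first by rewrite !mul0r.
by rewrite ler_wpM2l// h.
Qed.

(** The functions [h m], in which the first argument is rounded to a grid of
    mesh [1 / (m + 1)], are measurable and converge pointwise. *)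
Lemma caratheodory_measurable lo hi d (S : measurableType d)
    (g : 'rV[R]_n -> S -> R) (X : S -> 'rV[R]_n) :
  (forall i, lo 0 i <= hi 0 i) ->
  (forall a, box lo hi a -> measurable_fun setT (g a)) ->
  (forall s a, box lo hi a -> forall e, 0 < e -> exists2 r, 0 < r &
     forall x, box lo hi x -> (forall i, `|a 0 i - x 0 i| <= r) ->
       `|g a s - g x s| <= e) ->
  (forall i, measurable_fun setT (fun s => X s 0 i)) ->
  (forall s, box lo hi (X s)) ->
  measurable_fun setT (fun s => g (X s) s).
Proof.
move=> lohi mg cg mX bX.
have e0 (m : nat) : (0 : R) < m.+1%:R^-1 by rewrite invr_gt0.
pose part m := grid_partition (e0 m) lohi.
pose h m s := \sum_(c : part_index (part m))
  (\prod_i part_weight c i (X s 0 i)) * g (part_pt c) s.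
apply: (measurable_fun_cvg (h := h)).
  move=> m; apply: measurable_sum => c; apply: measurable_funM; last exact/mg/part_pt_box.
  by apply: measurable_prod => i _; exact: (measurableT_comp (part_weight_meas c i)).
move=> s _; apply/cvgrPdist_le => e egt0.
have [r r0 hr] := cg s (X s) (bX s) e egt0.
near=> m; apply: weighted_mean_dist.
- by move=> c; apply: prodr_ge0 => i _; case/andP: (part_weight01 c i (X s 0 i)).
- exact/part_sum1/bX.
- move=> c nz; apply: hr => [|i]; first exact: part_pt_box.
  apply: le_trans (part_near (bX s) nz i) _; apply: ltW.
  near: m; exact: (near_infty_natSinv_lt (PosNum r0)).
Unshelve. all: by end_near. Qed.

End box_partition.

(** * Freezing an independent variable *)

Section freezing.
Context d (Omega : measurableType d) (R : realType) (P : probability Omega R).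
Context (n : nat).
Implicit Types (lo hi a x : 'rV[R]_n).
Local Notation Ex f := (Rintegral P setT f).
Local Notation L1 f := (P.-integrable setT (EFin \o (f : Omega -> R))).

Lemma lipschitz_continuous_sum lo hi (f : 'rV[R]_n -> R) (l : R) :
  (forall a x, box lo hi a -> box lo hi x ->
    `|f a - f x| <= l * \sum_i `|a 0 i - x 0 i|) ->
  forall a, box lo hi a -> forall e, 0 < e -> exists2 r, 0 < r &
    forall x, box lo hi x -> (forall i, `|a 0 i - x 0 i| <= r) ->
      `|f a - f x| <= e.
Proof.
move=> lipf a ba e e0; pose m : R := `|l| * n%:R + 1.
have m0 : 0 < m by rewrite ltr_pwDr// mulr_ge0.
exists (e / m) => [|x bx hx]; first exact: divr_gt0.
apply: (le_trans (lipf _ _ ba bx)).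
apply: (@le_trans _ _ (`|l| * \sum_(i < n) (e / m))).
  apply: (le_trans (ler_wpM2r _ (ler_norm l))); first exact: sumr_ge0.
  by rewrite ler_wpM2l//; apply: ler_sum => i _; exact: hx.
rewrite sumr_const card_ord -[_ *+ n]mulr_natl.
have -> : `|l| * (n%:R * (e / m)) = `|l| * n%:R / m * e by ring.
by rewrite ler_piMl ?(ltW e0)// ler_pdivrMr// mul1r /m lerDl.
Qed.

(** Independence lets the variable [X] be treated as a constant when the
    randomness of [g] is averaged out. Both sides are compared with their
    approximations on a fine grid of values of [X], for which the identity is
    the product rule. *)
Lemma Ex_freeze lo hi (G1 G2 : set_system Omega) (g : 'rV[R]_n -> Omega -> R)
    (L Z : Omega -> R) (X : Omega -> 'rV[R]_n) (B : R) :
  G1 `<=` measurable -> G2 `<=` measurable ->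
  independent2 P <<s G1 >> <<s G2 >> ->
  (forall i, lo 0 i <= hi 0 i) ->
  (forall a, box lo hi a -> adapted G2 (g a)) ->
  (forall a, box lo hi a -> L1 (g a)) ->
  (forall w, 0 <= L w) -> L1 L ->
  (forall w a x, box lo hi a -> box lo hi x ->
    `|g a w - g x w| <= L w * \sum_i `|a 0 i - x 0 i|) ->
  (forall i, adapted G1 (fun w => X w 0 i)) -> (forall w, box lo hi (X w)) ->
  adapted G1 Z -> (forall w, `|Z w| <= B) ->
  L1 (fun w => Z w * g (X w) w) /\
  Ex (fun w => Z w * g (X w) w) = Ex (fun w => Z w * Ex (g (X w))).
Proof.
move=> mG1 mG2 ind lohi ag ig L0 iL lipg aX bX aZ ZB.
pose h a := Ex (g a).
have mX i := adapted_measurable mG1 (aX i).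
have mZ := adapted_measurable mG1 aZ.
have blo : box lo hi lo by move=> i; rewrite lexx lohi.
pose D := \sum_i (hi 0 i - lo 0 i).
have D0 : 0 <= D by apply: sumr_ge0 => i _; rewrite subr_ge0.
have Xlo w : \sum_i `|X w 0 i - lo 0 i| <= D.
  apply: ler_sum => i _; have /andP[l1 l2] := bX w i.
  by rewrite ger0_norm ?subr_ge0// lerD2r.
have liph a x : box lo hi a -> box lo hi x ->
    `|h a - h x| <= Ex L * \sum_i `|a 0 i - x 0 i|.
  move=> ba bx; rewrite /h -ExB; [|exact: ig|exact: ig].
  rewrite (le_trans (normr_Ex (L1B (ig _ ba) (ig _ bx))))// mulrC -ExZl//.
  apply: le_Ex; [by apply: L1_norm; apply: L1B; exact: ig|exact: L1Zl|].
  by move=> w; rewrite mulrC; exact: lipg.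
have mgX : measurable_fun setT (fun w => g (X w) w).
  apply: (caratheodory_measurable lohi) => //.
    by move=> a ba; exact: L1_measurable (ig _ ba).
  by move=> w; apply: lipschitz_continuous_sum; exact: lipg.
have mhX : measurable_fun setT (fun w => h (X w)).
  apply: (caratheodory_measurable (g := fun a _ => h a) lohi) => //.
  by move=> w; exact: (lipschitz_continuous_sum liph).
have igX : L1 (fun w => g (X w) w).
  apply: (L1_le (Y := fun w => `|g lo w| + D * L w)) => // [w|].
    rewrite -[g (X w) w](subrK (g lo w)) addrC.
    rewrite (le_trans (ler_normD _ _))// lerD2l (le_trans (lipg _ _ _ (bX w) blo))//.
    by rewrite mulrC ler_wpM2r.
  by apply: L1D; [exact/L1_norm/ig|exact: L1Zl].
have ihX : L1 (fun w => h (X w)).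
  apply: (@L1_bounded _ _ _ P _ (`|h lo| + D * Ex L)) => // w.
  rewrite -[h (X w)](subrK (h lo)) addrC.
  rewrite (le_trans (ler_normD _ _))// lerD2l (le_trans (liph _ _ (bX w) blo))//.
  by rewrite mulrC ler_wpM2r// Ex_ge0.
have iZg : L1 (fun w => Z w * g (X w) w) by exact: L1_boundedMl ZB _.
have iZh : L1 (fun w => Z w * h (X w)) by exact: L1_boundedMl ZB _.
split => //.
have B0 : 0 <= B by exact: le_trans (ZB point).
suff H e : 0 < e -> `|Ex (fun w => Z w * g (X w) w) -
    Ex (fun w => Z w * h (X w))| <= B * (Ex L * (n%:R * e)) *+ 2.
  apply/eqP; rewrite -subr_eq0 -normr_le0; apply/ler_addgt0Pl => e e0; rewrite addr0.
  pose m : R := B * (Ex L * n%:R) *+ 2 + 1.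
  have m0 : 0 < m by rewrite ltr_pwDr// mulrn_wge0// !mulr_ge0// Ex_ge0.
  apply: le_trans (H (e / m) (divr_gt0 e0 m0)) _.
  have -> : B * (Ex L * (n%:R * (e / m))) *+ 2 =
    (B * (Ex L * n%:R) *+ 2) / m * e by rewrite !mulr2n; ring.
  by rewrite ler_piMl ?(ltW e0)// ler_pdivrMr// mul1r /m lerDl.
move=> e0; have p := grid_partition e0 lohi.
pose W (c : part_index p) w := \prod_i part_weight c i (X w 0 i).
have aW c : adapted G1 (W c).
  apply: measurable_prod => i _.
  exact: (measurableT_comp (part_weight_meas c i) (aX i)).
have W01 c w : 0 <= W c w <= 1.
  rewrite prodr_ge0 => [|i _]; last by case/andP: (part_weight01 c i (X w 0 i)).
  by apply: prodr_ile1 => i _; exact: (part_weight01 c i (X w 0 i)).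
have aZW c : adapted G1 (fun w => Z w * W c w) by exact: (measurable_funM aZ (aW c)).
have iZW c : L1 (fun w => Z w * W c w).
  apply: (@L1_bounded _ _ _ P _ (B)) => [|w]; first exact: adapted_measurable (aZW c).
  have /andP[w0 w1] := W01 c w.
  by rewrite normrM (ger0_norm w0) -[leRHS]mulr1 ler_pM.
have close (u : 'rV[R]_n -> R) (l : R) w : 0 <= l ->
    (forall a x, box lo hi a -> box lo hi x ->
      `|u a - u x| <= l * \sum_i `|a 0 i - x 0 i|) ->
    `|u (X w) - \sum_c W c w * u (part_pt c)| <= l * (n%:R * e).
  move=> l0 lipu; apply: weighted_mean_dist.
  - by move=> c; case/andP: (W01 c w).
  - exact: part_sum1.
  - move=> c nz; apply: le_trans (lipu _ _ (bX w) (part_pt_box c)) _.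
    rewrite ler_wpM2l// -[in leRHS](card_ord n) mulr_natl -sumr_const.
    by apply: ler_sum => i _; exact: (part_near (bX w) nz).
have ibox (c : part_index p) : L1 (g (part_pt c)) by apply: ig; exact: part_pt_box.
have iZWg c : L1 (fun w => Z w * W c w * g (part_pt c) w).
  by have [] := Rintegral_indepM mG1 mG2 ind (aZW c)
    (ag _ (part_pt_box c)) (iZW c) (ibox c).
have E : Ex (fun w => \sum_c Z w * W c w * g (part_pt c) w) =
         Ex (fun w => \sum_c h (part_pt c) * (Z w * W c w)).
  rewrite !Ex_sum => [||c _]; [|by move=> c _; exact/L1Zl|exact: iZWg].
  apply: eq_bigr => c _; rewrite ExZl// mulrC.
  by have [_ ->] := Rintegral_indepM mG1 mG2 ind (aZW c)
    (ag _ (part_pt_box c)) (iZW c) (ibox c).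
have dist (u v : Omega -> R) (l : Omega -> R) : L1 u -> L1 v -> L1 l ->
    (forall w, `|u w - v w| <= l w) -> `|Ex u - Ex v| <= Ex l.
  move=> iu iv il uvl; rewrite -ExB// (le_trans (normr_Ex (L1B iu iv)))//.
  by apply: le_Ex => //; exact/L1_norm/L1B.
have iS1 : L1 (fun w => \sum_c Z w * W c w * g (part_pt c) w) by exact: L1_sum.
have iS2 : L1 (fun w => \sum_c h (part_pt c) * (Z w * W c w)).
  by apply: L1_sum => c _; exact: L1Zl.
rewrite -[X in `|X - _|](subrK (Ex (fun w => \sum_c Z w * W c w * g (part_pt c) w))).
rewrite -addrA mulr2n (le_trans (ler_normD _ _))//; apply: lerD.
  have -> : B * (Ex L * (n%:R * e)) = Ex (fun w => B * (n%:R * e) * L w).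
    by rewrite ExZl//; ring.
  apply: dist => // [|w]; first exact: L1Zl.
  have -> : \sum_c Z w * W c w * g (part_pt c) w =
      Z w * \sum_c W c w * g (part_pt c) w.
    by rewrite mulr_sumr; apply: eq_bigr => c _; rewrite mulrA.
  rewrite -mulrBr normrM -mulrA ler_pM// mulrC.
  by apply: (close (g ^~ w)) => //; exact: lipg.
rewrite E distrC.
have -> : B * (Ex L * (n%:R * e)) = Ex (fun=> B * (Ex L * (n%:R * e))) by rewrite Ex_cst.
apply: dist => // [|w]; first exact: L1_cst.
have -> : \sum_c h (part_pt c) * (Z w * W c w) =
    Z w * \sum_c W c w * h (part_pt c).
  by rewrite mulr_sumr; apply: eq_bigr => c _; ring.
rewrite -mulrBr normrM ler_pM//.
by apply: (close h) => //; exact: Ex_ge0.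
Qed.

End freezing.

(** * Gradients on a box *)

Section box_gradient.
Context (R : realType) (n : nat).
Implicit Types (a x y lo hi g : 'rV[R]_n).

Definition set_coord a (i : 'I_n) (t : R) : 'rV[R]_n :=
  \row_j (if j == i then t else a 0 j).

Lemma set_coord_sum a i t (w : 'I_n -> R -> R) :
  (forall j, w j 0 = 0) ->
  \sum_j w j (set_coord a i t 0 j - a 0 j) = w i (t - a 0 i).
Proof.
move=> w0; rewrite (bigD1 i)//= mxE eqxx big1 ?addr0// => j ji.
by rewrite mxE (negbTE ji) subrr.
Qed.

Lemma set_coordC a i s t : set_coord (set_coord a i s) i t = set_coord a i t.
Proof. by apply/rowP => j; rewrite !mxE; case: (j == i). Qed.

Lemma set_coord_box lo hi a i t : box lo hi a -> lo 0 i <= t <= hi 0 i ->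
  box lo hi (set_coord a i t).
Proof. by move=> ba ht j; rewrite mxE; case: eqP => [->|_]. Qed.

Lemma is_gradP (A : set 'rV[R]_n) f a g : is_grad A f a g ->
  forall e, 0 < e -> exists2 r, 0 < r & forall x, A x ->
    (forall i, `|x 0 i - a 0 i| < r) ->
    `|f x - f a - dotv g (x - a)| <= e * \sum_i `|x 0 i - a 0 i|.
Proof.
move=> gradg e e0; have /nbhs_ballP[r /= r0 hr] := gradg e e0.
exists r => // x Ax xa; apply: le_trans (hr x _ Ax) _.
  by split => // i j; rewrite !ord1 /ball/= distrC.
rewrite ler_wpM2l ?(ltW e0)// (_ : `|x - a| = mx_norm (x - a))// mx_normrE.
apply: bigmax_le => [|[i j] _]; first exact: sumr_ge0.
by rewrite ord1 !mxE (bigD1 j)//= lerDl; apply: sumr_ge0.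
Qed.

Lemma is_grad_continuous (A : set 'rV[R]_n) f a g : is_grad A f a g ->
  forall e, 0 < e -> exists2 r, 0 < r & forall x, A x ->
    (forall i, `|a 0 i - x 0 i| <= r) -> `|f a - f x| <= e.
Proof.
move=> gradg e e0; have [r r0 hr] := is_gradP gradg ltr01.
pose m : R := (\sum_i `|g 0 i| + 1) * n%:R + 1.
have m0 : 0 < m by rewrite ltr_pwDr// mulr_ge0// addr_ge0// sumr_ge0.
exists (Num.min (r / 2) (e / m)).
  by rewrite lt_min !divr_gt0.
move=> x Ax ax.
have ax' i : `|x 0 i - a 0 i| < r.
  rewrite distrC; apply: le_lt_trans (ax i) _; rewrite gt_min; apply/orP; left.
  by rewrite ltr_pdivrMr// ltr_pMr// ltr1n.
have axe i : `|x 0 i - a 0 i| <= e / m.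
  by rewrite distrC; apply: le_trans (ax i) _; rewrite ge_min lexx orbT.
have := hr x Ax ax'; rewrite mul1r => h.
have gle : `|dotv g (x - a)| <= (\sum_i `|g 0 i|) * \sum_i `|x 0 i - a 0 i|.
  rewrite /dotv (le_trans (ler_norm_sum _ _ _))// mulr_suml.
  apply: ler_sum => i _; rewrite normrM !mxE ler_wpM2l//.
  by rewrite (bigD1 i)//= lerDl; apply: sumr_ge0.
rewrite distrC -[f x - f a](subrK (dotv g (x - a))).
apply: le_trans (ler_normD _ _) _.
apply: le_trans (lerD h gle) _.
have sle : \sum_i `|x 0 i - a 0 i| <= n%:R * (e / m).
  by rewrite -[in leRHS](card_ord n) mulr_natl -sumr_const; apply: ler_sum => i _.
rewrite -[X in X + _]mul1r -mulrDl.
apply: (@le_trans _ _ ((1 + \sum_i `|g 0 i|) * (n%:R * (e / m)))).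
  by rewrite ler_wpM2l// addr_ge0// sumr_ge0.
have -> : (1 + \sum_i `|g 0 i|) * (n%:R * (e / m)) =
  (\sum_i `|g 0 i| + 1) * n%:R / m * e by ring.
by rewrite ler_piMl ?(ltW e0)// ler_pdivrMr// mul1r /m lerDl.
Qed.

Lemma dotv_set_coord g a i t :
  dotv g (set_coord a i t - a) = g 0 i * (t - a 0 i).
Proof.
rewrite /dotv -(set_coord_sum a i t (w := fun j u => g 0 j * u)) => [|j]; last exact: mulr0.
by apply: eq_bigr => j _; rewrite !mxE.
Qed.

Lemma is_grad_coord (A : set 'rV[R]_n) f a g i : is_grad A f a g ->
  forall e, 0 < e -> exists2 r, 0 < r & forall t, A (set_coord a i t) ->
    `|t - a 0 i| < r ->
    `|f (set_coord a i t) - f a - g 0 i * (t - a 0 i)| <= e * `|t - a 0 i|.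
Proof.
move=> gradg e e0; have [r r0 hr] := is_gradP gradg e0; exists r => // t At ta.
rewrite -dotv_set_coord -(set_coord_sum a i t (w := fun=> Num.norm)) ?normr0//.
apply: hr => // j; rewrite mxE; case: eqP => [->//|_].
by rewrite subrr normr0.
Qed.

(** A coordinate of a gradient is a one-sided derivative along the box, hence
    is controlled by the growth of the function in that direction. In
    particular gradients are unique, and vanish in the directions that the
    function does not depend on. *)
Lemma grad_coord_le lo hi f a g i (C : R) : is_grad (box lo hi) f a g ->
  box lo hi a -> lo 0 i < hi 0 i ->
  (forall t, lo 0 i <= t <= hi 0 i ->
    `|f (set_coord a i t) - f a| <= C * `|t - a 0 i|) ->
  `|g 0 i| <= C.
Proof.
move=> gradg ba lohi hf; apply/ler_addgt0Pr => e e0.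
have [r r0 hr] := is_grad_coord i gradg e0.
have [t [ht t0 tr]] : exists t, [/\ lo 0 i <= t <= hi 0 i, 0 < `|t - a 0 i| &
    `|t - a 0 i| < r].
  have /andP[la ah] := ba i.
  have r2 : 0 < r / 2 by lra.
  have [h|h] := ltP (a 0 i) (hi 0 i).
    exists (a 0 i + Num.min (r / 2) (hi 0 i - a 0 i)).
    have m1 : Num.min (r / 2) (hi 0 i - a 0 i) <= r / 2 by rewrite ge_min lexx.
    have m2 : Num.min (r / 2) (hi 0 i - a 0 i) <= hi 0 i - a 0 i by rewrite ge_min lexx orbT.
    have m0 : 0 < Num.min (r / 2) (hi 0 i - a 0 i) by rewrite lt_min r2 subr_gt0.
    move: (Num.min _ _) m1 m2 m0 => m m1 m2 m0.
    rewrite addrAC subrr add0r gtr0_norm//; split => //; [apply/andP; split|]; lra.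
  exists (a 0 i - Num.min (r / 2) (a 0 i - lo 0 i)).
  have m1 : Num.min (r / 2) (a 0 i - lo 0 i) <= r / 2 by rewrite ge_min lexx.
  have m2 : Num.min (r / 2) (a 0 i - lo 0 i) <= a 0 i - lo 0 i by rewrite ge_min lexx orbT.
  have m0 : 0 < Num.min (r / 2) (a 0 i - lo 0 i) by rewrite lt_min r2 subr_gt0; lra.
  move: (Num.min _ _) m1 m2 m0 => m m1 m2 m0.
  rewrite addrAC subrr add0r normrN gtr0_norm//; split => //; [apply/andP; split|]; lra.
have h1 := hr t (set_coord_box ba ht) tr.
have h2 := hf t ht.
rewrite -(ler_pM2r t0) -normrM mulrDl.
have -> : g 0 i * (t - a 0 i) = (f (set_coord a i t) - f a) -
    (f (set_coord a i t) - f a - g 0 i * (t - a 0 i)) by ring.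
exact: le_trans (ler_normB _ _) (lerD h2 h1).
Qed.

Lemma grad_is_grad (A : set 'rV[R]_n) f a :
  differentiable_on A f -> A a -> is_grad A f a (grad A f a).
Proof.
move=> df Aa; rewrite /grad.
by have := df a Aa => -[g gP]; exact: (xgetPex 0 (ex_intro _ g gP)).
Qed.

Lemma is_grad_sum (A : set 'rV[R]_n) (I : finType) (c : I -> R)
    (f : I -> 'rV[R]_n -> R) (g : I -> 'rV[R]_n) a :
  (forall i, is_grad A (f i) a (g i)) ->
  is_grad A (fun x => \sum_i c i * f i x) a (\sum_i c i *: g i).
Proof.
move=> gf e e0; pose m : R := \sum_i `|c i| + 1.
have m0 : 0 < m by rewrite ltr_pwDr// sumr_ge0.
have near_all : \forall x \near within A (nbhs a), forall i,
    `|f i x - f i a - dotv (g i) (x - a)| <= e / m * `|x - a|.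
  by apply: filter_forall => i; apply: gf; exact: divr_gt0.
apply: filterS near_all => x hx.
have -> : \sum_i c i * f i x - \sum_i c i * f i a -
    dotv (\sum_i c i *: g i) (x - a) =
    \sum_i c i * (f i x - f i a - dotv (g i) (x - a)).
  have -> : dotv (\sum_i c i *: g i) (x - a) = \sum_i c i * dotv (g i) (x - a).
    rewrite /dotv; under eq_bigr => j _ do rewrite summxE mulr_suml.
    rewrite exchange_big/=; apply: eq_bigr => i _; rewrite mulr_sumr.
    by apply: eq_bigr => j _; rewrite !mxE mulrA.
  by rewrite -!sumrB; apply: eq_bigr => i _; rewrite !mulrBr.
rewrite (le_trans (ler_norm_sum _ _ _))//.
apply: (@le_trans _ _ (\sum_i `|c i| * (e / m * `|x - a|))).
  by apply: ler_sum => i _; rewrite normrM ler_wpM2l.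
rewrite -mulr_suml mulrA ler_wpM2r// mulrCA ger_pMr// ler_pdivrMr// mul1r.
by rewrite /m lerDl.
Qed.

Lemma is_grad_unique lo hi f a g g' : (forall i, lo 0 i < hi 0 i) ->
  box lo hi a -> is_grad (box lo hi) f a g -> is_grad (box lo hi) f a g' ->
  g = g'.
Proof.
move=> lohi ba gradg gradg'.
have grad0 : is_grad (box lo hi) (fun=> 0) a (g - g').
  move=> e e0; have e2 : 0 < e / 2 by lra.
  apply: filterS2 (gradg _ e2) (gradg' _ e2) => x h h'.
  have -> : 0 - 0 - dotv (g - g') (x - a) = (f x - f a - dotv g (x - a)) -
      (f x - f a - dotv g' (x - a)).
    have -> : dotv (g - g') (x - a) = dotv g (x - a) - dotv g' (x - a).
      by rewrite /dotv -sumrB; apply: eq_bigr => i _; rewrite !mxE mulrBl.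
    by ring.
  rewrite (le_trans (ler_normB _ _))// (le_trans (lerD h h'))//.
  by rewrite -mulrDl -splitr.
apply/rowP => i; apply/eqP; rewrite -subr_eq0 -normr_le0.
have := grad_coord_le (i := i) (C := 0) grad0 ba (lohi i).
rewrite !mxE; apply => t _; by rewrite subrr normr0 mul0r.
Qed.

(** On a segment of the box the gradient gives a derivative inside and continuity
    up to the ends, where it is only one-sided: this is all that the mean value
    theorem asks for. *)
Lemma coord_mvt lo hi f a i t : differentiable_on (box lo hi) f ->
  box lo hi a -> lo 0 i <= t <= hi 0 i ->
  exists2 s, Num.min t (a 0 i) <= s <= Num.max t (a 0 i) &
    f (set_coord a i t) - f a =
      partial (box lo hi) i f (set_coord a i s) * (t - a 0 i).
Proof.
move=> df ba ht.
pose phi s := f (set_coord a i s).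
pose dphi s := partial (box lo hi) i f (set_coord a i s).
have phi_cvg s : lo 0 i <= s <= hi 0 i -> forall e, 0 < e -> exists2 r, 0 < r &
    forall u, lo 0 i <= u <= hi 0 i -> `|u - s| < r ->
    `|phi u - phi s - dphi s * (u - s)| <= e * `|u - s|.
  move=> hs e e0; have bs := set_coord_box ba hs.
  have [r r0 hr] := is_grad_coord i (grad_is_grad df bs) e0.
  exists r => // u hu us.
  by have := hr u; rewrite set_coordC mxE eqxx; apply => //; exact: set_coord_box.
have key u v : lo 0 i <= u -> v <= hi 0 i -> u <= v ->
    exists2 c, c \in `[u, v]%R & phi v - phi u = dphi c * (v - u).
  move=> lu vh uv; apply: MVT_segment => // [x|].
    rewrite in_itv/= => /andP[ux xv].
    have hx : lo 0 i <= x <= hi 0 i by apply/andP; split; lra.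
    have cv : (fun h => h^-1 *: ((phi \o shift x) (h *: 1) - phi x)) @ 0^' --> dphi x.
      apply/cvgrPdist_le => e e0.
      have [r r0 hr] := phi_cvg x hx e e0.
      near=> h.
      have h0 : h != 0 by near: h; exact: nbhs_dnbhs_neq.
      have hlt : `|h| < Num.min r (Num.min (x - u) (v - x)).
        by near: h; apply: dnbhs0_lt; rewrite !lt_min r0 !subr_gt0 ux xv.
      move: hlt; rewrite !lt_min => /and3P[h1 h2 h3].
      have hxE : h *: 1 + x - x = h by rewrite addrK /GRing.scale/= mulr1.
      have := hr (h *: 1 + x); rewrite hxE => /(_ _ h1) hh.
      have {}hh : `|phi (h *: 1 + x) - phi x - dphi x * h| <= e * `|h|.
        apply: hh; have := ler_norm h; have := ler_norm (- h); rewrite normrN.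
        by rewrite /GRing.scale/= mulr1 => ? ?; apply/andP; split; lra.
      rewrite [X in `|X|](_ : _ =
          - ((phi (h *: 1 + x) - phi x - dphi x * h) / h)); last first.
        by rewrite /GRing.scale/=; field.
      by rewrite normrN normrM normfV ler_pdivrMr ?normr_gt0.
    by apply: DeriveDef; [apply/cvg_ex; exists (dphi x)|exact: cvg_lim].
  apply/subspace_continuousP => x /=; rewrite in_itv/= => /andP[ux xv].
  have hx : lo 0 i <= x <= hi 0 i by apply/andP; split; lra.
  apply/cvgrPdist_le => e e0.
  have [r r0 hr] := phi_cvg x hx 1 ltr01.
  pose m := 1 + `|dphi x|; have m0 : 0 < m by rewrite ltr_pwDl.
  rewrite near_withinE; near=> y => /=; rewrite in_itv/= => /andP[uy yv].
  have hy : `|x - y| < Num.min r (e / m).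
    near: y; apply: (nbhsx_ballx x (Num.min r (e / m))).
    by rewrite lt_min r0/= divr_gt0.
  move: hy; rewrite lt_min distrC => /andP[h1 h2].
  have hy : lo 0 i <= y <= hi 0 i by apply/andP; split; lra.
  rewrite -[leLHS]/(`|phi x - phi y|) distrC
    -[phi y - phi x](subrK (dphi x * (y - x))).
  rewrite (le_trans (ler_normD _ _))// (le_trans (lerD (hr y hy h1) (lexx _)))//.
  by rewrite normrM -mulrDl -/m mulrC -ler_pdivlMr// ltW.
have phia : phi (a 0 i) = f a.
  by congr f; apply/rowP => j; rewrite mxE; case: eqP => // ->.
have /andP[lt th] := ht; have /andP[la ah] := ba i.
have [ta|at_] := leP t (a 0 i).
  have [c] := key t (a 0 i) lt ah ta; rewrite in_itv/= phia => hc E.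
  by exists c => //; rewrite -[LHS]opprB E -mulrN opprB.
have [c] := key (a 0 i) t la th (ltW at_); rewrite in_itv/= phia => hc E.
by exists c.
Unshelve. all: by end_near. Qed.

End box_gradient.

(** * First-order expansion along one coordinate *)

Section box_gradient_bounds.
Context (R : realType) (n : nat).
Implicit Types (a x y lo hi : 'rV[R]_n).

(** One goes from [y] to [x] by changing the coordinates one at a time, and only
    those in [p] move. *)
Lemma lipschitz_of_partials lo hi (f : 'rV[R]_n -> R) (p : pred 'I_n) (C : R) :
  differentiable_on (box lo hi) f -> 0 <= C ->
  (forall a j, box lo hi a -> p j -> `|partial (box lo hi) j f a| <= C) ->
  forall x y, box lo hi x -> box lo hi y ->
    (forall j, ~~ p j -> x 0 j = y 0 j) ->
    `|f x - f y| <= C * \sum_j `|x 0 j - y 0 j|.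
Proof.
move=> df C0 dfC x y bx by_ xy.
pose z k : 'rV[R]_n := \row_j (if (j < k)%N then x 0 j else y 0 j).
have bz k : box lo hi (z k) by move=> j; rewrite mxE; case: ifP.
have zn : z n = x by apply/rowP => j; rewrite mxE ltn_ord.
have z0 : z 0%N = y by apply/rowP => j; rewrite mxE.
have zS (k : 'I_n) : z k.+1 = set_coord (z k) k (x 0 k).
  apply/rowP => j; rewrite !mxE ltnS leq_eqVlt.
  have [->|jk] := eqVneq j k; first by rewrite eqxx.
  by rewrite (_ : (j == k :> nat) = false)//; apply/negbTE.
have step (k : 'I_n) : `|f (z k.+1) - f (z k)| <= C * `|x 0 k - y 0 k|.
  have zk : z k 0 k = y 0 k by rewrite mxE ltnn.
  have [pk|npk] := boolP (p k); last first.
    rewrite zS (_ : set_coord _ _ _ = z k) ?subrr ?normr0 ?mulr_ge0//.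
    apply/rowP => j; rewrite mxE; case: eqP => // ->.
    by rewrite zk xy.
  have [s hs E] := coord_mvt df (bz k) (bx k).
  rewrite zS E normrM zk ler_wpM2r// dfC//.
  apply: set_coord_box => //; move: hs; rewrite zk.
  have /andP[x1 x2] := bx k; have /andP[y1 y2] := by_ k.
  case/andP => s1 s2; rewrite (le_trans _ s1) ?(le_trans s2)//.
    by rewrite ge_max x2 y2.
  by rewrite le_min x1 y1.
rewrite -{1}zn -{1}z0 -(telescope_sumr (fun k => f (z k)) (leq0n n)) big_mkord.
rewrite (le_trans (ler_norm_sum _ _ _))// mulr_sumr.
exact: ler_sum.
Qed.

(** The mean value theorem takes the derivative at a point of the segment, and the
    Lipschitz bound for this derivative moves it to [b]. The predicate [p] stands
    for the activity of the nodes: second derivatives are bounded between active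
    nodes only, and the actions of the other nodes are not perturbed. *)
Lemma coord_expansion lo hi (f : 'rV[R]_n -> R) (p : pred 'I_n) (C : R) i
    (x b : 'rV[R]_n) (t : R) (r : 'I_n -> R) :
  differentiable_on (box lo hi) f ->
  differentiable_on (box lo hi) (partial (box lo hi) i f) -> 0 <= C ->
  (forall a j, box lo hi a -> p j ->
     `|partial (box lo hi) j (partial (box lo hi) i f) a| <= C) ->
  box lo hi x -> box lo hi b -> lo 0 i <= t <= hi 0 i -> p i ->
  (forall j, ~~ p j -> x 0 j = b 0 j) ->
  (forall j, `|x 0 j - b 0 j| <= r j) -> `|t - b 0 i| <= r i ->
  `|f (set_coord x i t) - f x - partial (box lo hi) i f b * (t - x 0 i)| <=
    C * (\sum_j r j) * `|t - x 0 i|.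
Proof.
move=> df ddf C0 hC bx bb ht pi xb xr tr.
have [s hs ->] := coord_mvt df bx ht.
rewrite -mulrBl normrM ler_wpM2r//.
have /andP[x1 x2] := bx i; have /andP[t1 t2] := ht; case/andP: hs => s1 s2.
have bs : box lo hi (set_coord x i s).
  apply: set_coord_box => //; rewrite (le_trans _ s1) ?(le_trans s2)//.
    by rewrite ge_max t2 x2.
  by rewrite le_min t1 x1.
apply: le_trans (lipschitz_of_partials ddf C0 hC bs bb _) _.
  move=> j npj; rewrite mxE; case: eqP => [E|_]; last exact: xb.
  by rewrite E pi in npj.
rewrite ler_wpM2l//; apply: ler_sum => j _; rewrite mxE.
case: eqP => [->|_]; last exact: xr.
have := xr i; move: tr; rewrite !ler_norml => /andP[h1 h2] /andP[h3 h4].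
have s1' : b 0 i - r i <= s.
  by apply: le_trans s1; rewrite le_min; apply/andP; split; lra.
have s2' : s <= b 0 i + r i.
  by apply: (le_trans s2); rewrite ge_max; apply/andP; split; lra.
by apply/andP; split; lra.
Qed.

End box_gradient_bounds.

(** * Moments of the binomial law *)

Section binomial_moments.
Context d (Omega : measurableType d) (R : realType) (P : probability Omega R).
Local Notation Ex f := (Rintegral P setT f).
Local Notation L1 f := (P.-integrable setT (EFin \o (f : Omega -> R))).

Lemma Ex_binomial (X : {RV P >-> nat}) (m : nat) (q : R) (f : nat -> R) :
  0 <= q <= 1 -> distribution P X =1 binomial_prob m q ->
  (forall x, 0 <= f x) ->
  L1 (f \o X) /\
  Ex (f \o X) = \sum_(x < m.+1) q ^+ x * (1 - q) ^+ (m - x) *+ 'C(m, x) * f x.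
Proof.
move=> /andP[q0 q1] lawX f0.
have mf : measurable_fun [set: nat] f by [].
have mEf : measurable_fun [set: nat] (EFin \o f) by exact/measurable_EFinP.
have E : (\int[P]_w (f (X w))%:E =
    (\sum_(x < m.+1) q ^+ x * (1 - q) ^+ (m - x) *+ 'C(m, x) * f x)%:E)%E.
  rewrite -(ge0_integral_distribution X mEf (fun x => f0 x)).
  rewrite (eq_measure_integral (binomial_prob m q)) => [|A mA _]; last exact: lawX.
  rewrite (@integral_binomial _ m _ q0 q1)//=.
  by rewrite -sumEFin; apply: eq_bigr => x _; rewrite EFinM.
split; last by rewrite /Rintegral E.
apply/integrableP; split.
  by apply/measurable_EFinP; exact: measurableT_comp.
under eq_integral do rewrite /= ger0_norm//.
by rewrite E ltry.
Qed.

Lemma binomial_weights (m : nat) (q : R) :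
  \sum_(x < m.+1) q ^+ x * (1 - q) ^+ (m - x) *+ 'C(m, x) = 1.
Proof.
have := exprDn (1 - q) q m; rewrite subrK expr1n => E; rewrite [RHS]E.
by apply: eq_bigr => x _; rewrite mulrC.
Qed.

Lemma mul_bin_shift2 (m x : nat) :
  ((x.+1 * x.+2) * 'C(m.+2, x.+2) = (m.+1 * m.+2) * 'C(m, x))%N.
Proof.
rewrite -mulnA -(mul_bin_diag m.+2 x.+1)/= mulnCA -(mul_bin_diag m.+1 x)/=.
by rewrite mulnA [(m.+2 * _)%N]mulnC.
Qed.

(** [1 / (x + 1) ^ 2 <= 2 / ((x + 1) * (x + 2))], and dividing the weights of a
    binomial law by [(x + 1) * (x + 2)] gives, up to a factor, the weights of the
    law with two more trials. *)
Lemma binomial_inv_sqr (m : nat) (q : R) : 0 < q -> q <= 1 ->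
  \sum_(x < m.+1) q ^+ x * (1 - q) ^+ (m - x) *+ 'C(m, x) * x.+1%:R ^- 2 <=
  2 / q ^+ 2 * m.+1%:R ^- 2.
Proof.
move=> q0 q1; have q1' : 0 <= 1 - q by rewrite subr_ge0.
have shift (x : nat) : (x <= m)%N ->
    q ^+ x * (1 - q) ^+ (m - x) *+ 'C(m, x) * x.+1%:R ^- 2 <=
    2 / q ^+ 2 * m.+1%:R ^- 2 *
      (q ^+ x.+2 * (1 - q) ^+ (m.+2 - x.+2) *+ 'C(m.+2, x.+2)).
  move=> xm; rewrite !subSS -[_ *+ 'C(m, x)]mulr_natr -[_ *+ 'C(m.+2, x.+2)]mulr_natr.
  have binE : 'C(m.+2, x.+2)%:R = m.+1%:R * m.+2%:R * 'C(m, x)%:R / (x.+1%:R * x.+2%:R) :> R.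
    apply: (canRL (mulfK _)); first by rewrite mulf_neq0// pnatr_eq0.
    by rewrite -!natrM mulnC mul_bin_shift2.
  rewrite binE [q ^+ x.+2]exprS [q ^+ x.+1]exprS.
  have -> : 2 / q ^+ 2 * m.+1%:R ^- 2 *
     (q * (q * q ^+ x) * (1 - q) ^+ (m - x) *
      (m.+1%:R * m.+2%:R * 'C(m, x)%:R / (x.+1%:R * x.+2%:R))) =
     q ^+ x * (1 - q) ^+ (m - x) * 'C(m, x)%:R *
      (2 * m.+2%:R / m.+1%:R / (x.+1%:R * x.+2%:R)).
    have : m.+1%:R != 0 :> R by rewrite pnatr_eq0.
    have : x.+1%:R != 0 :> R by rewrite pnatr_eq0.
    have : x.+2%:R != 0 :> R by rewrite pnatr_eq0.
    have : q != 0 by rewrite gt_eqF.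
    move: (m.+1%:R) (m.+2%:R) (x.+1%:R) (x.+2%:R) (q ^+ x) ((1 - q) ^+ _) ('C(m, x)%:R).
    by move=> u v w z *; field; do 3?[apply/andP; split].
  rewrite ler_wpM2l ?mulr_ge0 ?exprn_ge0 ?ler0n ?(ltW q0)//.
  have x0 : 0 < x.+1%:R :> R by rewrite ltr0n.
  have m0 : 0 < m.+1%:R :> R by rewrite ltr0n.
  rewrite -[x.+2%:R]natr1 -[m.+2%:R]natr1.
  have x1 : 1 <= x.+1%:R :> R by rewrite ler1n.
  move: (x.+1%:R) (m.+1%:R) x0 m0 x1 => u v u0 v0 u1.
  rewrite -subr_ge0.
  have -> : 2 * (v + 1) / v / (u * (u + 1)) - u ^- 2 =
      (u * v - v + 2 * u) / (v * u ^+ 2 * (u + 1)).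
    by field; rewrite !gt_eqF//; lra.
  apply: divr_ge0; first nra.
  by rewrite !mulr_ge0 ?exprn_ge0//; lra.
apply: (@le_trans _ _ (\sum_(x < m.+1) 2 / q ^+ 2 * m.+1%:R ^- 2 *
      (q ^+ x.+2 * (1 - q) ^+ (m.+2 - x.+2) *+ 'C(m.+2, x.+2)))).
  by apply: ler_sum => x _; apply: shift; rewrite -ltnS.
rewrite -mulr_sumr -[leRHS]mulr1 ler_wpM2l//.
  by rewrite mulr_ge0 ?divr_ge0 ?invr_ge0 ?exprn_ge0 ?(ltW q0).
rewrite -[leRHS](binomial_weights m.+2 q) [leRHS]big_ord_recl; apply: ler_wpDl.
  by rewrite mulrn_wge0// mulr_ge0// exprn_ge0// ltW.
rewrite [leRHS]big_ord_recl; apply: ler_wpDl.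
  by rewrite mulrn_wge0// mulr_ge0// exprn_ge0// ltW.
by apply: ler_sum => x _; rewrite /= /bump/= !add1n.
Qed.

End binomial_moments.

(** * Sources of randomness *)

HB.instance Definition _ (n : nat) := gen_eqMixin (source n).
HB.instance Definition _ (n : nat) := gen_choiceMixin (source n).

Section sources.
Context (R : realType) (d : measure_display) (Omega : measurableType d)
  (P : probability Omega R) (d' : measure_display) (T : measurableType d')
  (n : nat) (M : dosp_model P T n) (hM : dosp_assumptions M)
  (st : stepsize R) (a : nat -> Omega -> 'rV[R]_n.+1) (run : dosp_run M st a).
Local Notation Ex f := (Rintegral P setT f).
Local Notation L1 f := (P.-integrable setT (EFin \o (f : Omega -> R))).

(** The initial action and the step-sizes of the first slot, on which it may
    depend, are merged into one source, indexed by [None]. *)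
Definition source_events (j : option (source n)) : set_system Omega :=
  if j is Some x then source_sigma M x else
  <<s \bigcup_(i in [set: 'I_n.+1])
        (sigma_rv (fun w => a 1%N w 0 i) `|`
         sigma_rv (delta M i 1) `|` sigma_rv (ellt M i 1)) >>.

(** The step-sizes of the first slot already belong to the source [None]. *)
Definition proper_source (j : option (source n)) : Prop :=
  if j is Some x then (0 < slot x)%N /\
    forall i, x <> SrcDelta i 1 /\ x <> SrcEll i 1
  else True.

Definition known (D : set (option (source n))) : set_system Omega :=
  \bigcup_(j in D) source_events j.

Lemma sigma_rv_measurable d2 (T2 : measurableType d2) (X : Omega -> T2) :
  measurable_fun setT X -> sigma_rv X `<=` measurable.
Proof. by move=> mX _ [B mB <-]; exact: mX. Qed.

Lemma sigma_rv_setI d2 (T2 : measurableType d2) (X : Omega -> T2) :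
  setI_closed (sigma_rv X).
Proof.
move=> _ _ [B mB <-] [C mC <-]; exists (B `&` C); first exact: measurableI.
by rewrite !setTI preimage_setI.
Qed.

Lemma smallest_setI (G : set_system Omega) : setI_closed <<s G >>.
Proof. exact: (@measurableI _ (g_sigma_algebraType G)). Qed.

Lemma source_events_setI j : setI_closed (source_events j).
Proof.
by case: j => [[i k|k|i k|k|i k|i k]|];
  (exact: sigma_rv_setI || exact: smallest_setI).
Qed.

Lemma source_events_measurable j : source_events j `<=` measurable.
Proof.
have sub (G : set_system Omega) : G `<=` measurable -> <<s G >> `<=` measurable.
  by move=> mG; apply: smallest_sub => //; exact: sigma_algebra_measurable.
case: j => [[i k|k|i k|k|i k|i k]|].
- exact: sigma_rv_measurable.
- exact: sigma_rv_measurable.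
- exact: sigma_rv_measurable.
- by apply: sub => A [p _]; exact: sigma_rv_measurable.
- exact: sigma_rv_measurable.
- exact: sigma_rv_measurable.
- apply: sub => A [i _ [[|]|]]; apply: sigma_rv_measurable => //.
  exact: init_measurable run i.
Qed.

Lemma known_measurable D : known D `<=` measurable.
Proof. by move=> A [j _]; exact: source_events_measurable. Qed.

(** [None] is independent of all the proper sources of the model by the
    independence assumption on the initial action, and these are mutually
    independent. *)
Lemma proper_sources_indep (s : seq (option (source n)))
    (B : option (source n) -> set Omega) : uniq s ->
  (forall j, j \in s -> proper_source j /\ source_events j (B j)) ->
  P (\big[setI/setT]_(j <- s) B j) = (\prod_(j <- s) P (B j))%E.
Proof.
have somes (s' : seq (option (source n))) : None \notin s' -> uniq s' ->
    (forall j, j \in s' -> proper_source j /\ source_events j (B j)) ->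
    P (\big[setI/setT]_(j <- s') B j) = (\prod_(j <- s') P (B j))%E.
  move=> Ns us sB.
  have -> : s' = map Some (pmap id s').
    elim: s' Ns {us sB} => //= -[x|] s' IH; rewrite inE //= => Ns.
    by rewrite -IH.
  have up : uniq (pmap id s') by apply: pmap_uniq us => //; move=> [].
  rewrite !big_map.
  apply: (mutually_independent_seq (sources_indep hM)) => // x.
  rewrite mem_pmap map_id => xs; have [[x0 _] HB] := sB _ xs.
  by split.
move=> us sB; have [Ns|Ns] := boolP (None \in s); last exact: somes.
have us' := rem_uniq None us.
have Nrem : None \notin rem None s by rewrite mem_rem_uniq// !inE eqxx.
have memrem j : j \in rem None s -> j \in s by exact: mem_rem.
rewrite !(perm_big _ (perm_to_rem Ns))/= !big_cons -somes//; last first.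
  by move=> j /memrem; exact: sB.
apply: (init_indep run); first by have [] := sB _ Ns.
have -> : \big[setI/setT]_(j <- rem None s) B j =
    \big[setI/setT]_(j <- rem None s)
      (if j \in rem None s then B j else setT).
  by apply: eq_big_seq => j ->.
set G := \bigcup_(x in _) _.
apply: (@bigsetI_measurable _ (g_sigma_algebraType G)) => -[x|] _; last first.
  by rewrite (negbTE Nrem); exact: (@measurableT _ (g_sigma_algebraType G)).
case: ifPn => [/memrem xs|_]; last exact: (@measurableT _ (g_sigma_algebraType G)).
have [px HB] := sB _ xs.
by apply: sub_sigma_algebra; exists x.
Qed.

Lemma known_indep (D1 D2 : set (option (source n))) :
  D1 `<=` proper_source -> D2 `<=` proper_source -> D1 `&` D2 `<=` set0 ->
  independent2 P <<s known D1 >> <<s known D2 >>.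
Proof.
move=> p1 p2 D12; apply: independent2_group => // [j _|s B us sB].
  by split; [exact: source_events_setI|exact: source_events_measurable].
apply: proper_sources_indep => // j /sB[[/p1 ?|/p2 ?] ?]; by split.
Qed.

Lemma Ex_indepM (D1 D2 : set (option (source n))) (X Y : Omega -> R) :
  D1 `<=` proper_source -> D2 `<=` proper_source -> D1 `&` D2 `<=` set0 ->
  adapted (known D1) X -> adapted (known D2) Y -> L1 X -> L1 Y ->
  L1 (fun w => X w * Y w) /\ Ex (fun w => X w * Y w) = Ex X * Ex Y.
Proof.
move=> p1 p2 D12; apply: Rintegral_indepM; [exact: known_measurable|
  exact: known_measurable|exact: known_indep].
Qed.

Lemma known_adapted D j d2 (T2 : measurableType d2) (X : Omega -> T2) :
  D j -> sigma_rv X `<=` source_events j -> adapted (known D) X.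
Proof.
move=> Dj HX; apply: adapted_of_sigma => A /HX HA.
by apply: sub_sigma_algebra; exists j.
Qed.

Lemma knownS (D1 D2 : set (option (source n))) : D1 `<=` D2 ->
  known D1 `<=` known D2.
Proof. by move=> D12 A [j /D12 ? ?]; exists j. Qed.

End sources.

(** * Step-sizes and trajectories *)

Section trajectory.
Context (R : realType) (d : measure_display) (Omega : measurableType d)
  (P : probability Omega R) (d' : measure_display) (T : measurableType d')
  (n : nat) (M : dosp_model P T n) (hM : dosp_assumptions M)
  (beta0 gamma0 c1 c2 : R) (beta0_gt0 : 0 < beta0) (gamma0_gt0 : 0 < gamma0)
  (adm : admissible c1 c2).
Local Notation st := (StepSize beta0 gamma0 c1 c2).
Context (a : nat -> Omega -> 'rV[R]_n.+1) (run : dosp_run M st a).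
Local Notation aPhi := (alpha_Phi M).
Local Notation lo := (amin M).
Local Notation hi := (amax M).
Local Notation gam i k w := (gammat M st i k w).
Local Notation bet i k w := (betat M st i k w).

Let c1_gt0 : 0 < c1. Proof. by case: adm => h *; lra. Qed.
Let c2_gt0 : 0 < c2. Proof. by case: adm. Qed.

(** The inverse of the random step index, set to zero at an inactive node: both
    step-sizes are multiples of its powers. *)
Definition rate (i : 'I_n.+1) (k : nat) (w : Omega) : R :=
  (delta M i k w)%:R / (ellt M i k w).+1%:R.

Lemma rate_ge0 i k w : 0 <= rate i k w.
Proof. by rewrite divr_ge0. Qed.

Lemma rate_le1 i k w : rate i k w <= 1.
Proof.
rewrite ler_pdivrMr ?ltr0n// mul1r ler_nat.
by apply: leq_trans (leq_b1 _) _.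
Qed.

Lemma step_power (c0 c : R) i k w : c != 0 ->
  (delta M i k w)%:R * (c0 * (ell M i k w)%:R `^ (- c)) = c0 * rate i k w `^ c.
Proof.
move=> c_neq0; rewrite /rate /ell; case: (delta M i k w).
  by rewrite addn1 !mul1r -powR_inv1// -powRrM mulN1r.
by rewrite !mul0r powR0// mulr0.
Qed.

Lemma betatE i k w : bet i k w = beta0 * rate i k w `^ c1.
Proof. by rewrite /betat /beta/= step_power// gt_eqF. Qed.

Lemma gammatE i k w : gam i k w = gamma0 * rate i k w `^ c2.
Proof. by rewrite /gammat /gamma/= step_power// gt_eqF. Qed.

Lemma betat_ge0 i k w : 0 <= bet i k w.
Proof. by rewrite betatE mulr_ge0 ?powR_ge0// ltW. Qed.

Lemma gammat_ge0 i k w : 0 <= gam i k w.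
Proof. by rewrite gammatE mulr_ge0 ?powR_ge0// ltW. Qed.

Lemma rate_powR_le1 i k w (c : R) : 0 <= c -> rate i k w `^ c <= 1.
Proof.
move=> c0; have -> : 1 = 1 `^ c :> R by rewrite powR1.
rewrite ge0_ler_powR ?nnegrE ?rate_ge0//.
exact: rate_le1.
Qed.

Lemma gammat_le i k w : gam i k w <= gamma0.
Proof. by rewrite gammatE ger_pMr// rate_powR_le1// ltW. Qed.

Lemma betat_le i k w : bet i k w <= beta0.
Proof. by rewrite betatE ger_pMr// rate_powR_le1// ltW. Qed.

Lemma aPhi_ge0 : 0 <= aPhi. Proof. exact/ltW/(alpha_Phi_gt0 hM). Qed.

(** With positive probability a node is active at the first slot with step
    index 1, and then its interval of initial actions is the smallest one;
    it is nonempty, since it contains the initial action. *)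
Lemma interval_nonempty i : lo 0 i + aPhi * gamma0 <= hi 0 i - aPhi * gamma0.
Proof.
have [w [dw lw]] : exists w, delta M i 1 w = true /\ ellt M i 1 w = 0%N.
  apply: contrapT => noex.
  have /andP[q0 q1] : 0 < qa M <= 1 by rewrite (qa_gt0 hM) (qa_le1 hM).
  have Pd : P (delta M i 1 @^-1` [set true]) = (qa M)%:E.
    have := delta_law hM i (ltnSn 0) [set true]; rewrite /distribution/= /pushforward => ->.
    rewrite bernoulli_probE ?(ltW q0)// !diracE.
    rewrite (mem_set (erefl : [set true] true)) (memNset (A := [set true]) (u := false))//=.
    by rewrite mule1 mule0 adde0.
  have Pl : P (ellt M i 1 @^-1` (~` [set 0%N])) = 0%E.
    have := ellt_law hM i (ltnSn 0) (~` [set 0%N]); rewrite /distribution/= /pushforward => ->.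
    rewrite (@binomial_probE _ _ _ (ltW q0) q1) big_ord1 diracE.
    have -> : (nat_of_ord (@ord0 0) \in ~` [set 0%N]) = false.
      by apply/memNset => h; exact: h.
    by rewrite mule0.
  have : (P (delta M i 1 @^-1` [set true]) <= P (ellt M i 1 @^-1` (~` [set 0%N])))%E.
    apply: le_measure; rewrite ?inE//.
    - by rewrite -[X in measurable X]setTI; exact: measurable_funPT.
    - by rewrite -[X in measurable X]setTI; exact: measurable_funPT.
    - by move=> w /= dw lw; apply: noex; exists w.
  by rewrite Pd Pl lee_fin leNgt q0.
have g1 : gam i 1 w = gamma0.
  by rewrite /gammat /gamma /ell dw lw /= mul1r add0n powR1 mulr1.
have /andP[h1 h2] := init_range run i w.
by move: h1 h2; rewrite g1 => h1 h2; exact: le_trans h1 h2.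
Qed.

Lemma shrunk_interval i k w :
  lo 0 i + aPhi * gam i k w <= hi 0 i - aPhi * gam i k w.
Proof.
have h : aPhi * gam i k w <= aPhi * gamma0 by rewrite ler_wpM2l ?aPhi_ge0 ?gammat_le.
by have := interval_nonempty i; lra.
Qed.

Lemma shift_ge0 i k w : 0 <= aPhi * gam i k w.
Proof. by rewrite mulr_ge0 ?aPhi_ge0 ?gammat_ge0. Qed.

Lemma lo_lt_hi i : lo 0 i < hi 0 i.
Proof. by have /andP[h1 h2] := astar_interior hM i; exact: lt_trans h2. Qed.

Lemma lo_le_hi i : lo 0 i <= hi 0 i. Proof. exact/ltW/lo_lt_hi. Qed.

Lemma action_range k i w : (0 < k)%N ->
  lo 0 i + aPhi * gam i k w <= a k w 0 i <= hi 0 i - aPhi * gam i k w.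
Proof.
case: k => // -[_|k _]; first exact: (init_range run).
by rewrite (update run)//; apply: project_in; exact: shrunk_interval.
Qed.

Lemma action_box k w : (0 < k)%N -> actions M (a k w).
Proof.
move=> k0 i; have := action_range i w k0; have := shift_ge0 i k w.
by move=> s0 /andP[h1 h2]; apply/andP; split; lra.
Qed.

Lemma perturbation_le k i w : (0 < k)%N ->
  `|gam i k w * Phi M i k w| <= aPhi * gam i k w.
Proof.
move=> k0; rewrite normrM ger0_norm ?gammat_ge0// mulrC.
by rewrite ler_wpM2r ?gammat_ge0// (Phi_bound hM).
Qed.

Lemma performed_box k w : (0 < k)%N -> actions M (performed M st (a k w) k w).
Proof.
move=> k0 i; have := action_range i w k0; have := perturbation_le i w k0.
rewrite ler_norml mxE => /andP[h1 h2] /andP[h3 h4].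
by apply/andP; split; lra.
Qed.

(** The update projected onto the whole box: unlike [a k], it does not depend on
    the step-sizes of slot [k], and [a k] is its projection onto the box shrunk
    by these. *)
Definition iterate (k : nat) (w : Omega) : 'rV[R]_n.+1 :=
  \row_i project (lo 0 i) (hi 0 i) (a k.-1 w 0 i +
    bet i k.-1 w * Phi M i k.-1 w * f_estimate M st (a k.-1 w) i k.-1 w).

Lemma iterate_box k w : actions M (iterate k w).
Proof. by move=> i; rewrite mxE; apply: project_in; exact: lo_le_hi. Qed.

Lemma action_iterate k i w : (1 < k)%N ->
  a k w 0 i = project (lo 0 i + aPhi * gam i k w) (hi 0 i - aPhi * gam i k w)
                      (iterate k w 0 i).
Proof.
case: k => // k k0; rewrite mxE (update run)// project_project//.
  exact: shift_ge0.
exact: shrunk_interval.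
Qed.

Lemma astar_margin : exists2 r : R, 0 < r & forall i,
  lo 0 i + r <= astar M 0 i <= hi 0 i - r.
Proof.
pose m i := Num.min (astar M 0 i - lo 0 i) (hi 0 i - astar M 0 i).
have m0 i : 0 < m i.
  by have /andP[h1 h2] := astar_interior hM i; rewrite lt_min !subr_gt0 h1.
exists (\big[Num.min/1]_i m i).
  by apply/bigmin_gtP; split.
move=> i; have : \big[Num.min/1]_i m i <= m i by exact: bigmin_le_cond.
rewrite /m le_min => /andP[h1 h2]; apply/andP; split; lra.
Qed.

Lemma active_prod (k : nat) (dl : activity n) :
  (fun w => (active M k w == dl)%:R : R) =
  (fun w => \prod_i (delta M i k w == dl i)%:R).
Proof.
apply/funext => w; have [<-|ne] := eqVneq.
  by rewrite big1// => i _; rewrite ffunE eqxx.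
have [i ni] : exists i, delta M i k w != dl i.
  apply/existsP; apply: contraR ne => /existsPn h.
  by apply/eqP/ffunP => i; rewrite ffunE; exact/eqP/negPn/h.
by rewrite (bigD1 i)//= (negbTE ni) mul0r.
Qed.

Section adaptedness.
Variable D : set (option (source n)).
Local Notation KD := (known M a D).

Lemma adapted_bool d2 (S : measurableType d2) (X : S -> bool) (b : bool) :
  measurable_fun setT X -> measurable_fun setT (fun w => (X w == b)%:R : R).
Proof.
move=> mX; apply: (measurableT_comp (f := fun c : bool => (c == b)%:R : R)) mX.
by [].
Qed.

Lemma adapted_rate i k :
  adapted KD (delta M i k) -> adapted KD (ellt M i k) -> adapted KD (rate i k).
Proof.
move=> aD aE; apply: measurable_funM.
  exact: (measurableT_comp (f := fun c : bool => c%:R : R)) aD.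
exact: (measurableT_comp (f := fun c : nat => c.+1%:R^-1 : R)) aE.
Qed.

Lemma adapted_powR (X : Omega -> R) (c : R) :
  adapted KD X -> adapted KD (fun w => X w `^ c).
Proof. by move=> aX; exact: (measurableT_comp (measurable_powR c)) aX. Qed.

Lemma adapted_gammat i k :
  adapted KD (delta M i k) -> adapted KD (ellt M i k) ->
  adapted KD (fun w => gam i k w).
Proof.
move=> aD aE; rewrite (_ : (fun w => _) = (fun w => gamma0 * rate i k w `^ c2)).
  apply: measurable_funM => //; exact: (adapted_powR c2 (adapted_rate aD aE)).
by apply/funext => w; rewrite gammatE.
Qed.

Lemma adapted_betat i k :
  adapted KD (delta M i k) -> adapted KD (ellt M i k) ->
  adapted KD (fun w => bet i k w).
Proof.
move=> aD aE; rewrite (_ : (fun w => _) = (fun w => beta0 * rate i k w `^ c1)).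
  apply: measurable_funM => //; exact: (adapted_powR c1 (adapted_rate aD aE)).
by apply/funext => w; rewrite betatE.
Qed.

Lemma adapted_active (k : nat) (dl : activity n) :
  (forall i, adapted KD (delta M i k)) ->
  adapted KD (fun w => (active M k w == dl)%:R : R).
Proof.
move=> aD; rewrite active_prod; apply: measurable_prod => i _; exact: adapted_bool (aD i).
Qed.

Lemma adapted_project (f l h : Omega -> R) :
  adapted KD f -> adapted KD l -> adapted KD h ->
  adapted KD (fun w => project (l w) (h w) (f w)).
Proof.
move=> af al ah; apply: measurable_minr => //.
exact: measurable_maxr.
Qed.

Lemma enorm_mask_le (x : 'rV[R]_n.+1) (dl : activity n) :
  enorm (\row_j (x 0 j * (dl j)%:R)) <= \sum_(j | dl j) `|x 0 j|.
Proof.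
rewrite /enorm /dotv -[leRHS]ger0_norm ?sumr_ge0// -sqrtr_sqr ler_wsqrtr//.
rewrite expr2 big_distrl/= [leRHS]big_mkcond/=; apply: ler_sum => j _.
rewrite mxE; case: ifP => dj; last by rewrite !mulr0.
rewrite !mulr1 -expr2 -real_normK ?num_real// expr2 ler_wpM2l//.
by rewrite (bigD1 j)//= lerDl sumr_ge0.
Qed.

Lemma utility_lip j (dl : activity n) s x y : actions M x -> actions M y ->
  `|utility M j x dl s - utility M j y dl s| <=
    `|lipS M s| * \sum_(i | dl i) `|x 0 i - y 0 i|.
Proof.
move=> bx by_; apply: le_trans (utility_lipschitz hM j dl s bx by_) _.
apply: (@le_trans _ _ (`|lipS M s| * enorm (\row_i ((x - y) 0 i * (dl i)%:R)))).
  by rewrite ler_wpM2r ?ler_norm ?sqrtr_ge0.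
rewrite ler_wpM2l//; apply: le_trans (enorm_mask_le _ _) _.
by apply: ler_sum => i _; rewrite !mxE.
Qed.

Lemma utility_lipT j (dl : activity n) s x y : actions M x -> actions M y ->
  `|utility M j x dl s - utility M j y dl s| <=
    `|lipS M s| * \sum_i `|x 0 i - y 0 i|.
Proof.
move=> bx by_; apply: le_trans (utility_lip j dl s bx by_) _.
by rewrite ler_wpM2l// [leRHS](bigID (fun i => dl i))/= lerDl sumr_ge0.
Qed.

(** The utility is measurable in the state and Lipschitz in the action, so it can
    be evaluated at a random action. *)
Lemma adapted_utility j k (q : Omega -> 'rV[R]_n.+1) :
  (forall i, adapted KD (fun w => q w 0 i)) -> (forall w, actions M (q w)) ->
  (forall i, adapted KD (delta M i k)) -> adapted KD (state M k) ->
  adapted KD (fun w => utility M j (q w) (active M k w) (state M k w)).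
Proof.
move=> aq bq aD aS.
rewrite (_ : (fun w => _) = (fun w => \sum_(dl : activity n)
    (active M k w == dl)%:R * utility M j (q w) dl (state M k w))); last first.
  apply/funext => w; rewrite (bigD1 (active M k w))//= eqxx mul1r.
  rewrite big1 ?addr0// => dl; rewrite eq_sym => /negbTE ->.
  by rewrite mul0r.
apply: measurable_sum => dl; apply: measurable_funM; first exact: adapted_active.
apply: (caratheodory_measurable (lo := lo) (hi := hi)
  (S := g_sigma_algebraType KD)
  (g := fun x w => utility M j x dl (state M k w))) => //.
- exact: lo_le_hi.
- move=> x bx; apply: (measurableT_comp (utility_measurable hM _ _ _)) => //.
- move=> w; apply: (lipschitz_continuous_sum (l := `|lipS M (state M k w)|)).
  by move=> x y bx by_; exact: utility_lipT.
Qed.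

Lemma adapted_performed i k :
  adapted KD (fun w => a k w 0 i) ->
  adapted KD (delta M i k) -> adapted KD (ellt M i k) -> adapted KD (Phi M i k) ->
  adapted KD (fun w => performed M st (a k w) k w 0 i).
Proof.
move=> aa aD aE aPhi_; under eq_fun do rewrite mxE.
by apply: measurable_funD => //; apply: measurable_funM => //; exact: adapted_gammat.
Qed.

End adaptedness.

End trajectory.

(** * Dependence of the trajectory on the past *)

Section filtration.
Context (R : realType) (d : measure_display) (Omega : measurableType d)
  (P : probability Omega R) (d' : measure_display) (T : measurableType d')
  (n : nat) (M : dosp_model P T n) (hM : dosp_assumptions M)
  (beta0 gamma0 c1 c2 : R) (beta0_gt0 : 0 < beta0) (gamma0_gt0 : 0 < gamma0)
  (adm : admissible c1 c2).
Local Notation st := (StepSize beta0 gamma0 c1 c2).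
Context (a : nat -> Omega -> 'rV[R]_n.+1) (run : dosp_run M st a).
Local Notation aPhi := (alpha_Phi M).
Local Notation lo := (amin M).
Local Notation hi := (amax M).
Local Notation gam i k w := (gammat M st i k w).
Implicit Types (D : set (option (source n))).
Local Notation known := (known M a).
Local Notation iterate := (iterate M beta0 gamma0 c1 c2 a).

Lemma f_estimateE x i k w : f_estimate M st x i k w =
  observed_utility M st x i k w + (qr M)^-1 *
    \sum_(j | j != i) (delta M j k w)%:R * (recv M i j k w)%:R *
      observed_utility M st x j k w.
Proof.
rewrite /f_estimate big_mkcond [in RHS]big_mkcond/=; congr (_ + _ * _).
apply: eq_bigr => j _; rewrite /received inE andbCA.
by case: (j != i); case: (delta M j k w); case: (recv M i j k w);
  rewrite //= ?mul1r ?mul0r.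
Qed.

(** The source [None] counts as past: only slots after the first are considered. *)
Definition past (k : nat) : set (option (source n)) :=
  [set j | proper_source j /\ if j is Some x then (slot x < k)%N else True].

Lemma past_proper k : past k `<=` @proper_source n.
Proof. by move=> j []. Qed.

Lemma pastS k l : (k <= l)%N -> past k `<=` past l.
Proof. by move=> kl [x|] [px hx]; split => //; exact: leq_trans kl. Qed.

Lemma proper_slot (x : source n) : (1 < slot x)%N -> proper_source (Some x).
Proof.
move=> x1; split => [|i]; first exact: ltn_trans x1.
by split => E; move: x1; rewrite E.
Qed.

Lemma adapted_recv D i j k : D (Some (SrcRecv n k)) ->
  adapted (known D) (recv M i j k).
Proof.
move=> Dk; apply: (known_adapted Dk) => A HA; apply: sub_sigma_algebra.
by exists (i, j).
Qed.

Lemma adapted_some D (x : source n) d2 (T2 : measurableType d2) (X : Omega -> T2) :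
  D (Some x) -> sigma_rv X = source_sigma M x -> adapted (known D) X.
Proof. by move=> Dx XE; apply: (known_adapted Dx); rewrite XE. Qed.

Lemma adapted_step i k : (0 < k)%N ->
  adapted (known (past k.+1)) (delta M i k) /\
  adapted (known (past k.+1)) (ellt M i k).
Proof.
case: k => // -[_|k _]; last first.
  by split; [apply: (adapted_some (x := SrcDelta i k.+2))|
    apply: (adapted_some (x := SrcEll i k.+2))] => //; split => //; exact: proper_slot.
have N : past 2 None by [].
by split; apply: (known_adapted N) => A HA; apply: sub_sigma_algebra;
  exists i => //; [left; right|right].
Qed.

Lemma adapted_f_estimate D i k :
  (0 < k)%N ->
  (forall i, adapted (known D) (fun w => a k w 0 i)) ->
  (forall i, adapted (known D) (delta M i k)) ->
  (forall i, adapted (known D) (ellt M i k)) ->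
  (forall i, adapted (known D) (Phi M i k)) ->
  (forall i, adapted (known D) (Defs.eta M i k)) ->
  (forall i j, adapted (known D) (recv M i j k)) ->
  adapted (known D) (state M k) ->
  adapted (known D) (fun w => f_estimate M st (a k w) i k w).
Proof.
move=> k0 aa aD aE aF aN aR aS.
have aO j : adapted (known D) (fun w => observed_utility M st (a k w) j k w).
  apply: measurable_funD; last exact: aN.
  apply: (adapted_utility hM) => //.
    by move=> l; exact: adapted_performed.
  by move=> w; exact: (performed_box hM).
rewrite (_ : (fun w => _) = (fun w => observed_utility M st (a k w) i k w +
    (qr M)^-1 * \sum_(j | j != i) (delta M j k w)%:R * (recv M i j k w)%:R *
      observed_utility M st (a k w) j k w)); last first.
  by apply/funext => w; exact: f_estimateE.
apply: measurable_funD; first exact: aO.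
apply: measurable_funM => //.
under eq_fun do rewrite big_mkcond/=.
apply: measurable_sum => j; case: (j != i) => //.
apply: measurable_funM; last exact: aO.
apply: measurable_funM.
  exact: (measurableT_comp (f := fun c : bool => c%:R : R)) (aD j).
exact: (measurableT_comp (f := fun c : bool => c%:R : R)) (aR i j).
Qed.

Lemma adapted_action D i k : (1 < k)%N ->
  adapted (known D) (fun w => iterate k w 0 i) ->
  adapted (known D) (delta M i k) -> adapted (known D) (ellt M i k) ->
  adapted (known D) (fun w => a k w 0 i).
Proof.
move=> k1 ai aD aE.
rewrite (_ : (fun w => _) = (fun w => project (lo 0 i + aPhi * gam i k w)
    (hi 0 i - aPhi * gam i k w) (iterate k w 0 i))); last first.
  by apply/funext => w; exact: action_iterate.
have ag : adapted (known D) (fun w => aPhi * gam i k w).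
  by apply: measurable_funM => //; exact: adapted_gammat.
apply: adapted_project => //.
  exact: measurable_funD.
exact: measurable_funB.
Qed.

Lemma adapted_iterateS k i : (0 < k)%N ->
  (forall i, adapted (known (past k.+1)) (fun w => a k w 0 i)) ->
  adapted (known (past k.+1)) (fun w => iterate k.+1 w 0 i).
Proof.
move=> k0 aa.
have aD j := (adapted_step j k0).1; have aE j := (adapted_step j k0).2.
have px (x : source n) : slot x = k -> (forall j, x <> SrcDelta j 1 /\ x <> SrcEll j 1) ->
    past k.+1 (Some x).
  by move=> xk hx; split; rewrite ?xk//; split => //; rewrite xk.
under eq_fun do rewrite mxE.
have aF j : adapted (known (past k.+1)) (Phi M j k).
  by apply: (adapted_some (x := SrcPhi j k)) => //; apply: px.
apply: adapted_project; [|exact: measurable_cst|exact: measurable_cst].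
apply: measurable_funD; first exact: aa.
apply: measurable_funM.
  by apply: measurable_funM; [exact: adapted_betat|exact: aF].
apply: adapted_f_estimate => //.
- by move=> j; apply: (adapted_some (x := SrcEta j k)) => //; apply: px.
- by move=> j l; apply: adapted_recv; apply: px.
- by apply: (adapted_some (x := SrcState n k)) => //; apply: px.
Qed.

Lemma adapted_trajectory k i : (0 < k)%N ->
  adapted (known (past k.+1)) (fun w => a k w 0 i).
Proof.
elim: k i => // -[_ i _|k IH i _].
  have N : past 2 None by [].
  apply: (known_adapted N) => A HA; apply: sub_sigma_algebra.
  by exists i => //; left; left.
have [aD aE] := adapted_step i (ltn0Sn k.+1).
apply: adapted_action => //.
apply: (adaptedS (knownS (pastS (leqnSn k.+2)))).
by apply: adapted_iterateS => // j; exact: IH.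
Qed.

Lemma adapted_iterate k i : (1 < k)%N ->
  adapted (known (past k)) (fun w => iterate k w 0 i).
Proof.
case: k => // k k0; apply: adapted_iterateS => // j.
exact: adapted_trajectory.
Qed.

End filtration.

(** * Moments of the step-sizes *)

Section step_sizes.
Context (R : realType) (d : measure_display) (Omega : measurableType d)
  (P : probability Omega R) (d' : measure_display) (T : measurableType d')
  (n : nat) (M : dosp_model P T n) (hM : dosp_assumptions M)
  (beta0 gamma0 c1 c2 : R) (beta0_gt0 : 0 < beta0) (gamma0_gt0 : 0 < gamma0)
  (adm : admissible c1 c2).
Local Notation st := (StepSize beta0 gamma0 c1 c2).
Local Notation Ex f := (Rintegral P setT f).
Local Notation L1 f := (P.-integrable setT (EFin \o (f : Omega -> R))).
Local Notation gam i k w := (gammat M st i k w).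
Local Notation bet i k w := (betat M st i k w).
Local Notation rate := (rate M).

Let qa01 : 0 <= qa M <= 1.
Proof. by rewrite (ltW (qa_gt0 hM)) (qa_le1 hM). Qed.

Lemma powR_le1D (x s : R) : 0 <= x -> 0 <= s <= 2 -> x `^ s <= 1 + x ^+ 2.
Proof.
move=> x0 /andP[s0 s2]; have [x1|x1] := leP x 1.
  apply: (@le_trans _ _ 1); last by rewrite lerDl sqr_ge0.
  have -> : 1 = 1 `^ s :> R by rewrite powR1.
  by rewrite ge0_ler_powR ?nnegrE.
rewrite -powR_mulrn// (le_trans (ler_powR _ s2)) ?lerDr//; exact: ltW.
Qed.

(** Sums and maxima of step-sizes over the nodes are controlled by powers of
    the sum of the rates. *)
Definition total_rate (k : nat) (w : Omega) : R := \sum_i rate i k w.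

Lemma rate_le_total i k w : rate i k w <= total_rate k w.
Proof.
by rewrite /total_rate (bigD1 i)//= lerDl sumr_ge0// => j _; exact: rate_ge0.
Qed.

Lemma total_rate_ge0 k w : 0 <= total_rate k w.
Proof. by apply: sumr_ge0 => i _; exact: rate_ge0. Qed.

Lemma total_rate_le k w : total_rate k w <= n.+1%:R.
Proof.
apply: (@le_trans _ _ (\sum_(i < n.+1) 1)); last by rewrite sumr_const card_ord.
by apply: ler_sum => i _; exact: rate_le1.
Qed.

Lemma measurable_rate i k : measurable_fun setT (rate i k).
Proof.
apply: measurable_funM.
  exact: (measurableT_comp (f := fun c : bool => c%:R : R)).
exact: (measurableT_comp (f := fun c : nat => c.+1%:R^-1 : R)).
Qed.

Lemma measurable_total_rate k : measurable_fun setT (total_rate k).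
Proof. by apply: measurable_sum => i; exact: measurable_rate. Qed.

Lemma measurable_total_rate_powR k s :
  measurable_fun setT (fun w => total_rate k w `^ s).
Proof. exact: (measurableT_comp (measurable_powR s) (measurable_total_rate k)). Qed.

Lemma total_rate_powR_le k s w : 0 <= s -> total_rate k w `^ s <= n.+1%:R `^ s.
Proof.
by move=> s0; rewrite ge0_ler_powR ?nnegrE ?total_rate_ge0 ?total_rate_le.
Qed.

Lemma L1_total_rate k s : 0 <= s -> L1 (fun w => total_rate k w `^ s).
Proof.
move=> s0; apply: (@L1_bounded _ _ _ P _ (n.+1%:R `^ s)).
  exact: measurable_total_rate_powR.
by move=> w; rewrite ger0_norm ?powR_ge0// total_rate_powR_le.
Qed.

Definition rate_const : R := 1 + n.+1%:R * \sum_(i < n.+1) (2 / qa M ^+ 2).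

Lemma rate_const_ge0 : 0 <= rate_const.
Proof.
rewrite addr_ge0// mulr_ge0// sumr_ge0// => i _.
by rewrite divr_ge0 ?sqr_ge0.
Qed.

Lemma Ex_rate_sqr i k : (0 < k)%N ->
  L1 (fun w => rate i k w ^+ 2) /\
  Ex (fun w => rate i k w ^+ 2) <= 2 / qa M ^+ 2 * k%:R ^- 2.
Proof.
case: k => // k _.
have inv0 (x : nat) : 0 <= x.+1%:R ^- 2 :> R by rewrite invr_ge0 exprn_ge0.
have [iE EE] := Ex_binomial qa01 (ellt_law hM i (ltn0Sn k))
  (f := fun x => x.+1%:R ^- 2) inv0.
have le w : rate i k.+1 w ^+ 2 <= (ellt M i k.+1 w).+1%:R ^- 2.
  rewrite /rate/= expr_div_n ler_piMl ?invr_ge0 ?exprn_ge0//.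
  by case: (delta M i k.+1 w); rewrite ?expr1n ?expr0n.
have iR : L1 (fun w => rate i k.+1 w ^+ 2).
  apply: L1_le iE => [|w].
    by apply: measurable_funX; exact: measurable_rate.
  by rewrite ger0_norm ?sqr_ge0// le.
split => //; apply: le_trans (le_Ex iR iE le) _.
rewrite EE; apply: binomial_inv_sqr; [exact: qa_gt0 hM|exact: qa_le1 hM].
Qed.

(** A power [s <= 2] is dominated by [1] plus the square, applied to [k] times the
    rate: only second moments, hence [binomial_inv_sqr], are needed. *)
Lemma Ex_total_rate k s : (0 < k)%N -> 0 <= s <= 2 ->
  Ex (fun w => total_rate k w `^ s) <= rate_const * k%:R `^ (- s).
Proof.
move=> k0 /andP[s0 s2].
have kR : (0 : R) < k%:R by rewrite ltr0n.
have le w : total_rate k w `^ s <=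
    k%:R `^ (- s) * (1 + k%:R ^+ 2 * (n.+1%:R * \sum_i rate i k w ^+ 2)).
  rewrite powRN mulrC ler_pdivlMr ?powR_gt0// -powRM ?total_rate_ge0 ?ler0n//.
  apply: le_trans (powR_le1D _ _) _; rewrite ?mulr_ge0 ?total_rate_ge0 ?s0 ?s2//.
  rewrite lerD2l exprMn mulrC ler_wpM2l ?sqr_ge0//.
  by have := sqr_sum_le (fun i => rate i k w); rewrite card_ord.
have iS : L1 (fun w => \sum_i rate i k w ^+ 2).
  by apply: L1_sum => i _; have [] := Ex_rate_sqr i k0.
apply: le_trans (le_Ex (L1_total_rate k s0) _ le) _.
  by apply: L1Zl; apply: L1D; [exact: L1_cst|do 2 apply: L1Zl].
rewrite ExZl; last by apply: L1D; [exact: L1_cst|do 2 apply: L1Zl].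
rewrite ExD; [|exact: L1_cst|by do 2 apply: L1Zl].
rewrite Ex_cst ExZl; last exact: L1Zl.
rewrite ExZl// mulrC ler_wpM2r ?powR_ge0// lerD2l mulrCA ler_wpM2l//.
rewrite Ex_sum => [|i _]; last by have [] := Ex_rate_sqr i k0.
rewrite mulr_sumr; apply: ler_sum => i _.
have [_] := Ex_rate_sqr i k0.
by rewrite ler_pdivlMr ?exprn_gt0// mulrC.
Qed.

(** Given that a node is active, the product of its two step-sizes, as a function
    of the binomial variable [x]. *)
Definition step_product (x : nat) : R :=
  beta0 * x.+1%:R `^ (- c1) * (gamma0 * x.+1%:R `^ (- c2)).

Lemma step_product_ge0 x : 0 <= step_product x.
Proof. by rewrite !mulr_ge0 ?powR_ge0// ltW. Qed.

Lemma betat_gammat i k w :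
  bet i k w * gam i k w = (delta M i k w)%:R * step_product (ellt M i k w).
Proof.
rewrite /betat /gammat /beta /gamma /ell /step_product/=.
by case: (delta M i k w); rewrite ?mul0r// addn1 !mul1r.
Qed.

(** The expectation of [step_product] under the law of the step index. *)
Definition mean_product (k : nat) : R :=
  \sum_(x < k.-1.+1) qa M ^+ x * (1 - qa M) ^+ (k.-1 - x) *+ 'C(k.-1, x) *
    step_product x.

Lemma Ex_step_product i k : (0 < k)%N ->
  L1 (fun w => step_product (ellt M i k w)) /\
  Ex (fun w => step_product (ellt M i k w)) = mean_product k.
Proof.
move=> k0; exact: Ex_binomial qa01 (ellt_law hM i k0) step_product_ge0.
Qed.

(** At slot [k] the step index is at most [k], and step-sizes decrease. *)
Lemma mean_product_ge k : (0 < k)%N ->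
  beta0 * gamma0 * k%:R `^ (- (c1 + c2)) <= mean_product k.
Proof.
case: k => // k _; rewrite /mean_product/=.
rewrite -[leLHS]mul1r -[X in X * _](binomial_weights k (qa M)) mulr_suml.
have /andP[q0 q1] := qa01; have q1' : 0 <= 1 - qa M by rewrite subr_ge0.
apply: ler_sum => x _; rewrite ler_wpM2l ?mulrn_wge0 ?mulr_ge0 ?exprn_ge0//.
have -> : step_product x = beta0 * gamma0 * x.+1%:R `^ (- (c1 + c2)).
  rewrite opprD powRD; last by apply/implyP => _; rewrite pnatr_eq0.
  by rewrite /step_product; ring.
rewrite ler_wpM2l ?mulr_ge0 ?(ltW beta0_gt0) ?(ltW gamma0_gt0)//.
case: adm => h1 _ h2 _.
rewrite !powRN lef_pV2 ?posrE ?powR_gt0 ?ltr0n// ge0_ler_powR ?nnegrE ?ler_nat//.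
by lra.
Qed.

End step_sizes.

(** * The objective and its gradient *)

Section objective.
Context (R : realType) (d : measure_display) (Omega : measurableType d)
  (P : probability Omega R) (d' : measure_display) (T : measurableType d')
  (n : nat) (M : dosp_model P T n) (hM : dosp_assumptions M).
Local Notation Ex f := (Rintegral P setT f).
Local Notation L1 f := (P.-integrable setT (EFin \o (f : Omega -> R))).
Local Notation lo := (amin M).
Local Notation hi := (amax M).

Lemma L1_of_expectation (X : Omega -> R) : measurable_fun setT X ->
  (forall w, 0 <= X w) -> ('E_P[X] < +oo)%E -> L1 X.
Proof.
move=> mX X0; rewrite unlock => EX; apply/integrableP; split.
  exact/measurable_EFinP.
by under eq_integral do rewrite /= ger0_norm//.
Qed.

Lemma L1_of_sqr (X : Omega -> R) : measurable_fun setT X ->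
  L1 (fun w => X w ^+ 2) -> L1 X.
Proof.
move=> mX iX; apply: (L1_le (Y := fun w => 1 + X w ^+ 2)) => // [w|].
  by rewrite -[X w ^+ 2]real_normK ?num_real//; nra.
by apply: L1D => //; exact: L1_cst.
Qed.

Definition diameter : R := \sum_i (hi 0 i - lo 0 i).

Lemma actions_sum_le x y : actions M x -> actions M y ->
  \sum_i `|x 0 i - y 0 i| <= diameter.
Proof.
move=> bx by_; apply: ler_sum => i _.
have /andP[x1 x2] := bx i; have /andP[y1 y2] := by_ i.
by rewrite ler_norml; apply/andP; split; lra.
Qed.

Lemma actions_coord_le x y i : actions M x -> actions M y ->
  `|x 0 i - y 0 i| <= diameter.
Proof.
move=> bx by_; apply: le_trans (actions_sum_le bx by_).
by rewrite (bigD1 i)//= lerDl sumr_ge0.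
Qed.

Lemma diameter_ge0 : 0 <= diameter.
Proof.
exact: le_trans (normr_ge0 _) (actions_coord_le ord0 (astar_in hM) (astar_in hM)).
Qed.

(** The square of a utility over all actions is dominated by a function of the
    state alone, by the Lipschitz condition. *)
Definition envelope (j : 'I_n.+1) (t : T) : R :=
  2 * \sum_(dl : activity n) utility M j (astar M) dl t ^+ 2 +
  2 * diameter ^+ 2 * lipS M t ^+ 2.

Lemma utility_envelope j x dl t : actions M x ->
  utility M j x dl t ^+ 2 <= envelope j t.
Proof.
move=> bx.
have h : `|utility M j x dl t - utility M j (astar M) dl t| <= `|lipS M t| * diameter.
  apply: le_trans (utility_lipT hM j dl t bx (astar_in hM)) _.
  by rewrite ler_wpM2l// actions_sum_le//; exact: astar_in hM.
have h2 : (utility M j x dl t - utility M j (astar M) dl t) ^+ 2 <=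
    (diameter * lipS M t) ^+ 2.
  rewrite -[leLHS]real_normK ?num_real// -[leRHS]real_normK ?num_real//.
  by rewrite lerXn2r ?nnegrE// normrM (ger0_norm diameter_ge0) mulrC.
have h3 : utility M j (astar M) dl t ^+ 2 <=
    \sum_(dl : activity n) utility M j (astar M) dl t ^+ 2.
  by rewrite (bigD1 dl)//= lerDl sumr_ge0// => ? _; exact: sqr_ge0.
move: h2 h3; rewrite /envelope exprMn.
have := sqr_ge0 (utility M j x dl t - 2 * utility M j (astar M) dl t).
move: (\sum_dl _) (utility M j x dl t) (utility M j (astar M) dl t) => S u v.
by rewrite -mulrA; move: (diameter ^+ 2 * lipS M t ^+ 2) => W; nra.
Qed.

Lemma envelope_measurable j : measurable_fun setT (envelope j).
Proof.
apply: measurable_funD; apply: measurable_funM => //.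
  apply: measurable_sum => dl; apply: measurable_funX.
  exact: utility_measurable hM _ _ _ (astar_in hM).
exact/measurable_funX/(lipschitz_measurable hM).
Qed.

Lemma L1_lipS2 : L1 (fun w => lipS M (state M 1 w) ^+ 2).
Proof.
apply: L1_of_expectation => [|w|]; last exact: lipschitz_L2 hM.
  apply: measurable_funX.
  exact: (measurableT_comp (lipschitz_measurable hM)).
exact: sqr_ge0.
Qed.

Lemma L1_utility2 j x dl : actions M x ->
  L1 (fun w => utility M j x dl (state M 1 w) ^+ 2).
Proof.
move=> bx; apply: L1_of_expectation => [|w|]; last exact: utility_L2 hM _ _ _ bx.
  apply: measurable_funX.
  exact: (measurableT_comp (utility_measurable hM _ _ bx)).
exact: sqr_ge0.
Qed.

Lemma Ex_state (f : T -> R) k : (0 < k)%N -> measurable_fun setT f ->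
  L1 (fun w => f (state M 1 w)) ->
  L1 (fun w => f (state M k w)) /\
  Ex (fun w => f (state M k w)) = Ex (fun w => f (state M 1 w)).
Proof.
move=> k0 mf if_; apply: Ex_law => // B mB; exact: state_law hM _ _ k0 mB.
Qed.

Lemma L1_envelope j : L1 (fun w => envelope j (state M 1 w)).
Proof.
apply: L1D; last exact/L1Zl/L1_lipS2.
apply: L1Zl; apply: L1_sum => dl _.
exact/L1_utility2/(astar_in hM).
Qed.

Lemma L1_lipS k : (0 < k)%N -> L1 (fun w => `|lipS M (state M k w)|) /\
  Ex (fun w => `|lipS M (state M k w)|) = Ex (fun w => `|lipS M (state M 1 w)|).
Proof.
move=> k0; apply: (Ex_state (f := fun t => `|lipS M t|)) => //.
  exact: (measurableT_comp _ (lipschitz_measurable hM)).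
apply: L1_norm; apply: L1_of_sqr L1_lipS2.
exact: (measurableT_comp (lipschitz_measurable hM)).
Qed.

Lemma L1_utility j x dl k : (0 < k)%N -> actions M x ->
  L1 (fun w => utility M j x dl (state M k w)).
Proof.
move=> k0 bx; have mu := utility_measurable hM j dl bx.
apply: (Ex_state k0 mu _).1; apply: L1_of_sqr; last exact: L1_utility2.
exact: measurableT_comp.
Qed.

Lemma total_utility_measurable x dl : actions M x ->
  measurable_fun setT (total_utility M x dl).
Proof.
move=> bx; rewrite (_ : total_utility M x dl =
    fun t => \sum_(i <- enum 'I_n.+1) (dl i)%:R * utility M i x dl t); last first.
  apply/funext => t; rewrite /total_utility big_mkcond big_enum/=.
  by apply: eq_bigr => i _; case: ifP; rewrite ?mul1r ?mul0r.
apply: measurable_sum => i; apply: measurable_funM => //.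
exact: utility_measurable hM _ _ _ bx.
Qed.

Lemma L1_total x dl k : (0 < k)%N -> actions M x ->
  L1 (fun w => total_utility M x dl (state M k w)).
Proof. by move=> k0 bx; apply: L1_sum => i _; exact: L1_utility. Qed.

Lemma Ex_total x dl k : (0 < k)%N -> actions M x ->
  Ex (fun w => total_utility M x dl (state M k w)) = Gfun M dl x.
Proof.
move=> k0 bx; rewrite /Gfun fine_expectation.
by have [] := Ex_state k0 (total_utility_measurable dl bx) (L1_total dl (ltn0Sn 0) bx).
Qed.

Lemma total_lip dl t x y : actions M x -> actions M y ->
  `|total_utility M x dl t - total_utility M y dl t| <=
    n.+1%:R * `|lipS M t| * \sum_(i | dl i) `|x 0 i - y 0 i|.
Proof.
move=> bx by_; rewrite /total_utility -sumrB (le_trans (ler_norm_sum _ _ _))//.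
apply: (@le_trans _ _ (\sum_(i < n.+1) `|lipS M t| * \sum_(i | dl i) `|x 0 i - y 0 i|)).
  rewrite [leRHS](bigID (fun i => dl i))/= -[leLHS]addr0 lerD//.
    by apply: ler_sum => i _; exact: utility_lip.
  by apply: sumr_ge0 => i _; rewrite mulr_ge0// sumr_ge0.
by rewrite sumr_const card_ord -[leLHS]mulr_natl mulrA.
Qed.

Lemma total_lipT dl t x y : actions M x -> actions M y ->
  `|total_utility M x dl t - total_utility M y dl t| <=
    n.+1%:R * `|lipS M t| * \sum_i `|x 0 i - y 0 i|.
Proof.
move=> bx by_; apply: le_trans (total_lip dl t bx by_) _.
rewrite ler_wpM2l ?mulr_ge0// [leRHS](bigID (fun i => dl i))/= lerDl.
exact: sumr_ge0.
Qed.

Definition lipG : R := n.+1%:R * Ex (fun w => `|lipS M (state M 1 w)|).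

Lemma lipG_ge0 : 0 <= lipG.
Proof. by rewrite mulr_ge0// Ex_ge0. Qed.

Lemma Gfun_lip dl x y : actions M x -> actions M y ->
  `|Gfun M dl x - Gfun M dl y| <= lipG * \sum_(i | dl i) `|x 0 i - y 0 i|.
Proof.
move=> bx by_; have k0 := ltn0Sn 0.
have [iL _] := L1_lipS k0.
rewrite -!(Ex_total _ k0)// -ExB; [|exact: L1_total|exact: L1_total].
have iB : L1 (fun w => total_utility M x dl (state M 1 w) -
    total_utility M y dl (state M 1 w)) by apply: L1B; exact: L1_total.
apply: le_trans (normr_Ex iB) _.
rewrite /lipG mulrAC -ExZl//; apply: le_Ex; [exact: L1_norm|exact: L1Zl|].
by move=> w; apply: le_trans (total_lip _ _ bx by_) _; rewrite mulrAC.
Qed.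

Local Notation dG i dl := (partial (actions M) i (Gfun M dl)).

Lemma Gfun_is_grad dl x : actions M x ->
  is_grad (actions M) (Gfun M dl) x (grad (actions M) (Gfun M dl) x).
Proof. by move=> bx; apply: grad_is_grad bx; case: (G_twice hM dl). Qed.

(** [G] does not depend on the actions of the inactive nodes, whence the factor
    [dl i]. *)
Lemma dG_le i dl x : actions M x -> `|dG i dl x| <= lipG * (dl i)%:R.
Proof.
move=> bx.
apply: (grad_coord_le (lo := lo) (hi := hi) (Gfun_is_grad dl bx)) => //.
  exact: lo_lt_hi hM i.
move=> t ht; have bt := set_coord_box (lo := lo) (hi := hi) bx ht.
apply: le_trans (Gfun_lip dl bt bx) _; rewrite -mulrA ler_wpM2l ?lipG_ge0//.
rewrite big_mkcond/= (bigD1 i)//= big1 ?addr0.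
  by rewrite mxE eqxx; case: (dl i); rewrite ?mul1r ?mul0r.
by move=> j ji; rewrite mxE (negbTE ji) subrr normr0 if_same.
Qed.

Definition activity_prob (dl : activity n) : R :=
  fine (\prod_(i < n.+1) bernoulli_prob (qa M) [set dl i])%E.

Lemma Ex_active k dl : (0 < k)%N ->
  Ex (fun w => (active M k w == dl)%:R) = activity_prob dl.
Proof.
move=> k0.
pose B (i : 'I_n.+1) := delta M i k @^-1` [set dl i].
have mB i : measurable (B i).
  by rewrite -[X in measurable X]setTI; exact: measurable_funPT.
have -> : (fun w => (active M k w == dl)%:R : R) = \1_(\big[setI/setT]_(i < n.+1) B i).
  apply/funext => w; rewrite indicE; congr (_%:R : R); congr nat_of_bool.
  apply/eqP/idP => [E|].
    rewrite inE -(bigcap_seq (index_enum _) B) => i /= _.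
    by rewrite /B/= -E ffunE.
  rewrite inE -(bigcap_seq (index_enum _) B) => h; apply/ffunP => i.
  by have := h i (mem_index_enum i); rewrite ffunE.
have -> : Ex \1_(\big[setI/setT]_(i < n.+1) B i) =
    fine (P (\big[setI/setT]_(i < n.+1) B i)).
  rewrite -fine_expectation expectation_indic//.
  by apply: bigsetI_measurable => i _.
congr fine; transitivity (\prod_(i < n.+1) P (B i))%E.
  apply: (sources_indep hM (t := fun i => SrcDelta i k)) => //.
  - by move=> i j [].
  - by move=> i; exists [set dl i] => //; rewrite setTI.
by apply: eq_bigr => i _; exact: (delta_law hM i k0 [set dl i]).
Qed.

(** The activities and the state of a slot are independent. *)
Lemma Ffun_Gfun x : actions M x ->
  Ffun M x = \sum_dl activity_prob dl * Gfun M dl x.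
Proof.
move=> bx; rewrite /Ffun fine_expectation.
have k0 := ltn0Sn 0.
pose D1 : set (source n) := [set y | exists i, y = SrcDelta i 1].
pose D2 : set (source n) := [set SrcState n 1].
have pos y : D1 y \/ D2 y -> (0 < slot y)%N by move=> [[i ->]|->].
have ind : independent2 P <<s \bigcup_(y in D1) source_sigma M y >>
    <<s \bigcup_(y in D2) source_sigma M y >>.
  apply: independent2_group.
  - by move=> y [[i ->]|->]; split; (exact: sigma_rv_setI ||
      exact: sigma_rv_measurable).
  - by move=> y [[i ->] []].
  - move=> s B us sB.
    by apply: (mutually_independent_seq (sources_indep hM)) => // y /sB[/pos].
have m1 : \bigcup_(y in D1) source_sigma M y `<=` measurable.
  by move=> A [y [i ->]]; exact: sigma_rv_measurable.
have m2 : \bigcup_(y in D2) source_sigma M y `<=` measurable.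
  by move=> A [y ->]; exact: sigma_rv_measurable.
have aD dl : adapted (\bigcup_(y in D1) source_sigma M y)
    (fun w => (active M 1 w == dl)%:R : R).
  rewrite (_ : (fun w => _) =
      (fun w => \prod_i (delta M i 1 w == dl i)%:R : R)); last first.
    exact: active_prod.
  apply: measurable_prod => i _.
  apply: (measurableT_comp (f := fun c : bool => (c == dl i)%:R : R)) => //.
  apply: adapted_of_sigma => A HA; apply: sub_sigma_algebra.
  by exists (SrcDelta i 1) => //; exists i.
have aS dl : adapted (\bigcup_(y in D2) source_sigma M y)
    (fun w => total_utility M x dl (state M 1 w)).
  apply: (measurableT_comp (total_utility_measurable dl bx)).
  apply: adapted_of_sigma => A HA; apply: sub_sigma_algebra.
  by exists (SrcState n 1).
have iD dl : L1 (fun w => (active M 1 w == dl)%:R).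
  apply: (@L1_bounded _ _ _ P _ 1) => [|w].
    exact: adapted_measurable (aD dl).
  by case: (_ == _); rewrite ?normr1 ?normr0.
have prod dl := Rintegral_indepM m1 m2 ind (aD dl) (aS dl) (iD dl) (L1_total dl k0 bx).
transitivity (Ex (fun w => \sum_dl (active M 1 w == dl)%:R *
    total_utility M x dl (state M 1 w))).
  apply: eq_Ex => w; rewrite (bigD1 (active M 1 w))//= eqxx mul1r.
  by rewrite big1 ?addr0// => dl; rewrite eq_sym => /negbTE ->; rewrite mul0r.
rewrite Ex_sum => [|dl _]; last by have [] := prod dl.
by apply: eq_bigr => dl _; have [_ ->] := prod dl; rewrite Ex_active// Ex_total.
Qed.

(** Gradients on a box with nonempty interior are unique, so the gradient of a
    combination can be computed term by term. *)
Lemma dF_dG i x : actions M x ->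
  partial (actions M) i (Ffun M) x = \sum_dl activity_prob dl * dG i dl x.
Proof.
move=> bx.
have gF : is_grad (actions M) (Ffun M) x (grad (actions M) (Ffun M) x).
  by apply: grad_is_grad bx; case: (F_twice hM).
have gS := is_grad_sum (A := actions M) activity_prob (fun dl => Gfun_is_grad dl bx).
have gF' : is_grad (actions M) (Ffun M) x
    (\sum_dl activity_prob dl *: grad (actions M) (Gfun M dl) x).
  move=> e e0; have := gS e e0; rewrite !near_withinE.
  by apply: filterS => y + by_ => /(_ by_); rewrite !Ffun_Gfun.
rewrite /partial (is_grad_unique (lo := lo) (hi := hi) (lo_lt_hi hM) bx gF gF').
by rewrite summxE; apply: eq_bigr => dl _; rewrite mxE.
Qed.

Lemma Ex_eta j k : (0 < k)%N ->
  [/\ L1 (Defs.eta M j k), L1 (fun w => Defs.eta M j k w ^+ 2),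
      Ex (Defs.eta M j k) = 0 & Ex (fun w => Defs.eta M j k w ^+ 2) = sigma_eta M ^+ 2].
Proof.
move=> k0; have E2 := eta_var hM j k0; have E1 := eta_mean hM j k0.
rewrite varianceE in E2; last exact: (eta_L2 hM j k0).
have {}E2 : ('E_P[fun w => (Defs.eta M j k w ^+ 2)%R] = (sigma_eta M ^+ 2)%:E)%E.
  by move: E2; rewrite E1 expe2 mule0 sube0.
have i2 : L1 (fun w => Defs.eta M j k w ^+ 2).
  apply: L1_of_expectation => [|w|]; [exact: measurable_funX|exact: sqr_ge0|].
  by rewrite E2 ltry.
split => //; first exact: L1_of_sqr.
  by rewrite -fine_expectation E1.
by rewrite -fine_expectation E2.
Qed.

Lemma Ex_Phi j k : (0 < k)%N ->
  [/\ L1 (Phi M j k), L1 (fun w => Phi M j k w ^+ 2),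
      Ex (Phi M j k) = 0 & Ex (fun w => Phi M j k w ^+ 2) = sigma_Phi M ^+ 2].
Proof.
move=> k0; have E2 := Phi_var hM j k0; have E1 := Phi_mean hM j k0.
have i2 : L1 (fun w => Phi M j k w ^+ 2).
  apply: L1_of_expectation => [|w|]; [exact: measurable_funX|exact: sqr_ge0|].
  by rewrite E2 ltry.
split => //; first exact: L1_of_sqr.
  by rewrite -fine_expectation E1.
by rewrite -fine_expectation E2.
Qed.

End objective.

(** * Averaging the noise and the receptions of one slot *)

Section slot.
Context (R : realType) (d : measure_display) (Omega : measurableType d)
  (P : probability Omega R) (d' : measure_display) (T : measurableType d')
  (n : nat) (M : dosp_model P T n) (hM : dosp_assumptions M)
  (beta0 gamma0 c1 c2 : R) (beta0_gt0 : 0 < beta0) (gamma0_gt0 : 0 < gamma0)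
  (adm : admissible c1 c2).
Local Notation st := (StepSize beta0 gamma0 c1 c2).
Context (a : nat -> Omega -> 'rV[R]_n.+1) (run : dosp_run M st a).
Local Notation Ex f := (Rintegral P setT f).
Local Notation L1 f := (P.-integrable setT (EFin \o (f : Omega -> R))).
Local Notation aPhi := (alpha_Phi M).
Local Notation gam i k w := (gammat M st i k w).
Local Notation bet i k w := (betat M st i k w).
Context (k : nat) (k1 : (1 < k)%N).
Local Notation known := (known M a).
Local Notation iterate := (iterate M beta0 gamma0 c1 c2 a).
Local Notation ph := (fun w => performed M st (a k w) k w).
Local Notation X := (iterate k).
Let k0 : (0 < k)%N. Proof. exact: ltn_trans k1. Qed.

(** Averaging out a single source of slot [k] requires that everything else be
    measurable with respect to the sources below. *)
Definition others (x : source n) : set (option (source n)) :=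
  past k.+1 `\ Some x.

Lemma others_proper x : others x `<=` @proper_source n.
Proof. by move=> y [[]]. Qed.

Lemma proper_slot_k (x : source n) : slot x = k -> [set Some x] `<=` @proper_source n.
Proof. by move=> xk _ ->; apply: proper_slot; rewrite xk. Qed.

Lemma Ex_source x (V W : Omega -> R) : slot x = k ->
  adapted (known (others x)) V -> adapted (known [set Some x]) W ->
  L1 V -> L1 W ->
  L1 (fun w => V w * W w) /\ Ex (fun w => V w * W w) = Ex V * Ex W.
Proof.
move=> xk; apply: (Ex_indepM hM run (@others_proper x) (proper_slot_k xk)).
by move=> y [[_ yx] /= E]; exact: yx.
Qed.

Lemma others_in x y : slot y = k -> y <> x -> others x (Some y).
Proof.
move=> yk yx; split; last by move=> -[].
by split; [apply: proper_slot; rewrite yk|rewrite yk].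
Qed.

Lemma others_delta x i : x <> SrcDelta i k -> adapted (known (others x)) (delta M i k).
Proof.
move=> h; apply: (adapted_some (x := SrcDelta i k)) => //.
by apply: others_in => // E; exact: h.
Qed.

Lemma others_ellt x i : x <> SrcEll i k -> adapted (known (others x)) (ellt M i k).
Proof.
move=> h; apply: (adapted_some (x := SrcEll i k)) => //.
by apply: others_in => // E; exact: h.
Qed.

Lemma others_Phi x i : x <> SrcPhi i k -> adapted (known (others x)) (Phi M i k).
Proof.
move=> h; apply: (adapted_some (x := SrcPhi i k)) => //.
by apply: others_in => // E; exact: h.
Qed.

Lemma others_state x : x <> SrcState n k -> adapted (known (others x)) (state M k).
Proof.
move=> h; apply: (adapted_some (x := SrcState n k)) => //.
by apply: others_in => // E; exact: h.
Qed.

Lemma others_recv x i j : x <> SrcRecv n k -> adapted (known (others x)) (recv M i j k).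
Proof.
by move=> h; apply: adapted_recv; apply: others_in => // E; exact: h.
Qed.

Lemma others_iterate x i : slot x = k ->
  adapted (known (others x)) (fun w => X w 0 i).
Proof.
move=> xk; have A := adapted_iterate hM gamma0_gt0 adm run i k1.
apply: adaptedS A; apply: knownS => y [py yk]; split.
  by split => //; case: y yk {py} => // y yk; rewrite ltnS ltnW.
by move=> E; move: yk; rewrite E xk ltnn.
Qed.

Lemma others_action x i : slot x = k -> x <> SrcDelta i k -> x <> SrcEll i k ->
  adapted (known (others x)) (fun w => a k w 0 i).
Proof.
move=> xk xd xe; apply: (adapted_action hM gamma0_gt0 adm run) => //.
- exact: others_iterate.
- exact: others_delta.
- exact: others_ellt.
Qed.

Lemma others_betat x i : x <> SrcDelta i k -> x <> SrcEll i k ->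
  adapted (known (others x)) (fun w => bet i k w).
Proof.
by move=> xd xe; apply: adapted_betat => //; [exact: others_delta|exact: others_ellt].
Qed.

Lemma others_gammat x i : x <> SrcDelta i k -> x <> SrcEll i k ->
  adapted (known (others x)) (fun w => gam i k w).
Proof.
by move=> xd xe; apply: adapted_gammat => //; [exact: others_delta|exact: others_ellt].
Qed.

Lemma others_performed x i : slot x = k -> x <> SrcDelta i k -> x <> SrcEll i k ->
  x <> SrcPhi i k -> adapted (known (others x)) (fun w => ph w 0 i).
Proof.
move=> xk xd xe xp; apply: adapted_performed => //.
- exact: others_action.
- exact: others_delta.
- exact: others_ellt.
- exact: others_Phi.
Qed.

Definition weighted_dev (i : 'I_n.+1) (w : Omega) : R :=
  (a k w 0 i - astar M 0 i) * bet i k w.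

Lemma others_weighted_dev x i : slot x = k -> x <> SrcDelta i k ->
  x <> SrcEll i k -> adapted (known (others x)) (weighted_dev i).
Proof.
move=> xk xd xe; apply: measurable_funM; last exact: others_betat.
by apply: measurable_funB => //; exact: others_action.
Qed.

Lemma weighted_dev_le i w : `|weighted_dev i w| <= diameter M * beta0.
Proof.
rewrite normrM ler_pM//.
  by apply: actions_coord_le;
    [exact: (action_box hM gamma0_gt0 adm run w k0)|exact: (astar_in hM)].
by rewrite ger0_norm ?betat_ge0// betat_le.
Qed.

Local Notation u := (fun j w => utility M j (ph w) (active M k w) (state M k w)).
Definition probe_bound : R := diameter M * beta0 * aPhi.

Lemma probe_le i w : `|weighted_dev i w * Phi M i k w| <= probe_bound.
Proof. by rewrite normrM ler_pM// ?weighted_dev_le// (Phi_bound hM). Qed.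

Lemma others_probe x i : slot x = k -> x <> SrcDelta i k -> x <> SrcEll i k ->
  x <> SrcPhi i k ->
  adapted (known (others x)) (fun w => weighted_dev i w * Phi M i k w).
Proof.
move=> xk xd xe xp.
exact: (measurable_funM (others_weighted_dev xk xd xe) (others_Phi xp)).
Qed.

Lemma others_utility x j : slot x = k -> (forall i, x <> SrcDelta i k) ->
  (forall i, x <> SrcEll i k) -> (forall i, x <> SrcPhi i k) ->
  x <> SrcState n k -> adapted (known (others x)) (u j).
Proof.
move=> xk xd xe xp xs; apply: (adapted_utility hM) => //.
- by move=> i; exact: others_performed.
- by move=> w; exact: (performed_box hM gamma0_gt0 adm run w k0).
- by move=> i; exact: others_delta.
- exact: others_state.
Qed.

Lemma L1_slot_utility j : L1 (u j).
Proof.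
have := Ex_state hM k0 (envelope_measurable hM j) (L1_envelope hM j) => -[iE _].
apply: (L1_le (Y := fun w => 1 + envelope M j (state M k w))) => [|w|].
- apply: (adapted_measurable (G := known (others (SrcRecv n k)))).
    exact: (known_measurable run).
  exact: others_utility.
- have bw : actions M (ph w) by exact: (performed_box hM gamma0_gt0 adm run w k0).
  have := utility_envelope hM j (active M k w) (state M k w) bw.
  rewrite -real_normK ?num_real//.
  by move: (`|_|) (envelope _ _ _) => v e; nra.
- by apply: L1D => //; exact: L1_cst.
Qed.

Lemma L1_probe i (V : Omega -> R) : L1 V ->
  L1 (fun w => weighted_dev i w * Phi M i k w * V w).
Proof.
apply: L1_boundedMl; last exact: probe_le.
apply: (adapted_measurable (G := known (others (SrcRecv n k)))).
  exact: (known_measurable run).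
exact: others_probe.
Qed.

Lemma L1_boolM (b : Omega -> bool) (V : Omega -> R) :
  measurable_fun setT b -> L1 V -> L1 (fun w => (b w)%:R * V w).
Proof.
move=> mb; apply: (@L1_boundedMl _ _ _ P _ _ 1) => [|w].
  exact: (measurableT_comp (f := fun c : bool => c%:R : R)) mb.
by case: (b w); rewrite ?normr1 ?normr0.
Qed.

Lemma adapted_boolR G (b : Omega -> bool) :
  adapted G b -> adapted G (fun w => (b w)%:R : R).
Proof. exact: (measurableT_comp (f := fun c : bool => c%:R : R)). Qed.

Lemma Ex_recv i j : j != i -> Ex (fun w => (recv M i j k w)%:R) = qr M.
Proof.
move=> ji.
have -> : (fun w => (recv M i j k w)%:R : R) = \1_(recv M i j k @^-1` [set true]).
  apply/funext => w; rewrite indicE; congr (_%:R : R); congr nat_of_bool.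
  by apply/idP/idP; rewrite inE.
rewrite -fine_expectation expectation_indic; last first.
  by rewrite -[X in measurable X]setTI; exact: measurable_funPT.
have := recv_law hM k0 ji [set true]; rewrite /distribution/= /pushforward => ->.
rewrite bernoulli_probE ?(ltW (qr_gt0 hM)) ?(qr_le1 hM)// !diracE.
rewrite (mem_set (erefl : [set true] true)) (memNset (A := [set true]) (u := false))//=.
by rewrite mulr1 mulr0 addr0.
Qed.

(** The cross term in the square of the update. Centred noises average out, and
    receptions compensate the factor [1 / q_r]: in the mean every node sees the
    total utility. *)
Lemma Ex_probe_estimate i :
  L1 (fun w => weighted_dev i w * Phi M i k w * f_estimate M st (a k w) i k w) /\
  Ex (fun w => weighted_dev i w * Phi M i k w * f_estimate M st (a k w) i k w) =
  Ex (fun w => weighted_dev i w * Phi M i k w *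
    total_utility M (ph w) (active M k w) (state M k w)).
Proof.
pose zi w := weighted_dev i w * Phi M i k w.
have iZu j : L1 (fun w => zi w * u j w) by exact/L1_probe/L1_slot_utility.
have iZdu j : L1 (fun w => (delta M j k w)%:R * (zi w * u j w)) by exact: L1_boolM.
have mz : measurable_fun setT zi.
  apply: (adapted_measurable (G := known (others (SrcRecv n k)))).
    exact: (known_measurable run).
  exact: others_probe.
have iz : L1 zi by apply: L1_bounded mz _ => w; exact: probe_le.
have srcE j : adapted (known [set Some (SrcEta j k)]) (Defs.eta M j k).
  exact: (adapted_some (x := SrcEta j k)).
have noise j (b : Omega -> R) : adapted (known (others (SrcEta j k))) b ->
    L1 b -> L1 (fun w => b w * Defs.eta M j k w) /\
    Ex (fun w => b w * Defs.eta M j k w) = 0.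
  move=> ab ib; have [ie _ e0 _] := Ex_eta hM j k0.
  by have [i1 ->] := Ex_source (x := SrcEta j k) erefl ab (srcE j) ib ie; rewrite e0 mulr0.
have az j : adapted (known (others (SrcEta j k))) zi by exact: others_probe.
have azdr j : adapted (known (others (SrcEta j k)))
    (fun w => (recv M i j k w)%:R * ((delta M j k w)%:R * zi w)).
  apply: measurable_funM; first by apply: adapted_boolR; apply: others_recv.
  by apply: measurable_funM; [by apply: adapted_boolR; apply: others_delta|exact: az].
have izdr j : L1 (fun w => (recv M i j k w)%:R * ((delta M j k w)%:R * zi w)).
  by do 2 apply: L1_boolM => //.
have [iZe EZe] := noise i zi (az i) iz.
have cross j : j != i ->
    L1 (fun w => (delta M j k w)%:R * (zi w * u j w) * (recv M i j k w)%:R) /\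
    Ex (fun w => (delta M j k w)%:R * (zi w * u j w) * (recv M i j k w)%:R) =
    Ex (fun w => (delta M j k w)%:R * (zi w * u j w)) * qr M.
  move=> ji; rewrite -(Ex_recv ji).
  apply: (Ex_source (x := SrcRecv n k)) => //.
  - apply: measurable_funM; first by apply: adapted_boolR; apply: others_delta.
    by apply: measurable_funM; [exact: others_probe|exact: others_utility].
  - by apply: adapted_boolR; apply: adapted_recv.
  - apply: (@L1_bounded _ _ _ P _ 1) => [|w].
      exact: (measurableT_comp (f := fun c : bool => c%:R : R)).
    by case: (recv M i j k w); rewrite ?normr1 ?normr0.
pose term j w := (delta M j k w)%:R * (zi w * u j w) * (recv M i j k w)%:R +
  (recv M i j k w)%:R * ((delta M j k w)%:R * zi w) * Defs.eta M j k w.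
have iterm j : j != i -> L1 (term j).
  by move=> ji; apply: L1D; [exact: (cross j ji).1|exact: (noise j _ (azdr j) (izdr j)).1].
have Eterm j : j != i -> Ex (term j) =
    Ex (fun w => (delta M j k w)%:R * (zi w * u j w)) * qr M.
  move=> ji; rewrite ExD; [|exact: (cross j ji).1|exact: (noise j _ (azdr j) (izdr j)).1].
  by rewrite (cross j ji).2 (noise j _ (azdr j) (izdr j)).2 addr0.
have split_est w : zi w * f_estimate M st (a k w) i k w =
    (zi w * u i w + zi w * Defs.eta M i k w) +
      (qr M)^-1 * \sum_(j | j != i) term j w.
  rewrite f_estimateE /observed_utility mulrDr mulrDr; congr (_ + _).
  rewrite mulrCA mulr_sumr; congr (_ * _); apply: eq_bigr => j _.
  by rewrite /term; ring.
have isum : L1 (fun w => \sum_(j | j != i) term j w) by exact: L1_sum.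
have ieq : (fun w => zi w * f_estimate M st (a k w) i k w) =
    (fun w => (zi w * u i w + zi w * Defs.eta M i k w) +
      (qr M)^-1 * \sum_(j | j != i) term j w) by exact/funext.
rewrite -/(zi _) ieq; split; first by apply: L1D; [exact: L1D|exact: L1Zl].
rewrite ExD; [|exact: L1D|exact: L1Zl].
rewrite ExD// EZe addr0 ExZl// Ex_sum//.
have -> : Ex (fun w => zi w * u i w) = Ex (fun w => (delta M i k w)%:R * (zi w * u i w)).
  apply: eq_Ex => w; rewrite /zi /weighted_dev /betat.
  by case: (delta M i k w); rewrite ?mul1r ?mul0r ?mulr0 ?mul0r.
have -> : \sum_(j | j != i) Ex (term j) = \sum_(j | j != i)
    Ex (fun w => (delta M j k w)%:R * (zi w * u j w)) * qr M by exact: eq_bigr.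
rewrite -mulr_suml mulrCA mulVf ?gt_eqF ?(qr_gt0 hM)// mulr1.
have -> : Ex (fun w => zi w *
      total_utility M (ph w) (active M k w) (state M k w)) =
    Ex (fun w => \sum_j (delta M j k w)%:R * (zi w * u j w)).
  apply: eq_Ex => w.
  rewrite /total_utility mulr_sumr [LHS]big_mkcond/=; apply: eq_bigr => j _.
  by rewrite ffunE; case: (delta M j k w); rewrite ?mul1r ?mul0r.
by rewrite Ex_sum// [RHS](bigD1 i)//=.
Qed.

End slot.

(** * Mean drift along the gradient *)

Section drift.
Context (R : realType) (d : measure_display) (Omega : measurableType d)
  (P : probability Omega R) (d' : measure_display) (T : measurableType d')
  (n : nat) (M : dosp_model P T n) (hM : dosp_assumptions M)
  (beta0 gamma0 c1 c2 : R) (beta0_gt0 : 0 < beta0) (gamma0_gt0 : 0 < gamma0)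
  (adm : admissible c1 c2).
Local Notation st := (StepSize beta0 gamma0 c1 c2).
Context (a : nat -> Omega -> 'rV[R]_n.+1) (run : dosp_run M st a).
Local Notation Ex f := (Rintegral P setT f).
Local Notation L1 f := (P.-integrable setT (EFin \o (f : Omega -> R))).
Local Notation aPhi := (alpha_Phi M).
Local Notation lo := (amin M).
Local Notation hi := (amax M).
Local Notation gam i k w := (gammat M st i k w).
Local Notation bet i k w := (betat M st i k w).
Context (k : nat) (k1 : (1 < k)%N).
Local Notation known := (known M a).
Local Notation iterate := (iterate M beta0 gamma0 c1 c2 a).
Local Notation ph := (fun w => performed M st (a k w) k w).
Local Notation X := (iterate k).
Let k0 : (0 < k)%N. Proof. exact: ltn_trans k1. Qed.
Context (r : R) (r_gt0 : 0 < r)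
  (margin : forall i, lo 0 i + r <= astar M 0 i <= hi 0 i - r).
Local Notation others := (others k).
Local Notation wd := (weighted_dev M beta0 gamma0 c1 c2 a k).
Local Notation dG i dl := (partial (actions M) i (Gfun M dl)).
Local Notation dF i := (partial (actions M) i (Ffun M)).
Local Notation Theta := (mean_product M beta0 gamma0 c1 c2 k).
Local Notation Y := (fun i w => X w 0 i - astar M 0 i).

Let ph_box w : actions M (ph w).
Proof. exact: (performed_box hM gamma0_gt0 adm run w k0). Qed.

Let X_box w : actions M (X w).
Proof. exact: (iterate_box hM). Qed.

Let a_box w : actions M (a k w).
Proof. exact: (action_box hM gamma0_gt0 adm run w k0). Qed.

Let gam0 i w : 0 <= gam i k w. Proof. exact: gammat_ge0. Qed.
Let bet0 i w : 0 <= bet i k w. Proof. exact: betat_ge0. Qed.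
Let aPhi0 : 0 <= aPhi. Proof. exact: aPhi_ge0 hM. Qed.
Let Phi_le i w : `|Phi M i k w| <= aPhi. Proof. exact: (Phi_bound hM). Qed.

Lemma adapted_activity_fun D (h : activity n -> 'rV[R]_n.+1 -> R)
    (q : Omega -> 'rV[R]_n.+1) :
  (forall dl, differentiable_on (actions M) (h dl)) ->
  (forall i, adapted (known D) (fun w => q w 0 i)) -> (forall w, actions M (q w)) ->
  (forall i, adapted (known D) (delta M i k)) ->
  adapted (known D) (fun w => h (active M k w) (q w)).
Proof.
move=> dh aq bq aD.
rewrite (_ : (fun w => _) = (fun w => \sum_(dl : activity n)
    (active M k w == dl)%:R * h dl (q w))); last first.
  apply/funext => w; rewrite (bigD1 (active M k w))//= eqxx mul1r.
  rewrite big1 ?addr0// => dl; rewrite eq_sym => /negbTE ->.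
  by rewrite mul0r.
apply: measurable_sum => dl; apply: measurable_funM; first exact: adapted_active.
apply: (caratheodory_measurable (lo := lo) (hi := hi)
  (S := g_sigma_algebraType (known D)) (g := fun x _ => h dl x)) => //.
- by move=> i; exact: lo_le_hi hM i.
- move=> w x bx; have [g gP] := dh dl x bx.
  exact: (is_grad_continuous gP).
Qed.

Definition Gbound : R :=
  \sum_(dl : activity n) `|Gfun M dl (astar M)| + lipG M * diameter M.

Lemma Gfun_le dl x : actions M x -> `|Gfun M dl x| <= Gbound.
Proof.
move=> bx; rewrite -[Gfun M dl x](subrK (Gfun M dl (astar M))).
rewrite (le_trans (ler_normD _ _))// addrC lerD//.
  by rewrite (bigD1 dl)//= lerDl sumr_ge0.
apply: le_trans (Gfun_lip hM dl bx (astar_in hM)) _.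
rewrite ler_wpM2l ?lipG_ge0//.
apply: le_trans (actions_sum_le bx (astar_in hM)).
by rewrite [leRHS](bigID (fun i => dl i))/= lerDl sumr_ge0.
Qed.

Lemma measurable_known D (V : Omega -> R) : adapted (known D) V -> measurable_fun setT V.
Proof. exact: (adapted_measurable (known_measurable run (D := D))). Qed.

(** The state of the slot is independent of the performed action and of the
    activities, which can be frozen while the utilities are averaged into [G]. *)
Lemma Ex_probe_total i :
  Ex (fun w => wd i w * Phi M i k w *
    total_utility M (ph w) (active M k w) (state M k w)) =
  Ex (fun w => wd i w * Phi M i k w * Gfun M (active M k w) (ph w)).
Proof.
have freeze dl :
    L1 (fun w => (active M k w == dl)%:R * (wd i w * Phi M i k w) *
      total_utility M (ph w) dl (state M k w)) /\
    Ex (fun w => (active M k w == dl)%:R * (wd i w * Phi M i k w) *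
      total_utility M (ph w) dl (state M k w)) =
    Ex (fun w => (active M k w == dl)%:R * (wd i w * Phi M i k w) *
      Gfun M dl (ph w)).
  have [] : L1 (fun w => (active M k w == dl)%:R * (wd i w * Phi M i k w) *
      total_utility M (ph w) dl (state M k w)) /\
    Ex (fun w => (active M k w == dl)%:R * (wd i w * Phi M i k w) *
      total_utility M (ph w) dl (state M k w)) =
    Ex (fun w => (active M k w == dl)%:R * (wd i w * Phi M i k w) *
      Ex (fun w' => total_utility M (ph w) dl (state M k w'))); last first.
    move=> i1 E; split => //; rewrite E.
    by apply: eq_Ex => w; rewrite Ex_total.
  apply: (Ex_freeze (lo := lo) (hi := hi) (G1 := known (others (SrcState n k)))
    (G2 := known [set Some (SrcState n k)])
    (g := fun x w => total_utility M x dl (state M k w))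
    (L := fun w => n.+1%:R * `|lipS M (state M k w)|)
    (Z := fun w => (active M k w == dl)%:R * (wd i w * Phi M i k w))
    (X := ph) (B := probe_bound M beta0)).
  - exact: (known_measurable run).
  - exact: (known_measurable run).
  - apply: (known_indep hM run).
    + exact: others_proper.
    + exact: (proper_slot_k k1).
    + by move=> y [[_ yx] /= E]; exact: yx.
  - exact: lo_le_hi hM.
  - move=> x bx; apply: (measurableT_comp (total_utility_measurable hM dl bx)).
    exact: (adapted_some (x := SrcState n k)).
  - by move=> x bx; exact: L1_total.
  - by move=> w; rewrite mulr_ge0.
  - by apply: L1Zl; have [] := L1_lipS hM k0.
  - by move=> w x y bx by_; exact: total_lipT.
  - by move=> j; exact: (others_performed hM gamma0_gt0 adm run).
  - exact: ph_box.
  - apply: measurable_funM; first by apply: adapted_active => j; exact: others_delta.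
    exact: (others_probe hM gamma0_gt0 adm run k1).
  - move=> w; rewrite normrM; apply: (@le_trans _ _ (1 * probe_bound M beta0));
      last by rewrite mul1r.
    apply: ler_pM => //; first by case: (_ == _); rewrite ?normr1 ?normr0.
    exact: (probe_le hM beta0_gt0 gamma0_gt0 adm run k1).
pose W dl w := (active M k w == dl)%:R : R.
have split_act (h : activity n -> Omega -> R) w :
    wd i w * Phi M i k w * h (active M k w) w =
    \sum_dl W dl w * (wd i w * Phi M i k w) * h dl w.
  rewrite (bigD1 (active M k w))//= {1}/W eqxx mul1r big1 ?addr0// => dl.
  by rewrite eq_sym /W => /negbTE ->; rewrite !mul0r.
transitivity (Ex (fun w => \sum_dl W dl w * (wd i w * Phi M i k w) *
    total_utility M (ph w) dl (state M k w))).
  apply: eq_Ex => w.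
  exact: (split_act (fun dl w => total_utility M (ph w) dl (state M k w))).
transitivity (Ex (fun w => \sum_dl W dl w * (wd i w * Phi M i k w) *
    Gfun M dl (ph w))); last first.
  by apply: eq_Ex => w; rewrite -(split_act (fun dl w => Gfun M dl (ph w))).
rewrite !Ex_sum => [|dl _|dl _]; last by have [] := freeze dl.
  by apply: eq_bigr => dl _; have [] := freeze dl.
apply: (@L1_bounded _ _ _ P _ (probe_bound M beta0 * Gbound)) => [|w].
  apply: (measurable_known (D := others (SrcState n k))).
  apply: measurable_funM.
    apply: measurable_funM; first by apply: adapted_active => j; exact: others_delta.
    exact: (others_probe hM gamma0_gt0 adm run k1).
  apply: (adapted_activity_fun (h := fun _ => Gfun M dl)) => //.
  - by move=> _; exact: (G_twice hM dl).1.
  - by move=> j; exact: (others_performed hM gamma0_gt0 adm run).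
  - by move=> j; exact: others_delta.
rewrite normrM ler_pM// ?Gfun_le// normrM.
apply: (@le_trans _ _ (1 * probe_bound M beta0)); last by rewrite mul1r.
apply: ler_pM => //; first by rewrite /W; case: (_ == _); rewrite ?normr1 ?normr0.
exact: (probe_le hM beta0_gt0 gamma0_gt0 adm run k1).
Qed.

(** Being independent of [Phi i k], this point can be used as the origin of the
    expansion of [G]: the value of [G] there contributes nothing in the mean. *)
Definition unperturbed (i : 'I_n.+1) (w : Omega) : 'rV[R]_n.+1 :=
  set_coord (ph w) i (a k w 0 i).

Let un_box i w : actions M (unperturbed i w).
Proof. exact: (set_coord_box (lo := lo) (hi := hi) (ph_box w) (a_box w i)). Qed.

Lemma others_unperturbed i j :
  adapted (known (others (SrcPhi i k))) (fun w => unperturbed i w 0 j).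
Proof.
under eq_fun do rewrite mxE; have [ji|ji] := eqVneq j i.
  exact: (others_action hM gamma0_gt0 adm run).
apply: (others_performed hM gamma0_gt0 adm run) => // -[E].
by rewrite E eqxx in ji.
Qed.

Lemma L1_activity_fun x (h : activity n -> 'rV[R]_n.+1 -> R)
    (q : Omega -> 'rV[R]_n.+1) (V : Omega -> R) (c e : R) :
  (forall i, x <> SrcDelta i k) ->
  (forall dl, differentiable_on (actions M) (h dl)) ->
  (forall i, adapted (known (others x)) (fun w => q w 0 i)) ->
  (forall w, actions M (q w)) -> adapted (known (others x)) V ->
  (forall w, `|V w| <= c) -> (forall dl y, actions M y -> `|h dl y| <= e) ->
  adapted (known (others x)) (fun w => V w * h (active M k w) (q w)) /\
  L1 (fun w => V w * h (active M k w) (q w)).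
Proof.
move=> xd dh aq bq aV Vc he.
have ah : adapted (known (others x)) (fun w => V w * h (active M k w) (q w)).
  apply: measurable_funM => //; apply: adapted_activity_fun => // i.
  exact: others_delta.
split => //; apply: (@L1_bounded _ _ _ P _ (c * e)).
  exact: (measurable_known ah).
by move=> w; rewrite normrM ler_pM// he.
Qed.

Let Gdiff dl : differentiable_on (actions M) (Gfun M dl).
Proof. exact: (G_twice hM dl).1. Qed.

Let dGdiff i dl : differentiable_on (actions M) (dG i dl).
Proof. exact: (G_twice hM dl).2. Qed.

Let dGle i dl x : actions M x -> `|dG i dl x| <= lipG M.
Proof.
move=> bx; apply: le_trans (dG_le hM i dl bx) _.
by rewrite ler_piMr ?lipG_ge0// lern1 leq_b1.
Qed.

Lemma Ex_unperturbed i :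
  L1 (fun w => wd i w * Phi M i k w * Gfun M (active M k w) (unperturbed i w)) /\
  Ex (fun w => wd i w * Phi M i k w * Gfun M (active M k w) (unperturbed i w)) = 0.
Proof.
have [_ _ E0 _] := Ex_Phi hM i k0; have [iPhi _ _ _] := Ex_Phi hM i k0.
have [aV iV] : adapted (known (others (SrcPhi i k)))
    (fun w => wd i w * Gfun M (active M k w) (unperturbed i w)) /\
    L1 (fun w => wd i w * Gfun M (active M k w) (unperturbed i w)).
  apply: (L1_activity_fun (h := Gfun M) (c := diameter M * beta0) (e := Gbound)) => //.
  - exact: others_unperturbed.
  - exact: (others_weighted_dev hM gamma0_gt0 adm run).
  - exact: (weighted_dev_le hM beta0_gt0 gamma0_gt0 adm run k1).
  - by move=> *; exact: Gfun_le.
have aPh : adapted (known [set Some (SrcPhi i k)]) (Phi M i k).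
  exact: (adapted_some (x := SrcPhi i k)).
have [i1 E] := Ex_source hM run k1 (x := SrcPhi i k) erefl aV aPh iV iPhi.
have eqf : (fun w => wd i w * Phi M i k w * Gfun M (active M k w) (unperturbed i w)) =
    (fun w => wd i w * Gfun M (active M k w) (unperturbed i w) * Phi M i k w).
  by apply/funext => w; rewrite mulrAC.
by rewrite eqf; split => //; rewrite E E0 mulr0.
Qed.

Definition gain (i : 'I_n.+1) (w : Omega) : R := dG i (active M k w) (X w).

Lemma gain_le i w : `|gain i w| <= lipG M.
Proof. exact: dGle. Qed.

(** [Phi i k] is independent of the step-sizes, of the activities and of the
    iterate. *)
Lemma Ex_Phi_sqr i :
  [/\ L1 (fun w => wd i w * gam i k w * gain i w),
  L1 (fun w => wd i w * gam i k w * gain i w * Phi M i k w ^+ 2) &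
  Ex (fun w => wd i w * gam i k w * gain i w * Phi M i k w ^+ 2) =
  sigma_Phi M ^+ 2 * Ex (fun w => wd i w * gam i k w * gain i w)].
Proof.
have [_ i2 _ E2] := Ex_Phi hM i k0.
have awg : adapted (known (others (SrcPhi i k))) (fun w => wd i w * gam i k w).
  apply: measurable_funM; first exact: (others_weighted_dev hM gamma0_gt0 adm run).
  exact: (others_gammat _ _ adm).
have [aV iV] : adapted (known (others (SrcPhi i k)))
    (fun w => wd i w * gam i k w * gain i w) /\
    L1 (fun w => wd i w * gam i k w * gain i w).
  apply: (L1_activity_fun (h := fun dl => dG i dl)
    (c := diameter M * beta0 * gamma0) (e := lipG M)) => //.
  - by move=> j; exact: (others_iterate hM gamma0_gt0 adm run).
  - move=> w; rewrite normrM ler_pM//.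
      exact: (weighted_dev_le hM beta0_gt0 gamma0_gt0 adm run k1).
    by rewrite ger0_norm// gammat_le.
  - by move=> *; exact: dGle.
have aPh : adapted (known [set Some (SrcPhi i k)]) (fun w => Phi M i k w ^+ 2).
  apply: measurable_funX.
  exact: (adapted_some (x := SrcPhi i k)).
have [i1 ->] := Ex_source hM run k1 (x := SrcPhi i k) erefl aV aPh iV i2.
by rewrite E2 mulrC.
Qed.

Definition gammat_sum (w : Omega) : R := \sum_j gam j k w.

Lemma gammat_sum_ge0 w : 0 <= gammat_sum w. Proof. exact: sumr_ge0. Qed.

Lemma gammat_le_sum i w : gam i k w <= gammat_sum w.
Proof. by rewrite /gammat_sum (bigD1 i)//= lerDl sumr_ge0. Qed.

(** The common size of the errors made when the estimate is replaced with the
    gradient at the iterate. *)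
Definition residual (i : 'I_n.+1) (w : Omega) : R :=
  bet i k w * gam i k w * gammat_sum w * (`|Y i w| + aPhi * gammat_sum w).

Lemma residual_ge0 i w : 0 <= residual i w.
Proof.
rewrite /residual; apply: mulr_ge0.
  by apply: mulr_ge0; [exact: mulr_ge0|exact: gammat_sum_ge0].
by apply: addr_ge0 => //; apply: mulr_ge0; [|exact: gammat_sum_ge0].
Qed.

Lemma recentring_le i w : `|a k w 0 i - X w 0 i| <= aPhi * gam i k w.
Proof.
rewrite (action_iterate hM gamma0_gt0 adm run i w k1).
by apply: project_shift_le; [exact: mulr_ge0|
  exact: (shrunk_interval hM gamma0_gt0 adm run)|exact: X_box].
Qed.

Lemma recentring_le_dev i w :
  `|a k w 0 i - X w 0 i| <= aPhi * gam i k w * (`|Y i w| + aPhi * gam i k w) / r.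
Proof.
rewrite (action_iterate hM gamma0_gt0 adm run i w k1).
by apply: project_shift; [exact: mulr_ge0|exact: r_gt0|
  exact: (shrunk_interval hM gamma0_gt0 adm run)|exact: margin|exact: X_box].
Qed.

Lemma weighted_dev_residual i w :
  `|wd i w| <= bet i k w * (`|Y i w| + aPhi * gammat_sum w).
Proof.
rewrite normrM (ger0_norm (bet0 i w)) mulrC ler_wpM2l//.
have -> : a k w 0 i - astar M 0 i = (a k w 0 i - X w 0 i) + Y i w by rewrite /=; ring.
rewrite (le_trans (ler_normD _ _))// addrC lerD2l (le_trans (recentring_le i w))//.
by rewrite ler_wpM2l// gammat_le_sum.
Qed.

(** The gradient is taken at the iterate, the only point that is independent of
    the slot. All the points involved are within [2 * aPhi * gam j k w] of it in
    coordinate [j], and coincide with it in the coordinates of inactive nodes. *)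
Lemma expansion_error i w :
  `|wd i w * Phi M i k w * Gfun M (active M k w) (ph w) -
    wd i w * Phi M i k w * Gfun M (active M k w) (unperturbed i w) -
    wd i w * gam i k w * gain i w * Phi M i k w ^+ 2| <=
  2 * aPhi ^+ 3 * alpha_G M * residual i w.
Proof.
have res0 := residual_ge0 i w.
have -> : wd i w * Phi M i k w * Gfun M (active M k w) (ph w) -
    wd i w * Phi M i k w * Gfun M (active M k w) (unperturbed i w) -
    wd i w * gam i k w * gain i w * Phi M i k w ^+ 2 =
  wd i w * Phi M i k w * (Gfun M (active M k w) (ph w) -
    Gfun M (active M k w) (unperturbed i w) -
    gain i w * (gam i k w * Phi M i k w)) by ring.
have [di|ndi] := boolP (delta M i k w); last first.
  rewrite {1}/weighted_dev /betat (negbTE ndi) !mul0r mulr0 !mul0r normr0.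
  apply: mulr_ge0 => //; apply: mulr_ge0; last exact/ltW/(alpha_G_gt0 hM).
  by rewrite mulr_ge0// exprn_ge0.
have phi_near j : `|ph w 0 j - X w 0 j| <= 2 * aPhi * gam j k w.
  have -> : ph w 0 j - X w 0 j =
    (a k w 0 j - X w 0 j) + gam j k w * Phi M j k w by rewrite mxE; ring.
  rewrite (le_trans (ler_normD _ _))//.
  have := recentring_le j w; have := perturbation_le hM beta0 gamma0_gt0 adm j w k0.
  by move: (`|_|) (`|_|) => u v; lra.
have exp := coord_expansion (lo := lo) (hi := hi) (f := Gfun M (active M k w))
  (p := fun j => active M k w j) (C := alpha_G M) (i := i)
  (x := unperturbed i w) (b := X w) (t := ph w 0 i)
  (r := fun j => 2 * aPhi * gam j k w).
have un_ph : set_coord (unperturbed i w) i (ph w 0 i) = ph w.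
  by rewrite set_coordC; apply/rowP => j; rewrite mxE; case: eqP => [->|].
have un_i : ph w 0 i - unperturbed i w 0 i = gam i k w * Phi M i k w.
  by rewrite /unperturbed !mxE eqxx; ring.
rewrite un_ph un_i in exp.
have {}exp : `|Gfun M (active M k w) (ph w) - Gfun M (active M k w) (unperturbed i w) -
    gain i w * (gam i k w * Phi M i k w)| <=
    alpha_G M * (\sum_j 2 * aPhi * gam j k w) * `|gam i k w * Phi M i k w|.
  apply: exp => //.
  - exact/ltW/(alpha_G_gt0 hM).
  - by move=> y j by_ aj; apply: (G_hess hM) => //; rewrite ffunE.
  - exact: un_box.
  - exact: X_box.
  - exact: (ph_box w i).
  - by rewrite ffunE.
  - move=> j; rewrite ffunE => ndj.
    have g0 : gam j k w = 0 by rewrite /gammat (negbTE ndj) mul0r.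
    have h1 := phi_near j; have h2 := recentring_le j w.
    rewrite g0 mulr0 in h1; rewrite g0 mulr0 in h2.
    rewrite /unperturbed mxE; have [ji|_] := eqVneq j i; last first.
      by apply/eqP; rewrite -subr_eq0 -normr_le0.
    by rewrite -ji; apply/eqP; rewrite -subr_eq0 -normr_le0.
  - move=> j; rewrite /unperturbed mxE; case: eqP => [->|_]; last exact: phi_near.
    apply: le_trans (recentring_le i w) _; rewrite -mulrA ler_peMl// ?ler1n//.
    exact: mulr_ge0.
have hz : `|wd i w * Phi M i k w| <= bet i k w * (`|Y i w| + aPhi * gammat_sum w) * aPhi.
  by rewrite normrM ler_pM// weighted_dev_residual.
rewrite normrM; apply: le_trans (ler_pM _ _ hz exp) _ => //.
rewrite -mulr_sumr -/(gammat_sum w).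
have hp : `|gam i k w * Phi M i k w| <= aPhi * gam i k w.
  exact: (perturbation_le hM beta0 gamma0_gt0 adm i w k0).
apply: (@le_trans _ _ (bet i k w * (`|Y i w| + aPhi * gammat_sum w) * aPhi *
   (alpha_G M * (2 * aPhi * gammat_sum w) * (aPhi * gam i k w)))).
  have gs0 := gammat_sum_ge0 w.
  have s0 : 0 <= `|Y i w| + aPhi * gammat_sum w by apply: addr_ge0 => //; exact: mulr_ge0.
  apply: ler_wpM2l; first by apply: mulr_ge0 => //; exact: mulr_ge0.
  apply: ler_wpM2l => //; apply: mulr_ge0; first exact/ltW/(alpha_G_gt0 hM).
  by apply: mulr_ge0 => //; exact: mulr_ge0.
rewrite /residual le_eqVlt; apply/orP; left; apply/eqP; ring.
Qed.

(** The crude bound [recentring_le] would leave an error of order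
    [rate ^ (c1 + 2 * c2)], which is too large for the exponent [2 * c2]; the
    additional factor in [recentring_le_dev] brings it down to the residual. *)
Lemma recentring_error i w :
  `|wd i w * gam i k w * gain i w - Y i w * (bet i k w * gam i k w) * gain i w| <=
  lipG M * aPhi / r * residual i w.
Proof.
have -> : wd i w * gam i k w * gain i w - Y i w * (bet i k w * gam i k w) * gain i w =
    (a k w 0 i - X w 0 i) * (bet i k w * gam i k w * gain i w).
  by rewrite /weighted_dev; ring.
rewrite normrM.
apply: (@le_trans _ _ (aPhi * gam i k w * (`|Y i w| + aPhi * gam i k w) / r *
    (bet i k w * gam i k w * lipG M))).
  apply: ler_pM (recentring_le_dev i w) _ => //.
  by rewrite normrM ler_pM ?gain_le// ger0_norm// mulr_ge0.
have gs := gammat_le_sum i w.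
have -> : aPhi * gam i k w * (`|Y i w| + aPhi * gam i k w) / r *
    (bet i k w * gam i k w * lipG M) = lipG M * aPhi / r *
    (bet i k w * gam i k w * gam i k w * (`|Y i w| + aPhi * gam i k w)) by ring.
apply: ler_wpM2l.
  by apply: divr_ge0; [apply: mulr_ge0 => //; exact: lipG_ge0|exact: ltW].
have bg0 : 0 <= bet i k w * gam i k w by exact: mulr_ge0.
rewrite /residual; apply: ler_pM.
- exact: mulr_ge0.
- by apply: addr_ge0 => //; exact: mulr_ge0.
- exact: ler_wpM2l.
- by rewrite lerD2l ler_wpM2l.
Qed.

(** The step-sizes and the activities of the slot are independent of the
    iterate, so that the gradients of [G] average to that of [F]. *)
Lemma Ex_gain i :
  [/\ L1 (fun w => Y i w * (bet i k w * gam i k w) * gain i w),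
  L1 (fun w => Y i w * dF i (X w)) &
  Ex (fun w => Y i w * (bet i k w * gam i k w) * gain i w) =
  Theta * Ex (fun w => Y i w * dF i (X w))].
Proof.
have Yle w : `|Y i w| <= diameter M.
  exact: (actions_coord_le i (X_box w) (astar_in hM)).
have aYx x : slot x = k -> adapted (known (others x)) (Y i).
  move=> xk; apply: measurable_funB => //.
  exact: (others_iterate hM gamma0_gt0 adm run).
have [aV iV] : adapted (known (others (SrcEll i k))) (fun w => Y i w * gain i w) /\
    L1 (fun w => Y i w * gain i w).
  apply: (L1_activity_fun (h := fun dl => dG i dl)
    (c := diameter M) (e := lipG M)) => //.
  - by move=> j; exact: (others_iterate hM gamma0_gt0 adm run).
  - exact: aYx.
  - by move=> *; exact: dGle.
have [iS ES] := Ex_step_product hM c1 c2 beta0_gt0 gamma0_gt0 i k0.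
have aS : adapted (known [set Some (SrcEll i k)])
    (fun w => step_product beta0 gamma0 c1 c2 (ellt M i k w)).
  apply: (measurableT_comp (f := step_product beta0 gamma0 c1 c2)) => //.
  exact: (adapted_some (x := SrcEll i k)).
have [iVS EVS] := Ex_source hM run k1 (x := SrcEll i k) erefl aV aS iV iS.
have eqf : (fun w => Y i w * (bet i k w * gam i k w) * gain i w) =
    (fun w => Y i w * gain i w * step_product beta0 gamma0 c1 c2 (ellt M i k w)).
  apply/funext => w; rewrite betat_gammat.
  have [di|ndi] := boolP (delta M i k w); first by rewrite mul1r; ring.
  have -> : gain i w = 0.
    apply/eqP; rewrite -normr_le0.
    have := dG_le hM i (active M k w) (X_box w).
    by rewrite ffunE (negbTE ndi) mulr0.
  by rewrite !mulr0 mul0r.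
pose D1 : set (option (source n)) := [set y | exists j, y = Some (SrcDelta j k)].
have D1p : D1 `<=` @proper_source n.
  by move=> _ [j ->]; apply: proper_slot.
have D1past : @past n k `&` D1 `<=` set0.
  by move=> y [[_ yk] [j E]]; move: yk; rewrite E /= ltnn.
have aD dl : adapted (known D1) (fun w => (active M k w == dl)%:R : R).
  apply: adapted_active => j; apply: (adapted_some (x := SrcDelta j k)) => //.
  by exists j.
have iD dl : L1 (fun w => (active M k w == dl)%:R).
  apply: (@L1_bounded _ _ _ P _ 1) => [|w]; first exact: (measurable_known (aD dl)).
  by case: (_ == _); rewrite ?normr1 ?normr0.
have aX j := adapted_iterate hM gamma0_gt0 adm run j k1.
have aYdG dl : adapted (known (@past n k)) (fun w => Y i w * dG i dl (X w)).
  apply: measurable_funM; first by apply: measurable_funB => //; exact: aX.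
  apply: (caratheodory_measurable (lo := lo) (hi := hi)
    (S := g_sigma_algebraType (known (@past n k))) (g := fun x _ => dG i dl x)) => //.
  - by move=> j; exact: lo_le_hi hM j.
  - move=> w x bx; have [g gP] := dGdiff i dl bx.
    exact: (is_grad_continuous gP).
have iYdG dl : L1 (fun w => Y i w * dG i dl (X w)).
  apply: (@L1_bounded _ _ _ P _ (diameter M * lipG M)).
    exact: (measurable_known (aYdG dl)).
  by move=> w; rewrite normrM ler_pM// dGle.
have prod dl := Ex_indepM hM run (@past_proper n k) D1p D1past
  (aYdG dl) (aD dl) (iYdG dl) (iD dl).
have eqdF : (fun w => Y i w * dF i (X w)) =
    (fun w => \sum_dl activity_prob M dl * (Y i w * dG i dl (X w))).
  apply/funext => w; rewrite dF_dG// mulr_sumr.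
  by apply: eq_bigr => dl _; rewrite mulrCA.
split; first by rewrite eqf; exact: iVS.
  by rewrite eqdF; apply: L1_sum => dl _; exact: L1Zl.
rewrite eqf EVS ES; suff -> : Ex (fun w => Y i w * gain i w) =
  Ex (fun w => Y i w * dF i (X w)) by exact: mulrC.
transitivity (Ex (fun w => \sum_dl Y i w * dG i dl (X w) * (active M k w == dl)%:R)).
  apply: eq_Ex => w; rewrite (bigD1 (active M k w))//= eqxx mulr1.
  by rewrite big1 ?addr0// => dl; rewrite eq_sym => /negbTE ->; rewrite mulr0.
rewrite Ex_sum => [|dl _]; last by have [] := prod dl.
rewrite eqdF Ex_sum => [|dl _]; last exact: L1Zl.
apply: eq_bigr => dl _; rewrite ExZl//; have [_ ->] := prod dl.
by rewrite Ex_active// mulrC.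
Qed.

Lemma L1_residual i : L1 (residual i).
Proof.
have mg j : measurable_fun setT (fun w => gam j k w).
  apply: (measurable_known (D := others (SrcRecv n k))).
  exact: (others_gammat _ _ adm).
have mgs : measurable_fun setT gammat_sum by exact: measurable_sum.
have gsle w : `|gammat_sum w| <= n.+1%:R * gamma0.
  rewrite ger0_norm ?gammat_sum_ge0// /gammat_sum.
  apply: (@le_trans _ _ (\sum_(j < n.+1) gamma0)).
    by apply: ler_sum => j _; exact: gammat_le.
  by rewrite sumr_const card_ord -[leLHS]mulr_natl.
have mY : measurable_fun setT (Y i).
  apply: (measurable_known (D := others (SrcRecv n k))).
  apply: measurable_funB => //; exact: (others_iterate hM gamma0_gt0 adm run).
apply: (@L1_bounded _ _ _ P _ (beta0 * gamma0 * (n.+1%:R * gamma0) *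
    (diameter M + aPhi * (n.+1%:R * gamma0)))).
  apply: measurable_funM.
    apply: measurable_funM => //; apply: measurable_funM => //.
    apply: (measurable_known (D := others (SrcRecv n k))).
    exact: (others_betat _ _ adm).
  by apply: measurable_funD; [exact: measurableT_comp|exact: measurable_funM].
move=> w; rewrite ger0_norm ?residual_ge0// /residual.
have gsle' : gammat_sum w <= n.+1%:R * gamma0.
  by have := gsle w; rewrite ger0_norm ?gammat_sum_ge0.
have s0 : 0 <= `|Y i w| + aPhi * gammat_sum w.
  by apply: addr_ge0 => //; apply: mulr_ge0 => //; exact: gammat_sum_ge0.
apply: ler_pM => //.
- by apply: mulr_ge0; [exact: mulr_ge0|exact: gammat_sum_ge0].
- apply: ler_pM => //; first exact: mulr_ge0.
    exact: gammat_sum_ge0.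
  by apply: ler_pM => //; [exact: betat_le|exact: gammat_le].
- apply: lerD; first exact: (actions_coord_le i (X_box w) (astar_in hM)).
  by rewrite ler_wpM2l.
Qed.

Definition residual_const : R :=
  2 * aPhi ^+ 3 * alpha_G M + sigma_Phi M ^+ 2 * (lipG M * aPhi / r).

(** The estimate is replaced with the total utility, then with [G], which is
    expanded around [unperturbed]; the second-moment term of the expansion is
    recentred at the iterate, where it averages to the gradient of [F]. *)
Lemma drift i :
  Ex (fun w => wd i w * Phi M i k w * f_estimate M st (a k w) i k w) <=
  sigma_Phi M ^+ 2 * (Theta * Ex (fun w => Y i w * dF i (X w))) +
  residual_const * Ex (residual i).
Proof.
rewrite (Ex_probe_estimate hM beta0_gt0 gamma0_gt0 adm run k1 i).2 Ex_probe_total.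
have [iU EU] := Ex_unperturbed i; have [iwg iP EP] := Ex_Phi_sqr i.
have [iG _ EG] := Ex_gain i; have iR := L1_residual i.
have iT : L1 (fun w => wd i w * Phi M i k w * Gfun M (active M k w) (ph w)).
  have [] // := L1_activity_fun (x := SrcRecv n k) (h := Gfun M) (q := ph)
    (V := fun w => wd i w * Phi M i k w) (c := probe_bound M beta0) (e := Gbound).
  - by move=> j; exact: (others_performed hM gamma0_gt0 adm run).
  - exact: (others_probe hM gamma0_gt0 adm run k1).
  - exact: (probe_le hM beta0_gt0 gamma0_gt0 adm run k1).
  - by move=> *; exact: Gfun_le.
have step1 : Ex (fun w => wd i w * Phi M i k w * Gfun M (active M k w) (ph w)) <=
    sigma_Phi M ^+ 2 * Ex (fun w => wd i w * gam i k w * gain i w) +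
    2 * aPhi ^+ 3 * alpha_G M * Ex (residual i).
  rewrite -EP -[X in X + _ * _]add0r -EU -ExZl// -ExD// -ExD//; [|exact: L1D|exact: L1Zl].
  apply: le_Ex => // [|w]; first by apply: L1D; [exact: L1D|exact: L1Zl].
  have := expansion_error i w; rewrite -[X in `|X|]addrA -opprD.
  exact: le_of_dist.
have step2 : Ex (fun w => wd i w * gam i k w * gain i w) <=
    Theta * Ex (fun w => Y i w * dF i (X w)) + lipG M * aPhi / r * Ex (residual i).
  rewrite -EG -ExZl// -ExD//; last exact: L1Zl.
  apply: le_Ex => // [|w]; first by apply: L1D => //; exact: L1Zl.
  by apply: le_of_dist; exact: recentring_error.
apply: (le_trans step1).
have {step2} := ler_wpM2l (sqr_ge0 (sigma_Phi M)) step2.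
rewrite mulrDr => h.
rewrite /residual_const; set c := 2 * _ * _.
rewrite mulrDl [X in _ <= _ + X]addrC addrA lerD2r.
by rewrite -[X in _ <= _ + X]mulrA.
Qed.

End drift.

(** * Contraction of the mean-square deviation *)

Section one_step.
Context (R : realType) (d : measure_display) (Omega : measurableType d)
  (P : probability Omega R) (d' : measure_display) (T : measurableType d')
  (n : nat) (M : dosp_model P T n) (hM : dosp_assumptions M)
  (beta0 gamma0 c1 c2 : R) (beta0_gt0 : 0 < beta0) (gamma0_gt0 : 0 < gamma0)
  (adm : admissible c1 c2).
Local Notation st := (StepSize beta0 gamma0 c1 c2).
Context (a : nat -> Omega -> 'rV[R]_n.+1) (run : dosp_run M st a).
Local Notation Ex f := (Rintegral P setT f).
Local Notation L1 f := (P.-integrable setT (EFin \o (f : Omega -> R))).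
Local Notation aPhi := (alpha_Phi M).
Local Notation lo := (amin M).
Local Notation hi := (amax M).
Local Notation gam i k w := (gammat M st i k w).
Local Notation bet i k w := (betat M st i k w).

Lemma enorm_sqr (x : 'rV[R]_n.+1) : enorm x ^+ 2 = \sum_i x 0 i ^+ 2.
Proof.
rewrite sqr_sqrtr; last by apply: sumr_ge0 => i _; rewrite -expr2 sqr_ge0.
by apply: eq_bigr => i _; rewrite expr2.
Qed.

Lemma L1_distance k i : (0 < k)%N ->
  L1 (fun w => (a k w 0 i - astar M 0 i) ^+ 2).
Proof.
move=> k0; apply: (@L1_bounded _ _ _ P _ (diameter M ^+ 2)).
  apply: measurable_funX; apply: measurable_funB => //.
  apply: (adapted_measurable (known_measurable run (D := @past n k.+1))).
  exact: (adapted_trajectory hM gamma0_gt0 adm run).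
move=> w; rewrite ger0_norm ?sqr_ge0// -[leLHS]real_normK ?num_real//.
rewrite lerXn2r ?nnegrE ?(diameter_ge0 hM)//.
exact: (actions_coord_le i (action_box hM gamma0_gt0 adm run w k0) (astar_in hM)).
Qed.

Context (k : nat) (k1 : (1 < k)%N).
Local Notation known := (known M a).
Local Notation iterate := (iterate M beta0 gamma0 c1 c2 a).
Local Notation X := (iterate k).
Let k0 : (0 < k)%N. Proof. exact: ltn_trans k1. Qed.
Context (r : R) (r_gt0 : 0 < r)
  (margin : forall i, lo 0 i + r <= astar M 0 i <= hi 0 i - r).
Local Notation others := (others k).
Local Notation wd := (weighted_dev M beta0 gamma0 c1 c2 a k).
Local Notation dF i := (partial (actions M) i (Ffun M)).
Local Notation Theta := (mean_product M beta0 gamma0 c1 c2 k).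
Local Notation Y := (fun i w => X w 0 i - astar M 0 i).
Local Notation residual := (residual M beta0 gamma0 c1 c2 a k).
Local Notation rc := (rate_const M).
Local Notation t := (total_rate M k).
Local Notation estimate := (fun i w => f_estimate M st (a k w) i k w).

Let c1_gt0 : 0 < c1. Proof. by case: adm => h *; lra. Qed.
Let c2_gt0 : 0 < c2. Proof. by case: adm. Qed.
Let gam0 i w : 0 <= gam i k w. Proof. exact: gammat_ge0. Qed.
Let bet0 i w : 0 <= bet i k w. Proof. exact: betat_ge0. Qed.
Let aPhi0 : 0 <= aPhi. Proof. exact: aPhi_ge0 hM. Qed.
Let aPhi_gt0 : 0 < aPhi. Proof. exact: alpha_Phi_gt0 hM. Qed.
Let t0 w : 0 <= t w. Proof. exact: total_rate_ge0. Qed.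

Lemma betat_le_total i w : bet i k w <= beta0 * t w `^ c1.
Proof.
rewrite betatE// ler_wpM2l ?(ltW beta0_gt0)// ge0_ler_powR ?nnegrE ?rate_ge0//.
  exact: ltW.
exact: rate_le_total.
Qed.

Lemma gammat_le_total i w : gam i k w <= gamma0 * t w `^ c2.
Proof.
rewrite gammatE// ler_wpM2l ?(ltW gamma0_gt0)// ge0_ler_powR ?nnegrE ?rate_ge0//.
  exact: ltW.
exact: rate_le_total.
Qed.

Lemma betat_sqr_le i w : bet i k w ^+ 2 <= beta0 ^+ 2 * t w `^ (2 * c1).
Proof.
have -> : t w `^ (2 * c1) = (t w `^ c1) ^+ 2.
  by rewrite mulrC powRrM powR_mulrn// powR_ge0.
rewrite -exprMn lerXn2r ?nnegrE//; first by rewrite mulr_ge0 ?powR_ge0// ltW.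
exact: betat_le_total.
Qed.

Lemma two_c1 : 0 <= 2 * c1 <= 2.
Proof. by case: adm => h1 h2 *; apply/andP; split; lra. Qed.

Let measR (V : Omega -> R) : adapted (known (others (SrcRecv n k))) V ->
  measurable_fun setT V.
Proof. exact: (measurable_known run). Qed.

Lemma Ex_betat_sqr i : L1 (fun w => bet i k w ^+ 2) /\
  Ex (fun w => bet i k w ^+ 2) <= beta0 ^+ 2 * (rc * k%:R `^ (- (2 * c1))).
Proof.
have iT := L1_total_rate M k (andP two_c1).1.
have iB : L1 (fun w => bet i k w ^+ 2).
  apply: (L1_le (Y := fun w => beta0 ^+ 2 * t w `^ (2 * c1))).
  - apply: measR; apply: measurable_funX; exact: (others_betat _ _ adm).
  - by move=> w; rewrite ger0_norm ?sqr_ge0// betat_sqr_le.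
  - exact: L1Zl.
split => //; apply: le_trans (le_Ex iB (L1Zl (beta0 ^+ 2) iT) (betat_sqr_le i)) _.
rewrite ExZl// ler_wpM2l ?sqr_ge0//; exact: (Ex_total_rate hM k0 two_c1).
Qed.

Definition estimate_weight : R := 1 + (qr M)^-1.

Lemma estimate_sqr_le i w : estimate i w ^+ 2 <=
  estimate_weight ^+ 2 * (n.+1%:R *
    \sum_j (2 * envelope M j (state M k w) + 2 * Defs.eta M j k w ^+ 2)).
Proof.
pose c j := if j == i then 1 else (qr M)^-1 * ((delta M j k w)%:R * (recv M i j k w)%:R).
have qr0 : 0 < (qr M)^-1 by rewrite invr_gt0 (qr_gt0 hM).
have cle j : 0 <= c j <= estimate_weight.
  rewrite /c /estimate_weight; case: ifP => _; first by apply/andP; split; lra.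
  have : 0 <= ((delta M j k w)%:R * (recv M i j k w)%:R : R) <= 1.
    rewrite mulr_ge0//= -[leRHS]mulr1; apply: ler_pM => //.
      by rewrite lern1 leq_b1.
    by rewrite lern1 leq_b1.
  move: ((delta M j k w)%:R * _) => b /andP[b0 b1]; apply/andP; split; nra.
pose o j := observed_utility M st (a k w) j k w.
have -> : estimate i w = \sum_j c j * o j.
  rewrite f_estimateE [RHS](bigD1 i)//= {1}/c eqxx mul1r mulr_sumr; congr (_ + _).
  by apply: eq_bigr => j ji; rewrite /c (negbTE ji) !mulrA.
apply: le_trans (sqr_sum_le _) _; rewrite card_ord mulrCA ler_wpM2l// mulr_sumr.
apply: ler_sum => j _; rewrite exprMn; have /andP[h1 h2] := cle j.
apply: ler_pM; rewrite ?sqr_ge0//.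
  by rewrite lerXn2r ?nnegrE//; exact: le_trans h2.
have bw := performed_box hM gamma0_gt0 adm run w k0.
have := utility_envelope hM j (active M k w) (state M k w) bw.
rewrite /o /observed_utility.
move: (utility _ _ _ _ _) (envelope _ _ _) (Defs.eta _ _ _ _) => v e x ve.
by have := sqr_ge0 (v - x); nra.
Qed.

Definition noise_energy : R :=
  \sum_(j < n.+1) (2 * Ex (fun w => envelope M j (state M 1 w)) + 2 * sigma_eta M ^+ 2).

Definition energy_const : R :=
  aPhi ^+ 2 * (estimate_weight ^+ 2 * n.+1%:R) * noise_energy * (beta0 ^+ 2 * rc).

Lemma envelope_ge0 j s : 0 <= envelope M j s.
Proof.
apply: addr_ge0; apply: mulr_ge0 => //; last exact: sqr_ge0.
  by apply: sumr_ge0 => dl _; exact: sqr_ge0.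
by apply: mulr_ge0 => //; exact: sqr_ge0.
Qed.

Lemma noise_energy_ge0 : 0 <= noise_energy.
Proof.
apply: sumr_ge0 => j _; rewrite addr_ge0// mulr_ge0 ?sqr_ge0//.
by apply: Ex_ge0 => w; exact: envelope_ge0.
Qed.

Lemma measurable_estimate i : measurable_fun setT (estimate i).
Proof.
apply: (adapted_measurable (known_measurable run (D := setT))).
apply: (adapted_f_estimate hM gamma0_gt0 adm run) => //.
- move=> j; apply: adaptedS (adapted_trajectory hM gamma0_gt0 adm run j k0).
  exact: knownS.
- by move=> j; apply: (adapted_some (x := SrcDelta j k)).
- by move=> j; apply: (adapted_some (x := SrcEll j k)).
- by move=> j; apply: (adapted_some (x := SrcPhi j k)).
- by move=> j; apply: (adapted_some (x := SrcEta j k)).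
- by move=> j l; apply: adapted_recv.
- by apply: (adapted_some (x := SrcState n k)).
Qed.

(** The step-size is independent of the noise and of the state, which dominate the
    estimate uniformly in the action. *)
Lemma Ex_step_sqr i :
  L1 (fun w => (bet i k w * Phi M i k w * estimate i w) ^+ 2) /\
  Ex (fun w => (bet i k w * Phi M i k w * estimate i w) ^+ 2) <=
    energy_const * k%:R `^ (- (2 * c1)).
Proof.
have [iB EB] := Ex_betat_sqr i.
have src (V : Omega -> R) (x : source n) : slot x = k -> (forall l, x <> SrcDelta l k) ->
    (forall l, x <> SrcEll l k) -> adapted (known [set Some x]) V -> L1 V ->
    L1 (fun w => bet i k w ^+ 2 * V w) /\
    Ex (fun w => bet i k w ^+ 2 * V w) = Ex (fun w => bet i k w ^+ 2) * Ex V.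
  move=> xk xd xe aV iV; apply: (Ex_source hM run k1 xk) => //.
  by apply: measurable_funX; exact: (others_betat _ _ adm).
have env j : L1 (fun w => bet i k w ^+ 2 * envelope M j (state M k w)) /\
    Ex (fun w => bet i k w ^+ 2 * envelope M j (state M k w)) =
    Ex (fun w => bet i k w ^+ 2) * Ex (fun w => envelope M j (state M 1 w)).
  have [iE EE] := Ex_state hM k0 (envelope_measurable hM j) (L1_envelope hM j).
  rewrite -EE; apply: (src (fun w => envelope M j (state M k w)) (SrcState n k)) => //.
  apply: (measurableT_comp (envelope_measurable hM j)).
  exact: (adapted_some (x := SrcState n k)).
have eta2 j : L1 (fun w => bet i k w ^+ 2 * Defs.eta M j k w ^+ 2) /\
    Ex (fun w => bet i k w ^+ 2 * Defs.eta M j k w ^+ 2) =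
    Ex (fun w => bet i k w ^+ 2) * sigma_eta M ^+ 2.
  have [_ i2 _ E2] := Ex_eta hM j k0.
  rewrite -E2; apply: (src (fun w => Defs.eta M j k w ^+ 2) (SrcEta j k)) => //.
  apply: measurable_funX; exact: (adapted_some (x := SrcEta j k)).
pose q j w := 2 * (bet i k w ^+ 2 * envelope M j (state M k w)) +
  2 * (bet i k w ^+ 2 * Defs.eta M j k w ^+ 2).
have iq j : L1 (q j) by apply: L1D; apply: L1Zl; [exact: (env j).1|exact: (eta2 j).1].
have iQ : L1 (fun w => \sum_j q j w) by exact: L1_sum.
pose C := aPhi ^+ 2 * (estimate_weight ^+ 2 * n.+1%:R).
have C0 : 0 <= C by apply: mulr_ge0; rewrite ?sqr_ge0// mulr_ge0// sqr_ge0.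
have le w : (bet i k w * Phi M i k w * estimate i w) ^+ 2 <= C * \sum_j q j w.
  have h := estimate_sqr_le i w; move: h.
  set S := \sum_j _ => h.
  have -> : \sum_j q j w = bet i k w ^+ 2 * S.
    by rewrite mulr_sumr; apply: eq_bigr => j _; rewrite /q; ring.
  have -> : C * (bet i k w ^+ 2 * S) =
    bet i k w ^+ 2 * aPhi ^+ 2 * (estimate_weight ^+ 2 * (n.+1%:R * S)).
    by rewrite /C; ring.
  rewrite [leLHS]exprMn; apply: ler_pM h; rewrite ?sqr_ge0//.
  rewrite exprMn ler_wpM2l ?sqr_ge0// -[leLHS]real_normK ?num_real//.
  by rewrite lerXn2r ?nnegrE// (Phi_bound hM).
have iS : L1 (fun w => (bet i k w * Phi M i k w * estimate i w) ^+ 2).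
  apply: (L1_le (Y := fun w => C * \sum_j q j w)); last exact: L1Zl.
    apply: measurable_funX; apply: measurable_funM; last exact: measurable_estimate.
    apply: measurable_funM => //; apply: measR; exact: (others_betat _ _ adm).
  by move=> w; rewrite ger0_norm ?sqr_ge0// le.
split => //; apply: le_trans (le_Ex iS (L1Zl C iQ) le) _.
rewrite ExZl// Ex_sum// /energy_const -/C -mulrA -mulrA ler_wpM2l//.
apply: (@le_trans _ _ (noise_energy * Ex (fun w => bet i k w ^+ 2))); last first.
  by rewrite ler_wpM2l ?noise_energy_ge0// -mulrA.
rewrite /noise_energy mulr_suml le_eqVlt; apply/orP; left; apply/eqP.
apply: eq_bigr => j _; rewrite ExD; [|exact/L1Zl/(env j).1|exact/L1Zl/(eta2 j).1].
rewrite ExZl ?(env j).1// ExZl ?(eta2 j).1// (env j).2 (eta2 j).2.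
by ring.
Qed.

Definition dev2 (i : 'I_n.+1) : R := Ex (fun w => Y i w ^+ 2).

Let X_box w : actions M (X w). Proof. exact: (iterate_box hM). Qed.

Let mY i : measurable_fun setT (Y i).
Proof.
apply: measR; apply: measurable_funB => //.
exact: (others_iterate hM gamma0_gt0 adm run).
Qed.

Lemma L1_dev2 i : L1 (fun w => Y i w ^+ 2).
Proof.
apply: (@L1_bounded _ _ _ P _ (diameter M ^+ 2)); first exact: measurable_funX.
move=> w; rewrite ger0_norm ?sqr_ge0// -[leLHS]real_normK ?num_real//.
rewrite lerXn2r ?nnegrE ?(diameter_ge0 hM)//.
exact: (actions_coord_le i (X_box w) (astar_in hM)).
Qed.

Lemma dev2_ge0 i : 0 <= dev2 i.
Proof. by apply: Ex_ge0 => w; exact: sqr_ge0. Qed.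

Lemma total_dev2_independent i s : 0 <= s ->
  L1 (fun w => Y i w ^+ 2 * t w `^ s) /\
  Ex (fun w => Y i w ^+ 2 * t w `^ s) = dev2 i * Ex (fun w => t w `^ s).
Proof.
move=> s0.
pose D2 : set (option (source n)) :=
  [set y | exists j, y = Some (SrcDelta j k) \/ y = Some (SrcEll j k)].
apply: (Ex_indepM hM run (D1 := @past n k) (D2 := D2)).
- exact: past_proper.
- by move=> _ [j [->|->]]; apply: proper_slot.
- by move=> y [[_ yk] [j [E|E]]]; move: yk; rewrite E /= ltnn.
- apply: measurable_funX; apply: measurable_funB => //.
  exact: (adapted_iterate hM gamma0_gt0 adm run).
- apply: adapted_powR; apply: measurable_sum => j; apply: adapted_rate.
    by apply: (adapted_some (x := SrcDelta j k)) => //; exists j; left.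
  by apply: (adapted_some (x := SrcEll j k)) => //; exists j; right.
- exact: L1_dev2.
- exact: L1_total_rate.
Qed.

Definition residual_scale : R := beta0 * gamma0 * (n.+1%:R * gamma0).

Lemma residual_scale_ge0 : 0 <= residual_scale.
Proof. by rewrite !mulr_ge0// ltW. Qed.

Definition residual_tail (e : R) : R := (4 * e)^-1 + aPhi * (n.+1%:R * gamma0).

Lemma residual_tail_ge0 e : 0 < e -> 0 <= residual_tail e.
Proof.
move=> e0; apply: addr_ge0; first by rewrite invr_ge0 mulr_ge0// ltW.
by rewrite !mulr_ge0// ltW.
Qed.

(** Young's inequality moves the deviation [Y i], which comes with the factor
    [t ^ (c1 + 2 * c2)], partly into the contraction term [t ^ (c1 + c2)]. *)
Lemma residual_le e i w : 0 < e ->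
  residual i w <= residual_scale * (e * (Y i w ^+ 2 * t w `^ (c1 + c2)) +
    residual_tail e * t w `^ (c1 + 3 * c2)).
Proof.
move=> e0; rewrite /residual.
have gs : gammat_sum M beta0 gamma0 c1 c2 k w <= n.+1%:R * gamma0 * t w `^ c2.
  rewrite /gammat_sum; apply: (@le_trans _ _ (\sum_(j < n.+1) gamma0 * t w `^ c2)).
    by apply: ler_sum => j _; exact: gammat_le_total.
  by rewrite sumr_const card_ord -[leLHS]mulr_natl mulrA.
have gs0 : 0 <= gammat_sum M beta0 gamma0 c1 c2 k w by exact: sumr_ge0.
have b := betat_le_total i w; have g := gammat_le_total i w.
have p1 := powR_ge0 (t w) c1; have p2 := powR_ge0 (t w) c2.
have E1 : t w `^ (c1 + c2) = t w `^ c1 * t w `^ c2.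
  by rewrite powRD// gt_eqF// addr_gt0.
have E3 : t w `^ (c1 + 3 * c2) = t w `^ c1 * (t w `^ c2) ^+ 3.
  rewrite powRD; last by rewrite gt_eqF// addr_gt0// mulr_gt0.
  by rewrite [3 * _]mulrC powRrM powR_mulrn.
rewrite E1 E3; move: gs gs0 b g p1 p2 (normr_ge0 (Y i w)) (bet0 i w) (gam0 i w).
rewrite -[Y i w ^+ 2]real_normK ?num_real//.
move: (gammat_sum _ _ _ _ _ _ _) (bet i k w) (gam i k w) (t w `^ c1) (t w `^ c2) (`|Y i w|).
move=> G b g p q y gs gs0 bp gq p0 q0 y0 b0 g0.
have N0 : 0 <= n.+1%:R * gamma0 by rewrite mulr_ge0// ltW.
apply: (@le_trans _ _ ((beta0 * p) * (gamma0 * q) * (n.+1%:R * gamma0 * q) *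
    (y + aPhi * (n.+1%:R * gamma0 * q)))).
  apply: ler_pM.
  - by rewrite !mulr_ge0.
  - by apply: addr_ge0 => //; exact: mulr_ge0.
  - by apply: ler_pM => //; [exact: mulr_ge0|exact: ler_pM].
  - by rewrite lerD2l ler_wpM2l.
rewrite -subr_ge0.
have -> : residual_scale * (e * (y ^+ 2 * (p * q)) + residual_tail e * (p * q ^+ 3)) -
   (beta0 * p) * (gamma0 * q) * (n.+1%:R * gamma0 * q) *
    (y + aPhi * (n.+1%:R * gamma0 * q)) =
   residual_scale * (p * q) * ((2 * e * y - q) ^+ 2 / (4 * e)).
  by rewrite /residual_scale /residual_tail; field; rewrite gt_eqF.
apply: mulr_ge0; first by rewrite mulr_ge0 ?residual_scale_ge0// mulr_ge0.
by apply: divr_ge0; [exact: sqr_ge0|rewrite mulr_ge0// ltW].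
Qed.

Lemma c1_3c2 : 0 <= c1 + 3 * c2 <= 2.
Proof. by case: adm => h1 h2 h3 h4; apply/andP; split; lra. Qed.

Lemma c1_c2 : 0 <= c1 + c2 <= 2.
Proof. by case: adm => h1 h2 h3 h4; apply/andP; split; lra. Qed.

Lemma Ex_residual e i : 0 < e ->
  Ex (residual i) <= residual_scale * (rc * (e * (dev2 i * k%:R `^ (- (c1 + c2))) +
    residual_tail e * k%:R `^ (- (c1 + 3 * c2)))).
Proof.
move=> e0; have iR := L1_residual hM beta0_gt0 gamma0_gt0 adm run k1 i.
have [s0 _] := andP c1_c2; have [s0' _] := andP c1_3c2.
have [iA EA] := total_dev2_independent i s0.
have iB := L1_total_rate M k s0'.
apply: le_trans (le_Ex iR _ (fun w => residual_le i w e0)) _.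
  by apply: L1Zl; apply: L1D; exact: L1Zl.
rewrite ExZl; last by apply: L1D; exact: L1Zl.
rewrite ExD; [|exact: L1Zl|exact: L1Zl].
rewrite !ExZl// EA; apply: ler_wpM2l; first exact: residual_scale_ge0.
have h1 := Ex_total_rate hM k0 c1_c2; have h2 := Ex_total_rate hM k0 c1_3c2.
have := ler_wpM2l (mulr_ge0 (ltW e0) (dev2_ge0 i)) h1.
have := ler_wpM2l (residual_tail_ge0 e0) h2.
move: (Ex _) (Ex _) (residual_tail e) (dev2 i) (k%:R `^ _) (k%:R `^ _).
move=> A B u v p q hA hB; apply: le_trans (lerD _ _) _.
- by rewrite mulrA; exact: hB.
- exact: hA.
by rewrite le_eqVlt; apply/orP; left; apply/eqP; ring.
Qed.

(** If [aPhi * gam] exceeds the margin [r], then [t ^ c2] is at least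
    [r / (aPhi * gamma0)]; raising this to the power [2 * c1 / c2] bounds
    [(aPhi * gamma0) ^ 2] by a multiple of [t ^ (2 * c1)]. *)
Definition boundary_const : R :=
  (aPhi * gamma0) ^+ 2 / (r / (aPhi * gamma0)) `^ (2 * c1 / c2).

Lemma boundary_const_ge0 : 0 <= boundary_const.
Proof. by rewrite divr_ge0 ?sqr_ge0 ?powR_ge0. Qed.

(** The projection onto the shrunk interval moves the iterate away from the
    optimum only at slots with a large step-size, which are rare. *)
Lemma action_dev_le i w : (a k w 0 i - astar M 0 i) ^+ 2 <=
  Y i w ^+ 2 + boundary_const * t w `^ (2 * c1).
Proof.
rewrite (action_iterate hM gamma0_gt0 adm run i w k1).
apply: le_trans (project_dist_sqr _ _ (ltW r_gt0) _ (margin i)) _.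
- exact: mulr_ge0.
- exact: (shrunk_interval hM gamma0_gt0 adm run).
rewrite lerD2l; have ag0 : 0 < aPhi * gamma0 by exact: mulr_gt0.
have [rg|_] := ltP r (aPhi * gam i k w); last first.
  by rewrite mulr0 mulr_ge0 ?boundary_const_ge0 ?powR_ge0.
rewrite mulr1 /boundary_const.
have eta0 : 0 < r / (aPhi * gamma0) by exact: divr_gt0.
rewrite mulrAC ler_pdivlMr ?powR_gt0//.
apply: ler_pM; rewrite ?sqr_ge0 ?powR_ge0//.
  rewrite lerXn2r ?nnegrE ?mulr_ge0 ?(ltW gamma0_gt0)//.
  by rewrite ler_wpM2l// gammat_le.
have rp : r / (aPhi * gamma0) <= t w `^ c2.
  rewrite ler_pdivrMr//; apply: (le_trans (ltW rg)).
  rewrite [leRHS]mulrC -mulrA ler_wpM2l//.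
  exact: gammat_le_total.
apply: (@le_trans _ _ ((t w `^ c2) `^ (2 * c1 / c2))).
  rewrite ge0_ler_powR ?nnegrE ?powR_ge0 ?(ltW eta0)//.
  by rewrite divr_ge0 ?mulr_ge0// ltW.
by rewrite -powRrM mulrCA divff ?mulr1// gt_eqF.
Qed.

Lemma Ex_action_dev i : Ex (fun w => (a k w 0 i - astar M 0 i) ^+ 2) <=
  dev2 i + boundary_const * (rc * k%:R `^ (- (2 * c1))).
Proof.
have [s0 _] := andP two_c1; have iT := L1_total_rate M k s0.
apply: le_trans (le_Ex (L1_distance i k0) _ (action_dev_le i)) _.
  by apply: L1D; [exact: L1_dev2|exact: L1Zl].
rewrite ExD; [|exact: L1_dev2|exact: L1Zl].
rewrite lerD2l ExZl// ler_wpM2l ?boundary_const_ge0//.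
exact: (Ex_total_rate hM k0 two_c1).
Qed.

Lemma Ex_gradient_le :
  \sum_i Ex (fun w => Y i w * dF i (X w)) <= - alpha_F M * \sum_i dev2 i.
Proof.
have iG i : L1 (fun w => Y i w * dF i (X w)).
  by have [] := Ex_gain hM beta0_gt0 gamma0_gt0 adm run k1 i.
rewrite -Ex_sum// /dev2 -Ex_sum => [|i _]; last exact: L1_dev2.
rewrite -ExZl; last by apply: L1_sum => i _; exact: L1_dev2.
apply: le_Ex => [||w]; first exact: L1_sum.
  by apply: L1Zl; apply: L1_sum => i _; exact: L1_dev2.
have := F_strongly_concave hM (X_box w).
have -> : enorm (X w - astar M) ^+ 2 = \sum_i Y i w ^+ 2.
  by rewrite enorm_sqr; apply: eq_bigr => i _; rewrite !mxE.
have -> // : dotv (X w - astar M) (grad (actions M) (Ffun M) (X w)) =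
  \sum_i Y i w * dF i (X w).
by apply: eq_bigr => i _; rewrite !mxE.
Qed.

Lemma Ex_next i :
  Ex (fun w => (iterate k.+1 w 0 i - astar M 0 i) ^+ 2) <=
  Ex (fun w => (a k w 0 i - astar M 0 i) ^+ 2) +
  2 * Ex (fun w => wd i w * Phi M i k w * estimate i w) +
  Ex (fun w => (bet i k w * Phi M i k w * estimate i w) ^+ 2).
Proof.
have [iZ _] := Ex_probe_estimate hM beta0_gt0 gamma0_gt0 adm run k1 i.
have [iS _] := Ex_step_sqr i; have iA := L1_distance i k0.
rewrite -ExZl// -ExD//; last exact: L1Zl.
rewrite -ExD//; last by apply: L1D => //; exact: L1Zl.
have le w : (iterate k.+1 w 0 i - astar M 0 i) ^+ 2 <=
    (a k w 0 i - astar M 0 i) ^+ 2 + 2 * (wd i w * Phi M i k w * estimate i w) +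
    (bet i k w * Phi M i k w * estimate i w) ^+ 2.
  rewrite mxE /=; apply: le_trans (project_dist _ (astar_in hM i)) _.
  by rewrite /weighted_dev le_eqVlt; apply/orP; left; apply/eqP; ring.
have iR : L1 (fun w => (a k w 0 i - astar M 0 i) ^+ 2 +
    2 * (wd i w * Phi M i k w * estimate i w) +
    (bet i k w * Phi M i k w * estimate i w) ^+ 2).
  by apply: L1D => //; apply: L1D => //; exact: L1Zl.
apply: le_Ex => //; apply: (L1_le _ _ iR) => [|w].
  apply: measurable_funX; apply: measurable_funB => //.
  apply: (adapted_measurable (known_measurable run (D := @past n k.+1))).
  exact: (adapted_iterate hM gamma0_gt0 adm run).
by rewrite ger0_norm ?sqr_ge0.
Qed.

Definition forcing_const (e : R) : R :=
  n.+1%:R * (boundary_const * rc + energy_const +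
    2 * (residual_const M r * (residual_scale * (rc * residual_tail e)))).

(** The gain is large enough for a contraction by [4 * k ^ (- (c1 + c2))], half of
    which pays for the multiple of the deviation left by Young's inequality. All
    other terms are at most of order [k ^ (- (c1 + c2) - m)]: the squared update
    and the boundary correction because [m <= c1 - c2], the tail of the residual
    because [m <= 2 * c2]. *)
Lemma dev2_step (e m : R) : 0 < e -> m <= 2 * c2 -> m <= c1 - c2 ->
  residual_const M r * residual_scale * rc * e <= 1 ->
  4 <= A_const M * (beta0 * gamma0) ->
  \sum_i Ex (fun w => (iterate k.+1 w 0 i - astar M 0 i) ^+ 2) <=
  (1 - 2 * k%:R `^ (- (c1 + c2))) * \sum_i dev2 i +
    forcing_const e * k%:R `^ (- (c1 + c2) - m).
Proof.
move=> e0 m1 m2 small large.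
have kR : (1 : R) <= k%:R by rewrite ler1n.
have decay x : c1 + c2 + m <= x -> k%:R `^ (- x) <= k%:R `^ (- (c1 + c2) - m) :> R.
  by move=> h; rewrite ler_powR//; lra.
have hQ : k%:R `^ (- (2 * c1)) <= k%:R `^ (- (c1 + c2) - m) :> R.
  by apply: decay; lra.
have hW : k%:R `^ (- (c1 + 3 * c2)) <= k%:R `^ (- (c1 + c2) - m) :> R.
  by apply: decay; lra.
have rc0 := rate_const_ge0 M; have rs0 := residual_scale_ge0.
have rt0 := residual_tail_ge0 e0; have bc0 := boundary_const_ge0.
have cr0 : 0 <= residual_const M r.
  apply: addr_ge0; apply: mulr_ge0; rewrite ?sqr_ge0//.
  - by rewrite mulr_ge0// exprn_ge0.
  - exact/ltW/(alpha_G_gt0 hM).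
  - by apply: divr_ge0; [apply: mulr_ge0 => //; exact: lipG_ge0|exact: ltW].
have ec0 : 0 <= energy_const.
  apply: mulr_ge0; last by rewrite mulr_ge0// sqr_ge0.
  apply: mulr_ge0; last exact: noise_energy_ge0.
  by apply: mulr_ge0; rewrite ?sqr_ge0// mulr_ge0// sqr_ge0.
pose S : R := k%:R `^ (- (c1 + c2)); pose F : R := k%:R `^ (- (c1 + c2) - m).
have S0 : 0 <= S by exact: powR_ge0.
pose E i := Ex (fun w => Y i w * dF i (X w)).
have each i : Ex (fun w => (iterate k.+1 w 0 i - astar M 0 i) ^+ 2) <=
    dev2 i + 2 * (sigma_Phi M ^+ 2 * Theta) * E i + 2 * S * dev2 i +
    (boundary_const * rc + energy_const +
      2 * (residual_const M r * (residual_scale * (rc * residual_tail e)))) * F.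
  apply: (le_trans (Ex_next i)).
  have h1 := Ex_action_dev i; have h2 := (Ex_step_sqr i).2.
  have h3 := drift hM beta0_gt0 gamma0_gt0 adm run k1 r_gt0 margin i.
  have h4 := ler_wpM2l cr0 (Ex_residual i e0).
  have d0 := dev2_ge0 i.
  have h1' := ler_wpM2l (mulr_ge0 bc0 rc0) hQ.
  have h2' := ler_wpM2l ec0 hQ.
  have h5 := ler_wpM2l (mulr_ge0 cr0 (mulr_ge0 rs0 (mulr_ge0 rc0 rt0))) hW.
  have h6 := ler_wpM2r (mulr_ge0 S0 d0) small.
  rewrite -/(E i) in h3; rewrite -/S in h4; rewrite -/F in h1' h2' h5.
  move: h1 h2 h3 h4 h1' h2' h5 h6.
  move: (Ex (fun w => (a k w 0 i - _) ^+ 2)) (Ex (fun w => wd i w * _ * _)).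
  move: (Ex (fun w => (bet i k w * _ * _) ^+ 2)) (Ex (residual i)).
  move: (residual_const M r) residual_scale (residual_tail e) boundary_const.
  move: energy_const (rate_const M) (mean_product _ _ _ _ _ _) (E i).
  move: (dev2 i) (sigma_Phi M ^+ 2).
  move: (k%:R `^ (- (2 * c1))) (k%:R `^ (- (c1 + 3 * c2))) (S) (F).
  move=> Q W S' F' dv sg ec rc' Th Ei cr rs rt bc V3 V4 V1 V2.
  move=> h1 h2 h3 h4 h1' h2' h5 h6.
  have -> : (bc * rc' + ec + 2 * (cr * (rs * (rc' * rt)))) * F' =
    bc * rc' * F' + ec * F' + 2 * (cr * (rs * (rc' * rt)) * F') by ring.
  have h4' : cr * (rs * (rc' * (e * (dv * S') + rt * W))) =
    cr * rs * rc' * e * (S' * dv) + cr * (rs * (rc' * rt)) * W by ring.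
  rewrite h4' in h4; rewrite mulrA in h1; rewrite mul1r in h6.
  have -> : 2 * (sg * Th) * Ei = 2 * (sg * (Th * Ei)) by ring.
  have -> : 2 * S' * dv = 2 * (S' * dv) by ring.
  move: h1 h2 h3 h4 h1' h2' h5 h6; clear.
  move: (bc * rc' * Q) (bc * rc' * F') (ec * Q) (ec * F') (sg * (Th * Ei)).
  move: (cr * V4) (cr * rs * rc' * e * (S' * dv)) (S' * dv).
  move: (cr * (rs * (rc' * rt)) * W) (cr * (rs * (rc' * rt)) * F').
  by move=> z1 z2 z3 z4 z5 z6 z7 z8 z9 z10 *; lra.
apply: (le_trans (ler_sum _ (fun i _ => each i))).
rewrite !big_split/= sumr_const card_ord -mulr_sumr -mulr_sumr.
have U0 : 0 <= \sum_i dev2 i by apply: sumr_ge0 => i _; exact: dev2_ge0.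
have g := Ex_gradient_le.
have sT0 : 0 <= 2 * (sigma_Phi M ^+ 2 * Theta).
  apply: mulr_ge0 => //; apply: mulr_ge0; first exact: sqr_ge0.
  apply: le_trans (mean_product_ge hM beta0_gt0 gamma0_gt0 adm k0).
  by apply: mulr_ge0 => //; apply: mulr_ge0; exact: ltW.
have g' := ler_wpM2l sT0 g.
have A0 : 0 <= A_const M.
  apply: mulr_ge0; last exact/ltW/(alpha_F_gt0 hM).
  by apply: mulr_ge0 => //; exact: sqr_ge0.
have hT := ler_wpM2l A0 (mean_product_ge hM beta0_gt0 gamma0_gt0 adm k0).
have hS : 4 * S <= A_const M * Theta.
  apply: le_trans hT; rewrite -/S [leRHS]mulrA.
  by apply: ler_wpM2r.
have hU := ler_wpM2r U0 hS.
rewrite /forcing_const -/S -/F; set c := (X in X * F *+ _).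
rewrite -[(c * F) *+ _]mulr_natl [X in _ + X <= _]mulrA lerD2r.
apply: (@le_trans _ _ (\sum_i dev2 i + - (A_const M * Theta * \sum_i dev2 i) +
    2 * S * \sum_i dev2 i)).
  rewrite lerD2r lerD2l; apply: (le_trans g').
  by rewrite /A_const le_eqVlt; apply/orP; left; apply/eqP; ring.
move: hU; move: (\sum_i dev2 i) (A_const M * Theta) (S) => U V s h.
rewrite mulrBl mul1r -subr_ge0.
have -> : U - 2 * s * U - (U - V * U + 2 * s * U) = V * U - 4 * s * U by ring.
by rewrite subr_ge0.
Qed.

End one_step.

(** * Rate of convergence *)

Section rate.
Context (R : realType) (d : measure_display) (Omega : measurableType d)
  (P : probability Omega R) (d' : measure_display) (T : measurableType d')
  (n : nat) (M : dosp_model P T n) (hM : dosp_assumptions M)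
  (beta0 gamma0 c1 c2 : R) (beta0_gt0 : 0 < beta0) (gamma0_gt0 : 0 < gamma0)
  (adm : admissible c1 c2).
Local Notation st := (StepSize beta0 gamma0 c1 c2).
Context (a : nat -> Omega -> 'rV[R]_n.+1) (run : dosp_run M st a).
Local Notation Ex f := (Rintegral P setT f).
Local Notation L1 f := (P.-integrable setT (EFin \o (f : Omega -> R))).

Lemma msdE k : (0 < k)%N -> msd M a k = (n.+1%:R^-1 *
  \sum_i Ex (fun w => (a k w 0 i - astar M 0 i) ^+ 2))%:E.
Proof.
move=> k0; rewrite /msd EFinM; congr (_ * _)%E.
have -> : (fun w => enorm (a k w - astar M) ^+ 2) =
    (fun w => \sum_i (a k w 0 i - astar M 0 i) ^+ 2).
  by apply/funext => w; rewrite enorm_sqr; apply: eq_bigr => i _; rewrite !mxE.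
have iD i := L1_distance hM gamma0_gt0 adm run i k0.
rewrite expectation_Ex; last by apply: L1_sum => i _; exact: iD.
by rewrite Ex_sum// => i _; exact: iD.
Qed.

Lemma Ex_distance_le k i : (0 < k)%N ->
  Ex (fun w => (a k w 0 i - astar M 0 i) ^+ 2) <= diameter M ^+ 2.
Proof.
move=> k0; rewrite -[leRHS](Ex_cst P); apply: le_Ex => [||w].
- exact: (L1_distance hM gamma0_gt0 adm run i k0).
- exact: L1_cst.
rewrite -[leLHS]real_normK ?num_real// lerXn2r ?nnegrE ?(diameter_ge0 hM)//.
exact: (actions_coord_le i (action_box hM gamma0_gt0 adm run w k0) (astar_in hM)).
Qed.

Local Notation m := (Num.min (2 * c2) (c1 - c2)).

Lemma rate_exponent : 0 <= m <= 1.
Proof.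
case: adm => h1 h2 h3 h4; rewrite le_min ge_min; apply/andP; split.
  by apply/andP; split; lra.
by apply/orP; right; lra.
Qed.

(** The recursion bounds the deviation of the iterates; projecting them onto the
    shrunk boxes adds a term of order [k ^ (- (2 * c1))], which is smaller. *)
Lemma msd_rate : 4 <= A_const M * (beta0 * gamma0) ->
  exists2 Xi, 0 <= Xi & forall k, (0 < k)%N ->
    (msd M a k <= (Xi * k%:R `^ (- m))%:E)%E.
Proof.
move=> large; have [r r0 margin] := astar_margin hM.
pose u k := \sum_i dev2 M beta0 gamma0 c1 c2 a k i.
have u0 k : 0 <= u k by apply: sumr_ge0 => i _; exact: dev2_ge0.
pose Bd := \sum_(i < n.+1) diameter M ^+ 2.
have uB k : (2 <= k)%N -> 0 <= u k <= Bd.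
  move=> k2; rewrite u0; apply: ler_sum => i _.
  rewrite -[leRHS](Ex_cst P); apply: le_Ex => [||w].
  - exact: (L1_dev2 hM gamma0_gt0 adm run).
  - exact: L1_cst.
  rewrite -[leLHS]real_normK ?num_real// lerXn2r ?nnegrE ?(diameter_ge0 hM)//.
  exact: (actions_coord_le i (iterate_box hM _ _ _ _ _ _ w) (astar_in hM)).
pose K := residual_const M r * residual_scale n beta0 gamma0 * rate_const M.
(* The weight in Young's inequality: any positive [e] with [K * e <= 1] would do. *)
pose e := (`|K| + 1)^-1.
have e0 : 0 < e by rewrite invr_gt0 ltr_wpDl.
have small : K * e <= 1.
  by rewrite ler_pdivrMr ?ltr_wpDl// mul1r (le_trans (ler_norm _))// lerDl.
have m1 : m <= 2 * c2 by rewrite ge_min lexx.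
have m2 : m <= c1 - c2 by rewrite ge_min lexx orbT.
have step k : (2 <= k)%N -> u k.+1 <= (1 - 2 * k%:R `^ (- (c1 + c2))) * u k +
    `|forcing_const M beta0 gamma0 c1 c2 r e| * k%:R `^ (- (c1 + c2) - m).
  move=> k2; apply: le_trans (dev2_step hM beta0_gt0 gamma0_gt0 adm run k2
    r0 margin e0 m1 m2 small large) _.
  by rewrite lerD2l ler_wpM2r ?powR_ge0// ler_norm.
have s01 : 1 / 2 <= c1 + c2 <= 1.
  by case: adm => h1 h2 h3 h4; apply/andP; split; lra.
have [X hX] := rate_of_recursion s01 rate_exponent (normr_ge0 _) uB step.
pose bc := boundary_const M gamma0 c1 c2 r.
have bc0 : 0 <= bc by exact: boundary_const_ge0.
have rc0 := rate_const_ge0 M.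
have B0 : 0 <= Bd by apply: sumr_ge0 => i _; exact: sqr_ge0.
have nb0 : 0 <= n.+1%:R * (bc * rate_const M).
  by apply: mulr_ge0 => //; exact: mulr_ge0.
exists (`|X| + n.+1%:R * (bc * rate_const M) + Bd) => [|k k0].
  by apply: addr_ge0 => //; exact: addr_ge0.
rewrite msdE// lee_fin; apply: (@le_trans _ _ (\sum_i
    Ex (fun w => (a k w 0 i - astar M 0 i) ^+ 2))).
  rewrite ler_piMl ?invf_le1 ?ler1n ?ltr0n//.
  by apply: sumr_ge0 => i _; apply: Ex_ge0 => w; exact: sqr_ge0.
have [k1|k1] := ltnP 1 k; last first.
  have -> : k = 1%N by apply/eqP; rewrite eqn_leq k1.
  rewrite powR1 mulr1; apply: (@le_trans _ _ Bd).
    by apply: ler_sum => i _; exact: Ex_distance_le.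
  by rewrite lerDr addr_ge0.
apply: (@le_trans _ _ (u k + n.+1%:R * (bc * rate_const M) * k%:R `^ (- (2 * c1)))).
  rewrite -mulrA mulr_natl -[X in _ *+ X]card_ord -sumr_const -big_split/=.
  apply: ler_sum => i _; rewrite -mulrA.
  exact: (Ex_action_dev hM gamma0_gt0 adm run k1 r0 margin).
have p0 := powR_ge0 k%:R (- m) : (0 : R) <= _.
have hp : k%:R `^ (- (2 * c1)) <= k%:R `^ (- m) :> R.
  rewrite ler_powR ?ler1n// lerN2; apply: (le_trans m2).
  by case: adm => h1 h2 h3 h4; lra.
have h1 := hX k k1; have h2 := ler_wpM2l nb0 hp.
have h3 := ler_wpM2r p0 (ler_norm X); have h4 := mulr_ge0 B0 p0.
apply: (le_trans (lerD h1 h2)); rewrite -[leLHS]addr0.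
rewrite [leRHS]mulrDl [X in _ <= X + _]mulrDl.
by apply: lerD => //; exact: lerD.
Qed.

End rate.

(** * The best admissible exponents *)

Section admissible_exponents.
Context (R : realType).

Lemma admissible_optimum : admissible (3 / 4 : R) (1 / 4).
Proof. by split; lra. Qed.

(** The first exponent is at most [1 / 2] if [c2 <= 1 / 4]; otherwise the second
    one is, as [c1 - c2 <= 1 - 2 * c2]. *)
Lemma rate_exponent_le (c1 c2 : R) : admissible c1 c2 ->
  Num.min (2 * c2) (c1 - c2) <= 1 / 2.
Proof.
move=> [h1 h2 h3 h4]; rewrite ge_min; apply/orP.
by have [h|h] := leP c2 (1 / 4); [left|right]; lra.
Qed.

Lemma optimal_exponent :
  Num.min (2 * (1 / 4)) (3 / 4 - 1 / 4) = 1 / 2 :> R.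
Proof.
have -> : 2 * (1 / 4) = 1 / 2 :> R by field.
have -> : 3 / 4 - 1 / 4 = 1 / 2 :> R by field.
exact: minxx.
Qed.

End admissible_exponents.

Section convergence_rate.
Context (R : realType) (d : measure_display) (Omega : measurableType d)
  (P : probability Omega R) (d' : measure_display) (T : measurableType d')
  (n : nat) (M : dosp_model P T n) (hM : dosp_assumptions M).

(** Since [q_a <= 1], [k ^ (- m)] is at most [(q_a * k) ^ (- m)]; the factor
    [1 / q_r] is absorbed by [Xi]. *)
Lemma convergence_rate (c1 c2 : R) : admissible c1 c2 ->
  exists B : R, forall beta0 gamma0 : R, 0 < beta0 -> 0 < gamma0 ->
    B <= beta0 * gamma0 ->
    forall a, dosp_run M (StepSize beta0 gamma0 c1 c2) a ->
    exists Xi : R, forall k : nat, (0 < k)%N ->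
      (msd M a k <= (Xi * (qr M)^-1 *
         (qa M * k%:R) `^ (- Num.min (2 * c2) (c1 - c2)))%:E)%E.
Proof.
move=> adm.
have A0 : 0 < A_const M.
  apply: mulr_gt0; last exact: (alpha_F_gt0 hM).
  by apply: mulr_gt0 => //; rewrite exprn_gt0// (sigma_Phi_gt0 hM).
exists (4 / A_const M) => beta0 gamma0 b0 g0 large a run.
have [|X X0 hX] := msd_rate hM b0 g0 adm run.
  by move: large; rewrite ler_pdivrMr// mulrC.
exists (X * qr M) => k k0; apply: (le_trans (hX k k0)).
rewrite lee_fin mulfK ?gt_eqF ?(qr_gt0 hM)// ler_wpM2l//.
set m := Num.min _ _; have /andP[m0 _] : 0 <= m <= 1 := rate_exponent adm.
have kR : (0 : R) < k%:R by rewrite ltr0n.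
have qa0 := qa_gt0 hM.
rewrite !powRN lef_pV2 ?posrE ?powR_gt0 ?mulr_gt0//.
rewrite ge0_ler_powR ?nnegrE ?mulr_ge0 ?(ltW qa0)//.
by rewrite ler_piMl// (qa_le1 hM).
Qed.

End convergence_rate.

Theorem theorem4 (R : realType) (d : measure_display)
    (Omega : measurableType d) (P : probability Omega R)
    (d' : measure_display) (T : measurableType d') (n : nat)
    (M : dosp_model P T n) (hM : dosp_assumptions M) :
  (forall c1 c2 : R, admissible c1 c2 ->
    exists B : R, forall beta0 gamma0 : R, 0 < beta0 -> 0 < gamma0 ->
      B <= beta0 * gamma0 ->
      forall (a : nat -> Omega -> 'rV[R]_n.+1) (K0 K1 : nat) (C : R) (K2 : nat),
        dosp_run M (StepSize beta0 gamma0 c1 c2) a ->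
        dosp_constants M (StepSize beta0 gamma0 c1 c2) K0 K1 C K2 ->
        exists Xi : R, forall k : nat, (K2 <= k)%N ->
          (msd M a k <=
            (Xi * (qr M)^-1 *
             (qa M * k%:R) `^ (- Num.min (2 * c2) (c1 - c2)))%:E)%E) /\
  [/\ admissible (3 / 4 : R) (1 / 4),
      (forall c1 c2 : R, admissible c1 c2 ->
        Num.min (2 * c2) (c1 - c2)
          <= Num.min (2 * (1 / 4)) (3 / 4 - 1 / 4)) &
      exists B : R, forall beta0 gamma0 : R, 0 < beta0 -> 0 < gamma0 ->
        B <= beta0 * gamma0 ->
        forall (a : nat -> Omega -> 'rV[R]_n.+1) (K0 K1 : nat) (C : R)
               (K2 : nat),
          dosp_run M (StepSize beta0 gamma0 (3 / 4) (1 / 4)) a ->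
          dosp_constants M (StepSize beta0 gamma0 (3 / 4) (1 / 4))
            K0 K1 C K2 ->
          (fun k : nat => fine (msd M a k)) =O_\oo
          (fun k : nat => (qr M)^-1 * (qa M * k%:R) `^ (- (1 / 2)))].
Proof.
split=> [c1 c2 adm|].
  have [B hB] := convergence_rate hM adm.
  exists B => beta0 gamma0 b0 g0 large a K0 K1 C K2 run consts.
  have [Xi hXi] := hB _ _ b0 g0 large a run.
  exists Xi => k kK2; apply: hXi.
  apply: leq_trans (K0_gt0 consts) _; apply: leq_trans (K1_ge consts) _.
  exact: leq_trans (K2_ge consts) kK2.
split; first exact: admissible_optimum.
  by move=> c1 c2 adm; rewrite optimal_exponent; exact: rate_exponent_le.
have [B hB] := convergence_rate hM (admissible_optimum R).
exists B => beta0 gamma0 b0 g0 large a K0 K1 C K2 run consts.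
have [Xi hXi] := hB _ _ b0 g0 large a run.
apply/eqOP; near=> c.
near=> k.
have k0 : (0 < k)%N by near: k; exact: nbhs_infty_gt.
have := hXi k k0; rewrite optimal_exponent (msdE hM g0 (admissible_optimum R) run k0).
rewrite lee_fin /= => h.
have rhs0 : 0 <= (qr M)^-1 * (qa M * k%:R) `^ (- (1 / 2)).
  by rewrite mulr_ge0 ?powR_ge0// invr_ge0 (ltW (qr_gt0 hM)).
rewrite ger0_norm; last first.
  by rewrite mulr_ge0// sumr_ge0// => i _; apply: Ex_ge0 => w; exact: sqr_ge0.
rewrite (ger0_norm rhs0); apply: (le_trans h); rewrite -mulrA ler_wpM2r//.
Unshelve. all: by end_near.
Qed.
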